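(* Let $G$ be a finite group, $N$ a normal subgroup of $G$, $b$ a $p$-block of $N$ and $B$ a $p$-block of $G$ covering $b$, with defect group $D_B$ and Cartan matrix $(c_{ij})$. If $l(b)=1$ and $D_B\le N$, then $$c_{ij}\le |D_B|,\qquad i,j=1,2,\dots,l(B).$$ In particular, if $B$ is a $p$-block of $G$ having a defect group $D_B$ that is normal in $G$, then $c_{ij}\le|D_B|$ for $i,j=1,2,\dots,l(B)$.
   Context: Blocks are $p$-blocks over a field $F$ of characteristic $p>0$ that is a splitting field for the groups considered. $l(B)$ (respectively $l(b)$) denotes the number of irreducible Brauer characters in $B$ (respectively $b$). The Cartan matrix $(c_{ij})$ of $B$ has as entries the multiplicities $c_{ij}$ of the $j$-th simple $B$-module as a composition factor of the projective cover of the $i$-th simple $B$-module. *)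

(* Defs.v *)
From HB Require Import structures.
From mathcomp Require Import all_boot all_order all_fingroup all_algebra.
From mathcomp Require Import all_solvable all_field all_character.

Set Implicit Arguments.
Unset Strict Implicit.
Unset Printing Implicit Defensive.

Import GRing.Theory.
Local Open Scope ring_scope.

(* Modules are finite-dimensional and are given by matrix representations;   *)
(* they act on row vectors from the right, so maps compose left to right and *)
(* a matrix is surjective when it is row_full.  The group algebra FG is the  *)
(* row space of group_ring F G, i.e. FG in its regular representation, and   *)
(* gring_op rG a is the action of a : FG on the module of rG.                *)

Section Blocks.

Variables (F : fieldType) (gT : finGroupType) (G : {group gT}).
Local Notation aG := (regular_repr F G).
Implicit Types (e a : 'M[F]_#|G|) (D Q : {group gT}) (M S P : representation F G).

(* A p-block is represented by its block idempotent, a primitive idempotent  *)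
(* of the center of FG.                                                      *)
Definition is_block e : Prop :=
  [/\ (e \in 'Z(group_ring F G))%MS, e *m e = e, e != 0
    & forall f : 'M[F]_#|G|, (f \in 'Z(group_ring F G))%MS ->
        f *m f = f -> e *m f = f -> f = 0 \/ f = e].

Definition in_block e M : Prop := gring_op M e = 1%:M.

Definition fixed_by D a : Prop :=
  (a \in group_ring F G)%MS /\ {in D, forall x, aG x *m a = a *m aG x}.

(* Relative trace Tr_D^G : (FG)^D -> Z(FG), summed over the right cosets Dx. *)
Definition rel_trace D a : 'M[F]_#|G| :=
  \sum_(C in rcosets D G) aG (repr C)^-1%g *m a *m aG (repr C).

Definition is_rel_trace D e : Prop :=
  exists2 a, fixed_by D a & e = rel_trace D a.

(* Defect groups are the minimal D <= G with e \in Tr_D^G((FG)^D).           *)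
Definition is_defect_group e D : Prop :=
  [/\ D \subset G, is_rel_trace D e
    & forall Q, Q \proper D -> ~ is_rel_trace Q e].

Definition is_hom M1 M2 (f : 'M[F]_(rdegree M1, rdegree M2)) : Prop :=
  {in G, forall x, M1 x *m f = f *m M2 x}.

Definition is_projective P : Prop :=
  forall M1 M2 (f : 'M_(rdegree M1, rdegree M2))
               (g : 'M_(rdegree P, rdegree M2)),
    is_hom f -> row_full f -> is_hom g ->
    exists2 h : 'M_(rdegree P, rdegree M1), is_hom h & h *m f = g.

(* The last clause says that u is an essential epimorphism.                  *)
Definition is_projective_cover P S (u : 'M[F]_(rdegree P, rdegree S)) : Prop :=
  [/\ is_projective P, is_hom u, row_full u
    & forall U : 'M_(rdegree P), mxmodule P U ->
        row_full (U *m u) -> row_full U].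

(* The simple module S occurs exactly c times in a composition series of M.  *)
Definition has_composition_mult M S (c : nat) : Prop :=
  exists (Us : seq 'M[F]_(rdegree M)) (compU : mx_composition_series M Us)
         (I : {set 'I_(size Us)}),
    [/\ (last 0 Us :=: 1%:M)%MS,
        forall i : 'I_(size Us), i \in I <-> mx_rsim (series_repr i compU) S
      & #|I| = c].

(* S lists the simple modules of the block, once each up to isomorphism.     *)
Definition simple_modules_of e l (S : 'I_l -> representation F G) : Prop :=
  [/\ forall i, mx_irreducible (S i) /\ in_block e (S i),
      forall i j, mx_rsim (S i) (S j) -> i = j
    & forall M, mx_irreducible M -> in_block e M -> exists i, mx_rsim M (S i)].

Definition is_cartan_matrix e l (c : 'M[nat]_l) : Prop :=
  exists2 S : 'I_l -> representation F G, simple_modules_of e S &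
    forall i j, exists P (u : 'M_(rdegree P, rdegree (S i))),
      is_projective_cover u /\ has_composition_mult P (S j) (c i j).

End Blocks.

(* A block B of G covers a block b of N if some module in B has, on          *)
(* restriction to N, a nonzero component in b.                               *)
Definition covers (F : fieldType) (gT : finGroupType) (G N : {group gT})
    (sNG : N \subset G) (B : 'M[F]_#|G|) (b : 'M[F]_#|N|) : Prop :=
  exists2 M : representation F G,
    in_block B M & gring_op (subg_repr M sNG) b != 0.

(* Brauer lift z ^+ k |-> w ^+ k from the m-th roots of unity in an          *)
(* extension of F to those in the complex numbers; F itself need not contain *)
(* the eigenvalues of p-regular elements, even if it is a splitting field.   *)
Record brauer_lift (F : fieldType) (m : nat) := BrauerLift {
  lift_field : fieldType;
  lift_embed : {rmorphism F -> lift_field};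
  lift_root : lift_field;
  lift_value : algC;
  lift_rootP : m.-primitive_root lift_root;
  lift_valueP : m.-primitive_root lift_value
}.

Section BrauerCharacters.

Variables (F : fieldType) (m : nat) (beta : brauer_lift F m).
Variables (p : nat) (gT : finGroupType) (G : {group gT}).
Implicit Types M : representation F G.

(* The sum of the lifts of the eigenvalues of x on M, with multiplicity; x   *)
(* should be a p-regular element whose order divides m.                      *)
Definition brauer_char M (x : gT) : algC :=
  \sum_(k < m) (mup (lift_root beta ^+ k)
                    (char_poly (map_mx (lift_embed beta) (M x))))%:R
               * lift_value beta ^+ k.

Definition same_brauer_char M1 M2 : Prop :=
  {in G, forall x, (p^'.-elt x)%g -> brauer_char M1 x = brauer_char M2 x}.

(* l(B) = l: the irreducible modules in the block afford exactly l distinct  *)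
(* Brauer characters.                                                        *)
Definition block_l (e : 'M[F]_#|G|) (l : nat) : Prop :=
  exists S : 'I_l -> representation F G,
    [/\ forall i, mx_irreducible (S i) /\ in_block e (S i),
        forall i j, same_brauer_char (S i) (S j) -> i = j
      & forall M, mx_irreducible M -> in_block e M ->
          exists i, same_brauer_char M (S i)].

End BrauerCharacters.

(* Main.v *)
Require Import Defs.
From HB Require Import structures.
From mathcomp Require Import all_boot all_order all_fingroup all_algebra.
From mathcomp Require Import all_solvable all_field all_character.
From mathcomp Require Import mpoly.
From Stdlib Require Import Classical ClassicalEpsilon.

Set Implicit Arguments.
Unset Strict Implicit.
Unset Printing Implicit Defensive.

Import Order.TTheory GRing.Theory Num.Theory.
Local Open Scope ring_scope.

(** Let S be the only simple module of b, s its degree, and let S_i be the simple modules of B with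
    projective covers P_i. Let r_i be the dimension of the b-component of S_i restricted to N; since
    B covers b, r_i > 0 ([cover_nonzero]). Counting composition factors, c_ij r_j is at most the
    dimension of the b-component of P_i. Restricted to N, P_i is projective, and FNb has only S as
    composition factor, so s times this dimension is rank b times dim Hom_N(P_i, S)
    ([op_rank_higman]). Because D <= N, averaging over cosets of D shows that every N-homomorphism
    from P_i to S factors through S_i ([head_hom_vanish]), and s dim Hom_N(S_i, S) <= r_i. Hence
    c_ij r_j s^2 <= (rank b) r_i. The Cartan matrix is symmetric, so r_i <= r_j may be assumed, and
    c_ij <= rank b / s^2 ([cartan_bound]).

    It remains to see that rank b <= |D| s^2. If D is normal in G, take N = D and b = 1: the only
    simple module is trivial and rank b = |D| ([normal_defect_bound]). In general rank b divides |D|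
    s^2 ([block_rank_dvd]), which is checked one prime at a time.

    Linear independence of Brauer characters ([brauer_independence]) makes every additive invariant
    vanish on a virtual module with zero Brauer character. This is applied to a product of
    differences between integers and permutation modules on cosets of p'-subgroups
    ([coset_product]), where all invariants are computable. It gives, for each prime q other than p,
    that rank b divides s^2 k with k prime to q ([block_rank_dvd_prime]), and also the norm formula
    (rank b) times the sum of |phi_S(x)|^2 over p-regular x equals |N| s^2 ([block_norm]).

    For the prime p, S is an N-summand of a simple module of B, on which the identity is a relative
    trace from D. A determinant argument ([rank_dvd_orbits]) then shows that the eigenvalue
    multiplicities on S of a p-regular x are divisible by |C_N(x)|_p / |D| when this is an integer
    ([eigenvalue_mult_dvd]). So |D| phi_S(x) / |C_N(x)|_p is an algebraic integer, and the norm
    formula, summed by classes, yields that rank b divides |D| s^2 |N|_p'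
    ([block_rank_dvd_char]). *)

(** * Exact sequences, composition factors and homomorphisms *)

Section Exact.

Variables (F : fieldType) (gT : finGroupType) (G : {group gT}).
Implicit Types M P S T : representation F G.

Definition exact M1 M M2 (i : 'M[F]_(rdegree M1, rdegree M))
    (p : 'M[F]_(rdegree M, rdegree M2)) :=
  [/\ is_hom i, is_hom p, row_free i, row_full p & (kermx p :=: i)%MS].

Lemma exact_comp0 M1 M M2 (i : 'M_(rdegree M1, rdegree M))
    (p : 'M_(rdegree M, rdegree M2)) : exact i p -> i *m p = 0.
Proof. by case=> _ _ _ _ kp; apply/sub_kermxP; rewrite kp. Qed.

Lemma exact_degree M1 M M2 (i : 'M_(rdegree M1, rdegree M))
    (p : 'M_(rdegree M, rdegree M2)) :
  exact i p -> rdegree M = (rdegree M1 + rdegree M2)%N.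
Proof.
case=> _ _ fi /eqP fp kp; have := mxrank_ker p.
rewrite kp (eqP fi) fp => ->; rewrite subnK // -fp; exact: rank_leq_row.
Qed.

Lemma exact_submod M (U : 'M_(rdegree M)) (modU : mxmodule M U) :
  @exact (Representation (submod_repr modU)) M
         (Representation (factmod_repr modU))
         (val_submod 1%:M) (in_factmod U 1%:M).
Proof.
split=> [x Gx | x Gx | | |] /=.
- by rewrite -val_submodE -(val_submodJ modU) // mul1mx.
- by rewrite -in_factmodE -(in_factmodJ modU) // mul1mx.
- by rewrite /row_free val_submod1.
- apply/row_fullP; exists (val_factmod 1%:M).
  by rewrite -in_factmodE val_factmodK.
apply/eqmxP; rewrite !val_submod1; apply/andP; split.
  by rewrite -in_factmod_eq0 in_factmodE mulmx_ker.
by apply/sub_kermxP; rewrite -in_factmodE; apply/eqP; rewrite in_factmod_eq0 submx_refl.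
Qed.

Definition subquotient_closed (C : representation F G -> Prop) :=
  forall M1 M M2 (i : 'M_(rdegree M1, rdegree M))
    (p : 'M_(rdegree M, rdegree M2)), exact i p -> C M -> C M1 /\ C M2.

Definition additive_on_exact (V : nmodType) (f : representation F G -> V) :=
  (forall M, rdegree M = 0 -> f M = 0) /\
  forall M1 M M2 (i : 'M_(rdegree M1, rdegree M))
    (p : 'M_(rdegree M, rdegree M2)), exact i p -> f M = f M1 + f M2.

Definition subadditive_on_exact (f : representation F G -> nat) :=
  (forall M, rdegree M = 0 -> f M = 0) /\
  forall M1 M M2 (i : 'M_(rdegree M1, rdegree M))
    (p : 'M_(rdegree M, rdegree M2)), exact i p -> (f M <= f M1 + f M2)%N.

(** A single list of factors serves three kinds of induction along exact sequences: inherited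
    properties, subadditive bounds such as dimensions of Hom spaces, and additive invariants such as
    degrees or Brauer characters. *)
Lemma composition_factors M : exists k (T : 'I_k -> representation F G),
  [/\ forall j, mx_irreducible (T j),
      forall C, subquotient_closed C -> C M -> forall j, C (T j),
      forall f, subadditive_on_exact f -> (f M <= \sum_j f (T j))%N
    & forall (V : nmodType) (f : representation F G -> V), additive_on_exact f ->
        f M = \sum_j f (T j)].
Proof.
have [n] := ubnP (rdegree M); elim: n => // n IHn in M *; rewrite ltnS => leMn.
have [M0 | M_gt0] := posnP (rdegree M).
  exists 0, (fun _ => M); split=> [[]//|C _ _ []// | f [f0 _] | V f [f0 _]].
    by rewrite f0.
  by rewrite big_ord0 f0.
have [irrM | redM] := classic (mx_irreducible M).
  exists 1, (fun _ => M); split=> // [f _ | V f _]; by rewrite big_ord1.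
have [U modU [nzU nfU]]: exists2 U : 'M_(rdegree M), mxmodule M U & U != 0 /\ ~~ row_full U.
  apply: NNPP => H; case: redM; apply/mx_irrP; split=> // U modU nzU.
  by apply/negPn/negP=> nfU; case: H; exists U.
have exU := exact_submod modU; have degU := exact_degree exU.
rewrite /= in degU.
have r_gt0: (0 < \rank U)%N by rewrite lt0n mxrank_eq0.
have r_lt: (0 < \rank (cokermx U))%N.
  rewrite mxrank_coker subn_gt0 ltn_neqAle rank_leq_col andbT.
  exact: nfU.
have [/= | k1 [T1 [irr1 C1 s1 a1]]] := IHn (Representation (submod_repr modU)).
  by apply: leq_trans leMn; rewrite ltn_neqAle rank_leq_col andbT.
have [/= | k2 [T2 [irr2 C2 s2 a2]]] := IHn (Representation (factmod_repr modU)).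
  by apply: leq_trans leMn; rewrite mxrank_coker ltn_subrL r_gt0.
exists (k1 + k2)%N.
exists (fun j => match split j with inl j1 => T1 j1 | inr j2 => T2 j2 end).
have sumE (V : nmodType) (f : representation F G -> V) :
  \sum_(j < k1 + k2) f (match split j with inl j1 => T1 j1 | inr j2 => T2 j2 end)
  = \sum_j f (T1 j) + \sum_j f (T2 j).
  rewrite big_split_ord /=; congr (_ + _); apply: eq_bigr => j _.
    by rewrite (unsplitK (inl j)).
  by rewrite (unsplitK (inr j)).
split=> [j | C clC CM j | f subf | V f addf].
- by case: (split j).
- have [CU CU'] := clC _ _ _ _ _ exU CM.
  by case: (split j) => j'; [apply: C1 | apply: C2].
- have /= -> := sumE nat f; apply: leq_trans (proj2 subf _ _ _ _ _ exU) _.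
  by apply: leq_add; [apply: s1 | apply: s2].
by rewrite sumE (proj2 addf _ _ _ _ _ exU) -(a1 _ _ addf) -(a2 _ _ addf).
Qed.

Lemma is_homP M1 M2 (f : 'M_(rdegree M1, rdegree M2)) :
  is_hom f <-> {in G, forall x, M1 x^-1%g *m f *m M2 x = f}.
Proof.
split=> [homf x Gx | fixf x Gx].
  by rewrite homf ?groupV // -mulmxA -repr_mxM ?groupV // mulVg repr_mx1 mulmx1.
rewrite -[in LHS](fixf x) // !mulmxA -repr_mxM ?groupV //.
by rewrite mulgV repr_mx1 mul1mx.
Qed.

Lemma hom_comp M1 M2 M3 (f : 'M_(rdegree M1, rdegree M2))
    (g : 'M_(rdegree M2, rdegree M3)) : is_hom f -> is_hom g -> is_hom (f *m g).
Proof. by move=> hf hg x Gx; rewrite mulmxA hf // -!mulmxA hg. Qed.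

Lemma hom1 M : @is_hom F gT G M M 1%:M.
Proof. by move=> x Gx; rewrite mulmx1 mul1mx. Qed.

Lemma hom_gring M1 M2 (f : 'M_(rdegree M1, rdegree M2)) a :
  is_hom f -> gring_op M1 a *m f = f *m gring_op M2 a.
Proof.
move=> homf; rewrite !gring_opE /gring_mx /= !mulmx_sum_row !linear_sum /=.
rewrite mulmx_suml ?mulmx_sumr; apply: eq_bigr => i _.
by rewrite !linearZ /= -scalemxAl !rowK !mxvecK homf ?enum_valP.
Qed.

Lemma mxmodule_kermx M1 M2 (f : 'M_(rdegree M1, rdegree M2)) :
  is_hom f -> mxmodule M1 (kermx f).
Proof.
move=> homf; apply/mxmoduleP=> x Gx; apply/sub_kermxP.
by rewrite -mulmxA homf // mulmxA mulmx_ker mul0mx.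
Qed.

Lemma mxmodule_image M1 M2 (f : 'M_(rdegree M1, rdegree M2)) m
    (U : 'M_(m, rdegree M1)) :
  is_hom f -> mxmodule M1 U -> mxmodule M2 (U *m f).
Proof.
move=> homf modU; apply/mxmoduleP=> x Gx.
by rewrite -mulmxA -homf // mulmxA submxMr // (mxmoduleP modU).
Qed.

Lemma irr_kermx0 M1 M2 (f : 'M_(rdegree M1, rdegree M2)) :
  mx_irreducible M1 -> is_hom f -> f != 0 -> row_free f.
Proof.
move=> /mx_irrP[_ irrM] homf nzf; rewrite -kermx_eq0.
apply: contraR nzf => /(irrM _ (mxmodule_kermx homf)) fullK.
by rewrite -sub1mx in fullK; have/sub_kermxP := fullK; rewrite mul1mx => ->.
Qed.

Lemma irr_row_full M1 M2 (f : 'M_(rdegree M1, rdegree M2)) :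
  mx_irreducible M2 -> is_hom f -> f != 0 -> row_full f.
Proof.
move=> /mx_irrP[_ irrM] homf nzf.
have := irrM <<f>>%MS; rewrite /row_full genmxE; apply.
  rewrite (eqmx_module _ (genmxE _)) -[f]mul1mx.
  exact: mxmodule_image homf (mxmodule1 _).
by rewrite -mxrank_eq0 genmxE mxrank_eq0.
Qed.

Lemma irr_hom_rsim M1 M2 (f : 'M_(rdegree M1, rdegree M2)) :
  mx_irreducible M1 -> mx_irreducible M2 -> is_hom f -> f != 0 ->
  mx_rsim M1 M2.
Proof.
move=> irr1 irr2 homf nzf.
have /eqP ff := irr_kermx0 irr1 homf nzf.
have /eqP fu := irr_row_full irr2 homf nzf.
by exists f => //; [rewrite -ff fu | apply/eqP].
Qed.

End Exact.

(** * Linear maps between matrix spaces *)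

Section LinearMatrix.

Variable F : fieldType.

Lemma rank_linear_inj a b m n k l (A : 'M[F]_(a, m * n)) (B : 'M[F]_(b, k * l))
    (T : {linear 'M[F]_(m, n) -> 'M[F]_(k, l)}) :
  (forall f, (mxvec f <= A)%MS -> (mxvec (T f) <= B)%MS) ->
  (forall f, (mxvec f <= A)%MS -> T f = 0 -> f = 0) ->
  (\rank A <= \rank B)%N.
Proof.
move=> sTB injT; rewrite -(mxrank_mul_ker A (lin_mx T)).
have -> : (A :&: kermx (lin_mx T))%MS = 0.
  apply/eqP; rewrite -submx0; apply/rV_subP=> u.
  rewrite sub_capmx -[u]vec_mxK => /andP[Au /sub_kermxP].
  rewrite mul_vec_lin => /eqP; rewrite mxvec_eq0 => /eqP Tu0.
  by rewrite (injT _ Au Tu0) linear0 sub0mx.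
rewrite mxrank0 addn0; apply: mxrankS; apply/rV_subP=> u /submxP[v ->].
rewrite mulmxA; set w := v *m A; rewrite -[w]vec_mxK mul_vec_lin; apply: sTB.
by rewrite vec_mxK submxMl.
Qed.

Lemma eq_lin_mx m n k (A B : 'M[F]_(m * n, k)) :
  (forall f : 'M_(m, n), mxvec f *m A = mxvec f *m B) -> A = B.
Proof.
by move=> eqAB; apply/row_matrixP=> i; rewrite !rowE -[delta_mx _ _]vec_mxK.
Qed.

Lemma mxvec_dot m n (f g : 'M[F]_(m, n)) :
  (mxvec f *m (mxvec g)^T) 0 0 = \tr (f *m g^T).
Proof.
rewrite mxE (reindex _ (curry_mxvec_bij _ _)) /=.
rewrite (eq_bigr (fun u => f u.1 u.2 * g u.1 u.2)); last first.
  by move=> [i j] _; rewrite !mxE /= -!(mxvecE f) -!(mxvecE g) !mxvecE.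
rewrite -(pair_bigA _ (fun i j => f i j * g i j)) /=.
by apply: eq_bigr => i _; rewrite mxE; apply: eq_bigr => j _; rewrite mxE.
Qed.

Lemma eq_lin_mxP m n k l (A B : 'M[F]_(m * n, k * l)) :
  (forall f g, (mxvec f *m A *m (mxvec g)^T) 0 0
             = (mxvec f *m B *m (mxvec g)^T) 0 0) -> A = B.
Proof.
move=> eqAB; apply: eq_lin_mx => f; apply/rowP=> j.
have := eqAB f (vec_mx (delta_mx 0 j)); rewrite vec_mxK trmx_delta.
by rewrite -!colE !mxE.
Qed.

(** For the trace form of [mxvec_dot] the adjoint of f -> A f B is g -> A^T g B^T. This is what
    relates the trace maps on Hom(P, Q) and Hom(Q, P). *)
Lemma lin_mx_tr m n (A : 'M[F]_m) (B : 'M[F]_n) :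
  (lin_mx (mulmx A \o mulmxr B))^T = lin_mx (mulmx A^T \o mulmxr B^T).
Proof.
apply: eq_lin_mxP => f g; rewrite mul_vec_lin mxvec_dot /=.
rewrite -[in LHS]mulmxA -trmx_mul mul_vec_lin mxvec_dot /=.
by rewrite !trmx_mul -!mulmxA [RHS]mxtrace_mulC !mulmxA.
Qed.

End LinearMatrix.

(** * Hom modules, Higman's criterion and the symmetry of Hom for projectives *)

Section HomRepr.

Variables (F : fieldType) (gT : finGroupType) (G : {group gT}).

Section Def.

Variables (n1 n2 : nat) (M1 : mx_representation F G n1).
Variable M2 : mx_representation F G n2.

Definition hom_mx (x : gT) := lin_mx (mulmx (M1 x^-1%g) \o mulmxr (M2 x)).

Lemma hom_mxE f x : mxvec f *m hom_mx x = mxvec (M1 x^-1%g *m f *m M2 x).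
Proof. by rewrite mul_vec_lin /= mulmxA. Qed.

Lemma hom_mx_repr : mx_repr G hom_mx.
Proof.
split=> [|x y Gx Gy]; apply: eq_lin_mx => f.
  by rewrite hom_mxE invg1 !repr_mx1 mul1mx !mulmx1.
by rewrite mulmxA !hom_mxE invMg !repr_mxM ?groupV // !mulmxA.
Qed.

Definition hom_repr := MxRepresentation hom_mx_repr.

(** This is dim Hom_H(M1, M2), the H-homomorphisms being the fixed points of the conjugation
    action. *)
Definition hdim (H : {set gT}) := \rank (rfix_mx hom_repr H).

Lemma sub_rfix_homP (H : {set gT}) f : reflect
  {in H, forall x, M1 x^-1%g *m f *m M2 x = f}
  (mxvec f <= rfix_mx hom_repr H)%MS.
Proof.
apply: (iffP (rfix_mxP (rG := hom_repr) H)) => fixf x Hx.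
  by apply: (can_inj mxvecK); rewrite -hom_mxE; apply: fixf.
by rewrite [LHS]hom_mxE fixf.
Qed.

End Def.

Definition ghom (M1 M2 : representation F G) : representation F G :=
  Representation (hom_repr M1 M2).

Implicit Types M P Q S T : representation F G.

Lemma sub_homP M1 M2 (f : 'M_(rdegree M1, rdegree M2)) :
  (mxvec f <= rfix_mx (hom_repr M1 M2) G)%MS <-> is_hom f.
Proof. by rewrite is_homP; split=> [/sub_rfix_homP|?]; last apply/sub_rfix_homP. Qed.

Lemma sub_homHP (H : {group gT}) M1 M2 (f : 'M_(rdegree M1, rdegree M2)) :
    H \subset G ->
  (mxvec f <= rfix_mx (hom_repr M1 M2) H)%MS <->
  {in H, forall x, M1 x *m f = f *m M2 x}.
Proof.
move=> sHG; split=> [/sub_rfix_homP fixf x Hx | homf].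
  rewrite -[in LHS](fixf x) // !mulmxA -repr_mxM ?groupV ?(subsetP sHG) //.
  by rewrite mulgV repr_mx1 mul1mx.
apply/sub_rfix_homP => x Hx; have Gx := subsetP sHG x Hx.
by rewrite -mulmxA -homf // mulmxA -repr_mxM ?groupV // mulVg repr_mx1 mul1mx.
Qed.

Lemma hdim_subaddr P M1 M M2 (i : 'M_(rdegree M1, rdegree M))
    (p : 'M_(rdegree M, rdegree M2)) :
  exact i p -> (hdim P M G <= hdim P M1 G + hdim P M2 G)%N.
Proof.
case=> homi homp fi fp kp.
rewrite /hdim -(mxrank_mul_ker _ (lin_mx (mulmxr p))) addnC leq_add //.
  apply: (rank_linear_inj (T := mulmxr (pinvmx i))) => f; rewrite sub_capmx.
    case/andP=> /sub_homP homf /sub_kermxP; rewrite mul_vec_lin => /eqP.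
    rewrite mxvec_eq0 => /eqP/sub_kermxP; rewrite kp => fi'.
    apply/sub_homP => x Gx /=; apply: (row_free_inj fi).
    by rewrite -[LHS]mulmxA mulmxKpV // -[RHS]mulmxA homi // [RHS]mulmxA mulmxKpV // homf.
  case/andP=> _ /sub_kermxP; rewrite mul_vec_lin => /eqP.
  rewrite mxvec_eq0 => /eqP/sub_kermxP; rewrite kp => fi' /= f0.
  by rewrite -(mulmxKpV fi') f0 mul0mx.
apply: mxrankS; apply/rV_subP=> u /submxP[v ->].
rewrite mulmxA; set w := v *m _; rewrite -[w]vec_mxK mul_vec_lin.
apply/sub_homP; apply: hom_comp homp; apply/sub_homP.
by rewrite vec_mxK submxMl.
Qed.

Lemma hdim_subaddl S M1 M M2 (i : 'M_(rdegree M1, rdegree M))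
    (p : 'M_(rdegree M, rdegree M2)) :
  exact i p -> (hdim M S G <= hdim M1 S G + hdim M2 S G)%N.
Proof.
case=> homi homp fi fp kp.
have facp (f : 'M_(rdegree M, rdegree S)) : i *m f = 0 -> p *m (pinvmx p *m f) = f.
  move=> f0; apply/eqP; rewrite -subr_eq0 mulmxA -{2}[f]mul1mx -mulmxBl.
  have: (p *m pinvmx p - 1%:M <= i)%MS.
    by rewrite -kp; apply/sub_kermxP; rewrite mulmxBl mul1mx mulmxKpV ?subrr.
  by case/submxP=> D ->; rewrite -mulmxA f0 mulmx0.
rewrite /hdim -(mxrank_mul_ker _ (lin_mx (mulmx i))) leq_add //.
  apply: mxrankS; apply/rV_subP=> u /submxP[v ->].
  rewrite mulmxA; set w := v *m _; rewrite -[w]vec_mxK mul_vec_lin.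
  apply/sub_homP; apply: hom_comp => //; apply/sub_homP.
  by rewrite vec_mxK submxMl.
apply: (rank_linear_inj (T := mulmx (pinvmx p))) => f; rewrite sub_capmx.
  case/andP=> /sub_homP homf /sub_kermxP; rewrite mul_vec_lin => /eqP.
  rewrite mxvec_eq0 => /eqP/facp fac.
  apply/sub_homP => x Gx /=; apply: (row_full_inj fp).
  by rewrite [LHS]mulmxA -homp // -[LHS]mulmxA fac homf // [RHS]mulmxA fac.
case/andP=> _ /sub_kermxP; rewrite mul_vec_lin => /eqP.
by rewrite mxvec_eq0 => /eqP/facp fac /= f0; rewrite -fac f0 mulmx0.
Qed.

Lemma hdim_degree0l M S : rdegree M = 0 -> hdim M S G = 0.
Proof.
by move=> M0; apply/eqP; rewrite -leqn0 (leq_trans (rank_leq_col _)) // M0.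
Qed.

Lemma hdim_degree0r P M : rdegree M = 0 -> hdim P M G = 0.
Proof.
by move=> M0; apply/eqP; rewrite -leqn0 (leq_trans (rank_leq_col _)) // M0 muln0.
Qed.

(** Higman's criterion for projectivity: the identity is the trace of a linear endomorphism. This
    form passes easily to restrictions and Hom modules. *)
Definition higman M :=
  exists a, \sum_(x in G) M x^-1%g *m a *m M x = 1%:M.

Definition trace_hom M1 M2 (f : 'M_(rdegree M1, rdegree M2)) :=
  \sum_(x in G) M1 x^-1%g *m f *m M2 x.

Lemma trace_hom_hom M1 M2 (f : 'M_(rdegree M1, rdegree M2)) :
  is_hom (trace_hom f).
Proof.
apply/is_homP=> x Gx; rewrite mulmx_sumr mulmx_suml /trace_hom.
rewrite [RHS](reindex_inj (mulIg x)) /=; apply: eq_big => y.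
  by rewrite groupMr.
by move=> Gy; rewrite invMg !repr_mxM ?groupV // !mulmxA.
Qed.

Lemma trace_homMr M1 M2 M3 (f : 'M_(rdegree M1, rdegree M2))
    (g : 'M_(rdegree M2, rdegree M3)) :
  is_hom g -> trace_hom f *m g = trace_hom (f *m g).
Proof.
move=> homg; rewrite mulmx_suml; apply: eq_bigr => x Gx.
by rewrite -!mulmxA homg.
Qed.

Lemma trace_homMl M1 M2 M3 (f : 'M_(rdegree M1, rdegree M2))
    (g : 'M_(rdegree M2, rdegree M3)) :
  is_hom f -> f *m trace_hom g = trace_hom (f *m g).
Proof.
move=> homf; rewrite mulmx_sumr; apply: eq_bigr => x Gx.
by rewrite !mulmxA homf ?groupV.
Qed.

(** Hom(P, -) is exact: a homomorphism [g] into the quotient lifts to the trace of [a *m g] followed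
    by a linear section of [p]. *)
Lemma hdim_additive P M1 M M2 (i : 'M_(rdegree M1, rdegree M))
    (p : 'M_(rdegree M, rdegree M2)) :
  higman P -> exact i p -> hdim P M G = (hdim P M1 G + hdim P M2 G)%N.
Proof.
case=> a Pa exip; apply/eqP; rewrite eqn_leq (hdim_subaddr P exip) /=.
case: exip => homi homp fi fp kp.
rewrite {3}/hdim -(mxrank_mul_ker _ (lin_mx (mulmxr p))) addnC leq_add //.
  apply: mxrankS; apply/rV_subP=> u; rewrite -[u]vec_mxK => /sub_homP homu.
  set g := vec_mx u in homu *.
  have -> : mxvec g = mxvec (trace_hom (a *m g *m pinvmx p)) *m lin_mx (mulmxr p).
    rewrite mul_vec_lin /= trace_homMr // mulmxKpV ?submx_full //.
    by rewrite -trace_homMr // /trace_hom Pa mul1mx.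
  by apply: submxMr; apply/sub_homP; apply: trace_hom_hom.
apply: (rank_linear_inj (T := mulmxr i)) => [f /sub_homP homf | f _ /= fi0].
  rewrite sub_capmx; apply/andP; split.
    by apply/sub_homP; apply: hom_comp.
  apply/sub_kermxP; rewrite mul_vec_lin /= -mulmxA.
  have -> : i *m p = 0 by apply/sub_kermxP; rewrite kp.
  by rewrite mulmx0 linear0.
by apply: (row_free_inj fi); rewrite mul0mx.
Qed.

(** Since the identity of P is a trace, so is every homomorphism from or to P; both Hom spaces are
    thus full images of trace maps. *)
Lemma hdim_trace P Q : higman P ->
  hdim P Q G = \rank (\sum_(x in G) hom_mx P Q x)%R
  /\ hdim Q P G = \rank (\sum_(x in G) hom_mx Q P x)%R.
Proof.
have trE M1 M2 (f : 'M_(rdegree M1, rdegree M2)) :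
    mxvec f *m (\sum_(x in G) hom_mx M1 M2 x) = mxvec (trace_hom f).
  rewrite mulmx_sumr linear_sum; apply: eq_bigr => x _; exact: hom_mxE.
have trS M1 M2 : ((\sum_(x in G) hom_mx M1 M2 x)%R <= rfix_mx (hom_repr M1 M2) G)%MS.
  apply/rV_subP=> u /submxP[v ->]; rewrite -[v]vec_mxK trE.
  apply/sub_homP; exact: trace_hom_hom.
case=> a Pa; split; apply/eqP; rewrite eqn_leq (mxrankS (trS _ _)) andbT;
  apply: mxrankS; apply/rV_subP=> u; rewrite -[u]vec_mxK => /sub_homP; set f := vec_mx u => homf.
  have -> : mxvec f = mxvec (trace_hom (a *m f)).
    by rewrite -trace_homMr // /trace_hom Pa mul1mx.
  by rewrite -trE submxMl.
have -> : mxvec f = mxvec (trace_hom (f *m a)).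
  by rewrite -trace_homMl // /trace_hom Pa mulmx1.
by rewrite -trE submxMl.
Qed.

(** After the substitution of x^-1 for x, the two trace maps are adjoint up to transposition of
    matrices, so they have the same rank. This takes the role of the symmetrising form of the group
    algebra. *)
Lemma hdim_sym P Q : higman P -> hdim P Q G = hdim Q P G.
Proof.
move/hdim_trace=> /(_ Q)[-> ->].
pose tr12 := lin_mx (@trmx F (rdegree P) (rdegree Q)).
pose tr21 := lin_mx (@trmx F (rdegree Q) (rdegree P)).
have tr12K : tr12 *m tr21 = 1%:M.
  by apply: eq_lin_mx => f; rewrite mulmxA !mul_vec_lin /= trmxK mulmx1.
have tr21K : tr21 *m tr12 = 1%:M.
  by apply: eq_lin_mx => f; rewrite mulmxA !mul_vec_lin /= trmxK mulmx1.
rewrite -[LHS]mxrank_tr.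
have -> : (\sum_(x in G) hom_mx P Q x)^T
        = tr12 *m (\sum_(x in G) hom_mx Q P x) *m tr21.
  rewrite linear_sum mulmx_sumr mulmx_suml (reindex_inj invg_inj) /=.
  apply: eq_big => x; first by rewrite groupV.
  move=> _; apply: eq_lin_mx => f; rewrite lin_mx_tr.
  by rewrite !mulmxA !mul_vec_lin /= !trmx_mul trmxK invgK !mulmxA.
have f21 : row_free tr21 by apply/row_freeP; exists tr12.
have f12 : row_full tr12 by apply/row_fullP; exists tr21.
by rewrite mxrankMfree // (eqmxMfull _ f12).
Qed.

Lemma higman_ghom P Q : higman P -> higman (ghom P Q).
Proof.
case=> a Pa; exists (lin_mx (mulmx a)); apply: eq_lin_mx => f.
rewrite mulmx_sumr mulmx1 -[in RHS](mul1mx f) -Pa mulmx_suml linear_sum.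
apply: eq_bigr => x Gx; rewrite !mulmxA !hom_mxE mul_vec_lin hom_mxE /= invgK.
by rewrite -!mulmxA -repr_mxM ?groupV // mulVg repr_mx1 mulmx1 !mulmxA.
Qed.

End HomRepr.

(** * Permutation modules on cosets and Frobenius reciprocity *)

Section CosetRepr.

Variables (F : fieldType) (gT : finGroupType) (G H : {group gT}).

Lemma group_mem_rcosets : (H : {set gT}) \in rcosets H G.
Proof. by apply/rcosetsP; exists 1%g; rewrite ?group1 ?mulg1. Qed.

Lemma rcosets_rcoset C x : C \in rcosets H G -> x \in G -> (C :* x)%g \in rcosets H G.
Proof.
case/rcosetsP=> y Gy -> Gx; apply/rcosetsP; exists (y * x)%g; first exact: groupM.
by rewrite rcosetM.
Qed.

Definition coset_index (C : {set gT}) : 'I_#|rcosets H G| :=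
  enum_rank_in group_mem_rcosets C.

Lemma coset_indexK C : C \in rcosets H G -> enum_val (coset_index C) = C.
Proof. exact: enum_rankK_in. Qed.

Lemma coset_valK i : coset_index (enum_val i) = i.
Proof. exact: enum_valK_in. Qed.

Lemma coset_valP (i : 'I_#|rcosets H G|) : enum_val i \in rcosets H G.
Proof. exact: enum_valP. Qed.

Definition coset_mx (x : gT) : 'M[F]_#|rcosets H G| :=
  \matrix_(i, j) ((enum_val i :* x)%g == enum_val j)%:R.

Lemma row_coset_mx C x : C \in rcosets H G -> x \in G ->
  row (coset_index C) (coset_mx x) = delta_mx 0 (coset_index (C :* x)%g).
Proof.
move=> CH Gx; apply/rowP=> j; rewrite !mxE eqxx /= coset_indexK //.
have Cx := rcosets_rcoset CH Gx; congr (nat_of_bool _)%:R.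
apply/eqP/eqP => [-> | ->]; first by rewrite coset_valK.
by rewrite coset_indexK.
Qed.

Lemma coset_mx_repr : mx_repr G coset_mx.
Proof.
split=> [|x y Gx Gy]; apply/row_matrixP=> i; rewrite -[i]coset_valK.
  by rewrite row_coset_mx ?coset_valP // rcoset1 row1.
rewrite row_mul !row_coset_mx ?groupM ?coset_valP // -rowE row_coset_mx //.
  by rewrite rcosetM.
by rewrite rcosets_rcoset ?coset_valP.
Qed.

Definition coset_repr : representation F G :=
  Representation (MxRepresentation coset_mx_repr).

Hypothesis sHG : H \subset G.

(** The trace of the coordinate projection to the coset H is |H| times the identity, because each
    coset C is reached from H by exactly |H| elements. *)
Lemma higman_coset : (#|H|%:R : F) != 0 -> higman coset_repr.
Proof.
move=> nzH; pose i0 := coset_index H.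
exists ((#|H|%:R)^-1 *: delta_mx i0 i0).
apply/row_matrixP=> i; rewrite -[i]coset_valK; set C := enum_val i.
have CH : C \in rcosets H G := coset_valP i.
rewrite linear_sum row1.
rewrite (bigID (mem C)) /= [X in _ + X]big1 ?addr0; last first.
  move=> x /andP[Gx nCx]; rewrite !row_mul row_coset_mx ?groupV //.
  rewrite -scalemxAr mul_delta_mx_0 ?scaler0 ?mul0mx //.
  apply: contra nCx => /eqP/(congr1 enum_val).
  rewrite !coset_indexK ?group_mem_rcosets ?rcosets_rcoset ?groupV // => defH.
  by rewrite -[C](rcosetK x^-1%g) defH invgK rcoset_refl.
rewrite (eq_bigr (fun _ => (#|H|%:R)^-1 *: delta_mx 0 (coset_index C))); last first.
  move=> x /andP[Gx Cx]; rewrite !row_mul row_coset_mx ?groupV //.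
  have defC : C = (H :* x)%g.
    by case/rcosetsP: CH Cx => y _ -> /rcoset_eqP.
  rewrite defC rcosetK -scalemxAr mul_delta_mx -scalemxAl -rowE.
  by rewrite row_coset_mx ?group_mem_rcosets.
rewrite sumr_const -scaler_nat scalerA.
have -> : #|[pred x | (x \in G) && (x \in C)]| = #|H|.
  have sCG : C \subset G.
    by case/rcosetsP: CH => y Gy ->; rewrite mul_subG ?sub1set.
  transitivity #|C|; first (apply: eq_card => x); last first.
    by case/rcosetsP: CH => y Gy ->; rewrite card_rcoset.
  rewrite -[LHS]/((x \in G) && (x \in C)); apply: andb_idl; exact: (subsetP sCG).
by rewrite divff // scale1r.
Qed.

(** Frobenius reciprocity: Hom(W, M) is coinduced from the restriction of M to H. [R] evaluates at
    the coset H, and [K] rebuilds a G-homomorphism from an H-homomorphism by translating it with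
    coset representatives [xj]. *)
Lemma hdim_ghom_coset (M P : representation F G) :
  hdim P (ghom coset_repr M) G = hdim P M H.
Proof.
pose i0 := coset_index H; set W := coset_repr.
pose R : 'M[F]_(_, rdegree M) :=
  lin1_mx (row i0 \o (@vec_mx F (rdegree W) (rdegree M))).
have RE u : u *m R = row i0 (vec_mx u) by rewrite mul_rV_lin1.
have homR (x : gT) (u : 'rV_(rdegree W * rdegree M)) C :
    C \in rcosets H G -> x \in G ->
  row (coset_index C) (vec_mx (u *m ghom W M x))
    = row (coset_index (C :* x^-1)%g) (vec_mx u) *m M x.
  move=> CH Gx; rewrite -[u]vec_mxK [mxvec _ *m _]hom_mxE !mxvecK.
  by rewrite !row_mul row_coset_mx ?groupV // -rowE.
apply/eqP; rewrite eqn_leq; apply/andP; split.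
  apply: (rank_linear_inj (T := mulmxr R)) => f /(sub_homP (M2 := ghom W M)) homf /=.
    apply/sub_homHP => // h Hh; have Gh := subsetP sHG h Hh.
    rewrite mulmxA homf //; apply/row_matrixP=> i; rewrite !row_mul !RE.
    by rewrite homR ?group_mem_rcosets // rcoset_id ?groupV.
  move=> fR0; apply/row_matrixP=> i; rewrite row0.
  apply: (can_inj vec_mxK); apply/row_matrixP=> j; rewrite linear0 row0.
  rewrite -[j]coset_valK; have := coset_valP j; set C := enum_val j.
  case/rcosetsP=> x Gx ->.
  have Gx1 : x^-1%g \in G by rewrite groupV.
  have := homR x^-1%g (row i f) _ group_mem_rcosets Gx1; rewrite invgK.
  rewrite -[row i f *m _]row_mul -homf // row_mul -RE -mulmxA fR0 mulmx0 => /esym/eqP.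
  rewrite -[X in _ == X](mul0mx _ (M x^-1%g)) => /eqP.
  by move/(can_inj (repr_mxK M Gx1)).
pose E (j : 'I_#|rcosets H G|) : 'M[F]_(rdegree M, rdegree W * rdegree M) :=
  lin1_mx (mxvec \o mulmx (delta_mx j 0 : 'cV_(rdegree W))).
pose xj (j : 'I_#|rcosets H G|) := repr (enum_val j).
pose K := \sum_j lin_mx (mulmx (P (xj j)^-1%g) \o mulmxr (M (xj j) *m E j)).
have xjP j : xj j \in G /\ enum_val j = (H :* xj j)%g.
  rewrite /xj; have := coset_valP j; case/rcosetsP=> x Gx ->.
  have /rcosetP[h Hh ->] := mem_repr_rcoset H x.
  split; last by rewrite rcosetM (rcoset_id Hh).
  by rewrite groupM //; apply: (subsetP sHG).
have TE g (u : 'rV_(rdegree P)) x : {in H, forall x, P x *m g = g *m M x} -> x \in G ->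
    row (coset_index (H :* x)%g) (vec_mx (u *m vec_mx (mxvec g *m K)))
    = u *m P x^-1%g *m g *m M x.
  move=> homg Gx; set C := (H :* x)%g.
  have CH : C \in rcosets H G by apply/rcosetsP; exists x.
  have d11 : delta_mx 0 0 = 1%:M :> 'M[F]_1.
    by apply/matrixP=> a b; rewrite !ord1 !mxE.
  rewrite mulmx_sumr linear_sum mulmx_sumr !linear_sum /=.
  have termE j : row (coset_index C) (vec_mx (u *m vec_mx (mxvec g *m
       lin_mx (mulmx (P (xj j)^-1%g) \o mulmxr (M (xj j) *m E j)))))
     = row (coset_index C) (delta_mx j 0 : 'cV_(rdegree W))
         *m (u *m P (xj j)^-1%g *m g *m M (xj j)).
    rewrite mul_vec_lin /= mxvecK !mulmxA mul_rV_lin1 /= mxvecK row_mul.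
    by rewrite !mulmxA.
  rewrite (bigD1 (coset_index C)) //= big1 => [|j neq]; rewrite termE; last first.
    by rewrite rowE mul_delta_mx_0 ?mul0mx // eq_sym.
  rewrite rowE mul_delta_mx d11 mul1mx addr0.
  have [Gc] := xjP (coset_index C); set y := xj _ in Gc *.
  rewrite coset_indexK // => defC.
  have /rcosetP[h Hh ->] : y \in (H :* x)%g by rewrite -/C defC rcoset_refl.
  have Gh := subsetP sHG h Hh.
  rewrite invMg !repr_mxM ?groupV // !mulmxA -!(mulmxA _ g) -homg //.
  by rewrite !mulmxA -(mulmxA _ (P h^-1%g)) -repr_mxM ?groupV // mulVg repr_mx1 mulmx1.
apply: (rank_linear_inj (T := vec_mx \o mulmxr K \o mxvec)) => g /(sub_homHP _ sHG) homg.
  apply/(sub_homP (M2 := ghom W M)) => y Gy /=.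
  apply/row_matrixP=> i; apply: (can_inj vec_mxK); apply/row_matrixP=> j.
  rewrite -[j]coset_valK; have := coset_valP j; set C := enum_val j.
  case/rcosetsP=> x Gx ->.
  have Gxy : (x * y^-1)%g \in G by rewrite groupM ?groupV.
  rewrite !row_mul homR //; last by apply/rcosetsP; exists x.
  rewrite -rcosetM TE // (rowE i (vec_mx _)) TE // (rowE i (P y)).
  rewrite invMg invgK !repr_mxM ?groupV // !mulmxA.
  by rewrite -(mulmxA _ (M y^-1%g)) -repr_mxM ?groupV // mulVg repr_mx1 mulmx1.
move=> /= Tg0; apply/row_matrixP=> i.
have := TE g (delta_mx 0 i) 1%g homg (group1 G).
by rewrite Tg0 mulmx0 linear0 !linear0 invg1 !repr_mx1 !mulmx1 -rowE => <-.
Qed.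

Lemma hdim_coset_ghom (M S : representation F G) :
  (#|H|%:R : F) != 0 -> hdim (ghom coset_repr M) S G = hdim S M H.
Proof.
move=> nzH; rewrite hdim_sym ?hdim_ghom_coset //.
exact/higman_ghom/higman_coset.
Qed.

End CosetRepr.

(** P is a quotient of Hom(FG, P) by the map [f] that sums the values of a linear map over the group
    basis. Hom(FG, P) satisfies Higman's criterion, projectivity splits [f], and the witness is
    compressed to P along the splitting. *)
Lemma projective_higman (F : fieldType) (gT : finGroupType) (G : {group gT})
    (P : representation F G) : is_projective P -> higman P.
Proof.
move=> projP; pose W := coset_repr F G 1%G.
have homW : higman (ghom W P).
  by apply/higman_ghom/higman_coset; rewrite ?sub1G // cards1 oner_eq0.
pose f : 'M[F]_(rdegree (ghom W P), rdegree P) :=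
  lin1_mx (mulmx (const_mx 1 : 'rV_(rdegree W)) \o (@vec_mx F (rdegree W) (rdegree P))).
have homf : is_hom f.
  move=> x Gx; apply: eq_lin_mx => g.
  rewrite mulmxA [mxvec g *m _]hom_mxE mulmxA !mul_rV_lin1 /= !mxvecK !mulmxA.
  congr (_ *m _ *m _); apply/rowP=> j; rewrite !mxE.
  have Gx1 : x^-1%g \in G by rewrite groupV.
  have CH := coset_valP j.
  rewrite (bigD1 (coset_index G 1%G (enum_val j :* x)%g)) //= big1 => [|i neq].
    by rewrite !mxE coset_indexK ?rcosets_rcoset // rcosetK eqxx mulr1 addr0.
  rewrite !mxE mul1r; case: (_ =P enum_val j) neq => // <-.
  by rewrite rcosetKV coset_valK eqxx.
have fullf : row_full f.
  apply/row_fullP.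
  exists (lin1_mx (mxvec \o mulmx (delta_mx (coset_index G 1%G 1%g) 0 : 'cV_(rdegree W)))).
  apply/row_matrixP=> i; rewrite rowE mulmxA !mul_rV_lin1 /= mxvecK mulmxA.
  rewrite -colE col_const row1 -[RHS]mul1mx; congr (_ *m _).
  by apply/matrixP=> a b; rewrite !ord1 !mxE.
have [h homh hf1] := projP (ghom W P) P f 1%:M homf fullf (@hom1 _ _ _ P).
have [a Wa] := homW; exists (h *m a *m f).
transitivity (trace_hom (h *m a *m f) : 'M_(rdegree P)); first by [].
by rewrite -trace_homMr // -trace_homMl // /trace_hom Wa mulmx1.
Qed.

(** * The b-component of a module and the block with one simple module *)

Section BlockRank.

Variables (F : fieldType) (gT : finGroupType) (N : {group gT}).
Implicit Types M P Q S T : representation F N.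

Lemma rank_linear_rV a b m k (A : 'M[F]_(a, m)) (B : 'M[F]_(b, k))
    (T : {linear 'rV[F]_m -> 'rV[F]_k}) :
  (forall u : 'rV_m, (u <= A)%MS -> (T u <= B)%MS) ->
  (forall u : 'rV_m, (u <= A)%MS -> T u = 0 -> u = 0) ->
  (\rank A <= \rank B)%N.
Proof.
move=> sTB injT; rewrite -(mxrank_mul_ker A (lin1_mx T)).
have -> : (A :&: kermx (lin1_mx T))%MS = 0.
  apply/eqP; rewrite -submx0; apply/rV_subP=> u.
  rewrite sub_capmx => /andP[Au /sub_kermxP]; rewrite mul_rV_lin1 => Tu0.
  by rewrite (injT _ Au Tu0) sub0mx.
rewrite mxrank0 addn0; apply: mxrankS; apply/rV_subP=> u /submxP[v ->].
by rewrite mulmxA mul_rV_lin1 sTB ?submxMl.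
Qed.

Lemma exact_rsim M1 M2 : mx_rsim M1 M2 ->
  exists i p, @exact F gT N M1 M2 (@grepr0 F gT N) i p.
Proof.
case=> B eqd fB homB; exists B, 0; split=> // [x _||].
- by rewrite mulmx0 mul0mx.
- by rewrite /row_full mxrank0.
apply/eqmxP/andP; split; apply: submx_full; rewrite /row_full.
  by rewrite (eqP fB) eqd.
by rewrite mxrank_ker mxrank0 subn0.
Qed.

Lemma additive_rsim (V : nmodType) (f : representation F N -> V) M1 M2 :
  additive_on_exact f -> mx_rsim M1 M2 -> f M1 = f M2.
Proof.
case=> f0 addf /exact_rsim[i [p /addf ->]].
by rewrite (f0 (@grepr0 F gT N) erefl) addr0.
Qed.

Lemma subadditive_rsim f M1 M2 :
  subadditive_on_exact f -> mx_rsim M1 M2 -> f M1 = f M2.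
Proof.
move=> [f0 subf] sim12; apply/eqP; rewrite eqn_leq.
have le M M' : mx_rsim M M' -> (f M' <= f M)%N.
  case/exact_rsim=> i [p /subf]; by rewrite (f0 (@grepr0 F gT N) erefl) addn0.
by rewrite (le _ _ sim12) (le _ _ (mx_rsim_sym sim12)).
Qed.

Lemma hdim_subadditiver P : subadditive_on_exact (fun M => hdim P M N).
Proof. by split=> [M /hdim_degree0r // | M1 M M2 i p /hdim_subaddr]. Qed.

Lemma hdim_subadditivel S : subadditive_on_exact (fun M => hdim M S N).
Proof. by split=> [M /hdim_degree0l // | M1 M M2 i p /hdim_subaddl]. Qed.

Lemma hdim_additiver P : higman P -> additive_on_exact (fun M => hdim P M N).
Proof.
by move=> hP; split=> [M /hdim_degree0r // | M1 M M2 i p]; apply: hdim_additive.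
Qed.

Lemma rdegree_additive : additive_on_exact (fun M => rdegree M).
Proof. by split=> // M1 M M2 i p /exact_degree. Qed.

Lemma hdim_irr S T : mx_absolutely_irreducible S -> mx_irreducible T ->
  ~ mx_rsim T S -> hdim T S N = 0.
Proof.
move=> /mx_abs_irrW irrS irrT nsim; apply/eqP; rewrite mxrank_eq0 -submx0.
apply/rV_subP=> u; rewrite -[u]vec_mxK => /sub_homP homu.
have [-> | nzu] := eqVneq (vec_mx u) 0; first by rewrite linear0 sub0mx.
by case: nsim; apply: irr_hom_rsim homu nzu.
Qed.

Lemma hdim_abs_irr S : mx_absolutely_irreducible S -> hdim S S N = 1.
Proof.
move=> absS; have scalS := mx_abs_irr_cent_scalar absS.
have nzS : (rdegree S > 0)%N by case/andP: absS.
apply/eqP; rewrite eqn_leq; apply/andP; split.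
  rewrite -[X in (_ <= X)%N](_ : \rank (mxvec (1%:M : 'M[F]_(rdegree S))) = 1%N).
    apply: mxrankS; apply/rV_subP=> u; rewrite -[u]vec_mxK => /sub_homP homu.
    have /is_scalar_mxP[a ->] : is_scalar_mx (vec_mx u).
      by apply: scalS; apply/centgmxP => x Gx; rewrite homu.
    by rewrite -(scalemx1 _ a) linearZ_LR scalemx_sub.
  by apply/eqP; rewrite rank_rV mxvec_eq0 -mxrank_eq0 mxrank1 -lt0n nzS.
rewrite lt0n mxrank_eq0; apply/eqP=> fix0.
have : (mxvec (1%:M : 'M[F]_(rdegree S)) <= rfix_mx (hom_repr S S) N)%MS.
  by apply/sub_homP; apply: hom1.
rewrite fix0 submx0 mxvec_eq0 -mxrank_eq0 mxrank1.
by rewrite eqn0Ngt nzS.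
Qed.

Definition op_rank (b : 'M[F]_#|N|) M := \rank (gring_op M b).

Variable b : 'M[F]_#|N|.
Hypothesis Zb : (b \in 'Z(group_ring F N))%MS.
Hypothesis idb : b *m b = b.

Lemma center_gring : (b \in group_ring F N)%MS.
Proof. by case/center_mxP: Zb. Qed.

Lemma op_idem M : gring_op M b *m gring_op M b = gring_op M b.
Proof. by rewrite -gring_opM ?idb ?center_gring. Qed.

Lemma op_hom M : @is_hom F gT N M M (gring_op M b).
Proof.
move=> x Gx; have [_ /(_ _ (envelop_mx_id (regular_repr F N) Gx))] := center_mxP Zb.
move/(congr1 (gring_op M)); rewrite !gring_opM ?center_gring ?envelop_mx_id //.
by rewrite gring_opG.
Qed.

Lemma op_rank_additive : additive_on_exact (op_rank b).
Proof.
split=> [M M0 | M1 M M2 i p exip].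
  by apply/eqP; rewrite -leqn0 (leq_trans (rank_leq_col _)) ?M0.
have [homi homp fi fp kp] := exip; rewrite /op_rank.
rewrite -(mxrank_mul_ker (gring_op M b) p) addnC; congr (_ + _)%N.
  rewrite -(mxrankMfree _ fi); apply: eqmx_rank; apply/andP; split; last first.
    rewrite sub_capmx kp; apply/andP; split; last by rewrite submxMl.
    by rewrite hom_gring ?submxMl.
  apply/rV_subP=> u; rewrite sub_capmx kp => /andP[/submxP[v ->]].
  case/submxP=> w def_w; rewrite -(op_idem M) mulmxA def_w -mulmxA -hom_gring //.
  by rewrite mulmxA submxMr ?submxMl // submxMl.
by rewrite hom_gring // (eqmxMfull _ fp).
Qed.

Definition acts_as_one M := gring_op M b = 1%:M.

Lemma acts_as_one_closed : subquotient_closed acts_as_one.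
Proof.
move=> M1 M M2 i p [homi homp fi fp _] oneM; split.
  by apply: (row_free_inj fi); rewrite hom_gring // oneM mulmx1 mul1mx.
by apply: (row_full_inj fp); rewrite -hom_gring // oneM mulmx1 mul1mx.
Qed.

Lemma block_mxmodule : mxmodule (regular_repr F N) b.
Proof.
apply/mxmoduleP=> x Nx.
have [_ <-] := center_mxP Zb; [exact: submxMl | exact: envelop_mx_id].
Qed.

Definition block_module : representation F N :=
  Representation (submod_repr (U := b) (rG := regular_repr F N) block_mxmodule).

Lemma block_module_inj : exists2 i : 'M_(rdegree block_module, #|N|),
  [/\ row_free i, (i :=: b)%MS &
   {in N, forall x, block_module x *m i = i *m regular_repr F N x}]
  & acts_as_one block_module.
Proof.
exists (val_submod 1%:M).
  split=> [||x Gx]; first by rewrite /row_free val_submod1.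
    exact: val_submod1.
  by rewrite -val_submodE -(val_submodJ block_mxmodule) // mul1mx.
rewrite /acts_as_one.
have fi : row_free (val_submod 1%:M : 'M_(rdegree block_module, #|N|)).
  by rewrite /row_free val_submod1.
apply: (row_free_inj fi); rewrite mul1mx.
have hi : @is_hom F gT N block_module (Representation (regular_repr F N)) (val_submod 1%:M).
  by move=> x Gx /=; rewrite -val_submodE -(val_submodJ block_mxmodule) // mul1mx.
rewrite (hom_gring b hi) /= gring_op_id ?center_gring //.
have /submxP[w ->] : (val_submod (1%:M : 'M_(\rank b)) <= b)%MS by rewrite val_submod1.
by rewrite -mulmxA idb.
Qed.

(** The isomorphism Hom(eA, P) = Pe evaluates a homomorphism at the idempotent; [w] is b in the
    coordinates of [block_module]. Conversely a vector v of the b-component gives the map ba ->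
    va. *)
Lemma hdim_block_module P : hdim block_module P N = op_rank b P.
Proof.
have [i [fi ib homi] _] := block_module_inj.
have homgi a : gring_op block_module a *m i = i *m gring_op (regular_repr F N) a.
  exact: (@hom_gring F gT N block_module (Representation (regular_repr F N)) i a homi).
have idi : i *m b = i.
  have /submxP[w ->] : (i <= b)%MS by rewrite ib.
  by rewrite -mulmxA idb.
have rb_i : (gring_row b <= i)%MS by rewrite ib row_sub.
set w := gring_row b *m pinvmx i; have wi : w *m i = gring_row b by rewrite mulmxKpV.
have w_b : w *m gring_op block_module b = w.
  apply: (row_free_inj fi); rewrite -mulmxA homgi gring_op_id ?center_gring //.
  by rewrite idi.
apply/eqP; rewrite eqn_leq; apply/andP; split.
  apply: (rank_linear_rV (T := mulmx w \o (@vec_mx F _ _))) => u;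
    rewrite -[u]vec_mxK => /sub_homP; set f := vec_mx u => homf /=; rewrite mxvecK.
    by rewrite -w_b -mulmxA hom_gring // mulmxA submxMl.
  move=> wf0; apply/eqP; rewrite mxvec_eq0; apply/eqP/row_matrixP=> j.
  rewrite row0 rowE.
  have [a Ra a_def] : exists2 a, (a \in group_ring F N)%MS & gring_row a = row j i.
    by exists (gring_mx (regular_repr F N) (row j i)); rewrite ?gring_mxK ?gring_mxP.
  have -> : delta_mx 0 j = w *m gring_op block_module a.
    apply: (row_free_inj fi); rewrite -mulmxA homgi gring_op_id // mulmxA wi.
    have [_ cb] := center_mxP Zb.
    by rewrite -gring_row_mul -cb // gring_row_mul a_def -row_mul idi rowE.
  by rewrite -mulmxA hom_gring // mulmxA wf0 mul0mx.
pose E := enveloping_algebra_mx P.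
have ETE v (u : 'rV_#|N|) : u *m (E *m lin_mul_row v) = v *m gring_mx P u.
  by rewrite mulmxA; have := mul_vec_lin_row (vec_mx (u *m E)) v; rewrite vec_mxK.
apply: (rank_linear_rV (T := mxvec \o mulmx i \o mulmx E \o lin_mul_row)) => v /submxP[u0 ->] /=;
  set v' := u0 *m _.
  apply/(sub_homP (M1 := block_module) (M2 := P)) => x Gx; rewrite [LHS]mulmxA homi // -!mulmxA; congr (_ *m _).
  apply/row_matrixP=> k; rewrite !rowE !mulmxA -2!(mulmxA _ E) !ETE.
  by rewrite gring_mxJ // mulmxA.
move=> /eqP; rewrite mxvec_eq0 => /eqP iT0.
have : gring_row b *m (E *m lin_mul_row v') = 0 by rewrite -wi -mulmxA iT0 mulmx0.
by rewrite ETE -gring_opE -mulmxA op_idem.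
Qed.

Variable S : representation F N.
Hypothesis absS : mx_absolutely_irreducible S.
Hypothesis oneS : acts_as_one S.
Hypothesis uniqS : forall T, mx_irreducible T -> acts_as_one T -> mx_rsim T S.

Lemma isotypic_additive (f : representation F N -> nat) M :
  additive_on_exact f -> acts_as_one M ->
  (f M * rdegree S = rdegree M * f S)%N.
Proof.
move=> addf oneM; have [k [T [irrT CT _ addT]]] := composition_factors M.
have simT j : mx_rsim (T j) S.
  by apply: uniqS => //; apply: CT oneM _; apply: acts_as_one_closed.
rewrite (addT _ f addf) (addT _ _ rdegree_additive).
rewrite (eq_bigr (fun _ => f S)) => [|j _]; last exact: additive_rsim (simT j).
rewrite [in RHS](eq_bigr (fun _ => rdegree S)) => [|j _]; last first.
  exact: mxrank_rsim (simT j).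
by rewrite !sum_nat_const mulnAC.
Qed.

(** The b-component of P has dimension dim Hom(FNb, P) = dim Hom(P, FNb), and FNb is built from rank
    b / s copies of S. *)
Lemma op_rank_higman P : higman P ->
  (op_rank b P * rdegree S = \rank b * hdim P S N)%N.
Proof.
move=> hP; rewrite -hdim_block_module -hdim_sym //.
have [_ _ oneY] := block_module_inj.
exact: isotypic_additive (hdim_additiver hP) oneY.
Qed.

(** A composition factor isomorphic to S adds at most 1 to dim Hom(M, S) and exactly s to the
    b-component; any other factor adds nothing to the former. *)
Lemma hdim_le_op_rank M : (hdim M S N * rdegree S <= op_rank b M)%N.
Proof.
have [k [T [irrT _ subT addT]]] := composition_factors M.
rewrite (addT _ _ op_rank_additive).
apply: leq_trans (leq_mul (subT _ (hdim_subadditivel S)) (leqnn _)) _.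
rewrite big_distrl /=; apply: leq_sum => j _.
have [simT | nsim] := classic (mx_rsim (T j) S).
  rewrite (subadditive_rsim (hdim_subadditivel S) simT) hdim_abs_irr // mul1n.
  by rewrite (additive_rsim op_rank_additive simT) /op_rank oneS mxrank1.
by rewrite hdim_irr.
Qed.

End BlockRank.

(** * Additive invariants along a composition series *)

Section Series.

Variables (F : fieldType) (gT : finGroupType) (G : {group gT}).
Implicit Types M : representation F G.

Lemma val_submodM n (U : 'M[F]_n) a m (A : 'M_(a, m)) (B : 'M_(m, \rank U)) :
  val_submod (A *m B) = A *m val_submod B.
Proof. exact/esym/mulmxA. Qed.

Lemma in_submodM n (U : 'M[F]_n) a m (A : 'M_(a, m)) (B : 'M_(m, n)) :
  in_submod U (A *m B) = A *m in_submod U B.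
Proof. exact/esym/mulmxA. Qed.

Lemma in_factmodM n (U : 'M[F]_n) a m (A : 'M_(a, m)) (B : 'M_(m, n)) :
  in_factmod U (A *m B) = A *m in_factmod U B.
Proof. exact/esym/mulmxA. Qed.

Lemma exact_section M (U V : 'M_(rdegree M)) (modU : mxmodule M U)
    (modV : mxmodule M V) : (U <= V)%MS ->
  exists i p, @exact F gT G (Representation (submod_repr modU))
    (Representation (submod_repr modV))
    (Representation (section_repr modU modV)) i p.
Proof.
move=> sUV; set WS := <<in_factmod U V>>%MS.
pose i : 'M_(\rank U, \rank V) := in_submod V (val_submod 1%:M).
pose q := in_factmod U (val_submod (1%:M : 'M_(\rank V))).
pose p : 'M_(\rank V, \rank WS) := in_submod WS q.
have sU : (val_submod (1%:M : 'M_(\rank U)) <= V)%MS by rewrite val_submod1.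
have eq_q : (q :=: in_factmod U V)%MS.
  by apply/eqmxP; rewrite /q !submxMr ?val_submod1.
have sq : (q <= WS)%MS by rewrite genmxE eq_q.
have ip0 : i *m p = 0.
  rewrite /p -in_submodM /q -in_factmodM -val_submodM mulmx1 in_submodK //.
  have /eqP -> : in_factmod U (val_submod (1%:M : 'M_(\rank U))) == 0.
    by rewrite in_factmod_eq0 val_submod1.
  by rewrite linear0.
have rk_p : \rank p = \rank WS by rewrite mxrank_in_submod // genmxE eq_q.
have fi : row_free i by rewrite /row_free mxrank_in_submod // val_submod1.
exists i, p; split=> [x Gx | x Gx | // | | ] /=.
- rewrite -(in_submodJ modV) // -(val_submodJ modU) // mul1mx.
  by rewrite -[submod_mx modU x in RHS]mulmx1 val_submodM in_submodM.
- rewrite -(in_submodJ (section_module modU modV)) //.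
  rewrite -(in_factmodJ modU) // -(val_submodJ modV) // mul1mx.
  by rewrite -[submod_mx modV x in RHS]mulmx1 val_submodM in_factmodM in_submodM.
- by rewrite /row_full rk_p.
apply: eqmx_sym; apply/eqmxP.
have sip : (i <= kermx p)%MS by apply/sub_kermxP.
rewrite -(mxrank_leqif_eq sip) mxrank_ker (eqP fi) rk_p.
have := mxrank_in_factmod U V; rewrite (addsmx_idPr sUV) /WS genmxE => <-.
by rewrite addKn.
Qed.

(** Evaluates additive invariants on the explicit series that occur in [has_composition_mult]. *)
Lemma series_additive (f : representation F G -> nat) M Us
    (compU : mx_composition_series M Us) :
  additive_on_exact f -> (last 0 Us :=: 1%:M)%MS ->
  f M = (\sum_(i < size Us) f (Representation (series_repr i compU)))%N.
Proof.
move=> addf lastU; pose modU := proj1 compU.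
have partial k : (k <= size Us)%N ->
    f (Representation (submod_repr (mx_subseries_module' k modU)))
    = (\sum_(0 <= i < k) f (Representation (series_repr i compU)))%N.
  elim: k => [_ | k IHk ltk].
    by rewrite big_nil (proj1 addf) //= mxrank0.
  rewrite big_nat_recr //= -IHk 1?ltnW //.
  have [_ /(_ k ltk)[/ltmxW sU _]] := compU.
  have [i [p /(proj2 addf) eqf]] := exact_section (mx_subseries_module' k modU)
    (mx_subseries_module k modU) sU.
  apply: etrans eqf; rewrite /=.
  by rewrite (bool_irrelevance (mx_subseries_module' k.+1 modU) (mx_subseries_module k modU)).
rewrite -(big_mkord xpredT (fun i => f (Representation (series_repr i compU)))).
rewrite -partial //; apply/esym/(additive_rsim addf).
apply: rsim_submod1; rewrite -(last_nth 0); exact: lastU.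
Qed.

End Series.

(** * Restriction to a subgroup and relative traces *)

Section Restriction.

Variables (F : fieldType) (gT : finGroupType) (G N : {group gT}).
Hypothesis sNG : N \subset G.
Implicit Types M P S T : representation F G.

Definition restr M : representation F N := Representation (subg_repr M sNG).

Lemma restr_hom M1 M2 (f : 'M_(rdegree M1, rdegree M2)) :
  is_hom f -> @is_hom F gT N (restr M1) (restr M2) f.
Proof. by move=> homf x Nx; apply: homf; apply: (subsetP sNG). Qed.

Lemma restr_exact M1 M M2 (i : 'M_(rdegree M1, rdegree M))
    (p : 'M_(rdegree M, rdegree M2)) :
  exact i p -> @exact F gT N (restr M1) (restr M) (restr M2) i p.
Proof. by case=> *; split=> //; apply: restr_hom. Qed.

Lemma restr_additive (V : nmodType) (f : representation F N -> V) :
  additive_on_exact f -> additive_on_exact (fun M => f (restr M)).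
Proof.
case=> f0 addf; split=> [M M0 | M1 M M2 i p exip]; first exact: f0.
exact: addf (restr_exact exip).
Qed.

Lemma repr_rcosets C : C \in rcosets N G -> repr C \in G /\ C = (N :* repr C)%g.
Proof.
case/rcosetsP=> x Gx ->; have /rcosetP[h Hh ->] := mem_repr_rcoset N x.
split; last by rewrite rcosetM (rcoset_id Hh).
by rewrite groupM //; apply: (subsetP sNG).
Qed.

Lemma sum_rcosets (V : nmodType) (f : gT -> V) :
  \sum_(x in G) f x = \sum_(C in rcosets N G) \sum_(n in N) f (n * repr C)%g.
Proof.
rewrite (set_partition_big (rcosets N G)) ?rcosets_partition //=.
apply: eq_bigr => C /repr_rcosets[_ defC].
rewrite (reindex_inj (mulIg (repr C))) /=; apply: eq_bigl => n.
by rewrite (congr1 (fun A : {set gT} => n * repr C \in A)%g defC) mem_rcoset mulgK.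
Qed.

(** The trace over G is a trace over N after a sum over coset representatives; that inner sum is the
    new witness. *)
Lemma higman_restr P : higman P -> higman (restr P).
Proof.
case=> a Pa; exists (\sum_(C in rcosets N G) P (repr C) *m a *m P (repr C)^-1%g).
rewrite -[RHS]Pa [RHS](reindex_inj invg_inj) /=.
rewrite [RHS](eq_bigl (fun x => x \in G)) => [|x]; last exact: groupV.
rewrite [RHS](eq_bigr (fun x => P x *m a *m P x^-1%g)) => [|x _]; last by rewrite invgK.
rewrite sum_rcosets exchange_big /= (reindex_inj invg_inj) /=.
apply: eq_big => n; first by rewrite groupV.
rewrite groupV => Nn; have Gn := subsetP sNG n Nn.
rewrite invgK mulmx_sumr mulmx_suml; apply: eq_bigr => C /repr_rcosets[GC _].
by rewrite invMg !repr_mxM ?groupV // !mulmxA.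
Qed.

Lemma rel_trace_coset M (X : 'M_(rdegree M)) y :
    {in N, forall x, M x *m X = X *m M x} -> y \in G ->
  M (repr (N :* y)%g)^-1%g *m X *m M (repr (N :* y)%g) = M y^-1%g *m X *m M y.
Proof.
move=> cX Gy; have /rcosetP[h Hh ->] := mem_repr_rcoset N y.
have Gh := subsetP sNG h Hh.
rewrite invMg !repr_mxM ?groupV // !mulmxA -!(mulmxA _ X) -cX //.
by rewrite !mulmxA -(mulmxA _ (M h^-1%g)) -repr_mxM ?groupV // mulVg repr_mx1 mulmx1.
Qed.

Lemma rel_trace_hom M (X : 'M_(rdegree M)) :
    {in N, forall x, M x *m X = X *m M x} ->
  @is_hom F gT G M M
    (\sum_(C in rcosets N G) M (repr C)^-1%g *m X *m M (repr C)).
Proof.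
move=> cX x Gx; apply/esym; rewrite mulmx_suml mulmx_sumr.
rewrite [RHS](reindex_inj (h := fun C : {set gT} => (C :* x)%g)) /=; last first.
  exact: can_inj (rcosetK x).
apply: eq_big => C.
  apply/idP/idP => [CN|]; first exact: rcosets_rcoset.
  by move/rcosets_rcoset/(_ (groupVr Gx)); rewrite rcosetK.
move=> CN; have [GC defC] := repr_rcosets CN.
rewrite [in RHS]defC -rcosetM rel_trace_coset ?groupM //.
rewrite invMg !repr_mxM ?groupV // !mulmxA.
by rewrite -repr_mxM ?groupV // mulgV repr_mx1 mul1mx.
Qed.

End Restriction.

Lemma factor_full (F : fieldType) m n k l (q : 'M[F]_(m, n)) (f : 'M_(m, k)) (K : 'M_(l, m)) :
  (kermx q <= K)%MS -> K *m f = 0 -> q *m (pinvmx q *m f) = f.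
Proof.
move=> sK Kf; apply/eqP; rewrite -subr_eq0 mulmxA -{2}[f]mul1mx -mulmxBl.
have /submxP[D ->] : (q *m pinvmx q - 1%:M <= K)%MS.
  apply: submx_trans sK; apply/sub_kermxP.
  by rewrite mulmxBl mul1mx mulmxKpV ?subrr.
by rewrite -mulmxA Kf mulmx0.
Qed.

Lemma rel_trace_op (F : fieldType) (gT : finGroupType) (G D : {group gT})
    (a : 'M[F]_#|G|) (M : representation F G) : D \subset G -> fixed_by D a ->
  {in D, forall x, M x *m gring_op M a = gring_op M a *m M x} /\
  gring_op M (rel_trace D a) = \sum_(C in rcosets D G) M (repr C)^-1%g *m gring_op M a *m M (repr C).
Proof.
move=> sDG [Ra ca]; split=> [x Dx | ].
  have Gx := subsetP sDG x Dx; have := congr1 (gring_op M) (ca x Dx).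
  by rewrite !gring_opM ?envelop_mx_id // gring_opG.
rewrite /rel_trace linear_sum /=; apply: eq_bigr => C /(repr_rcosets sDG)[GC _].
by rewrite !gring_opM ?envelop_mx_id // !gring_opG ?groupV.
Qed.

(** * Homomorphisms from a projective cover to simple modules of N *)

Section Head.

Variables (F : fieldType) (gT : finGroupType) (G N D : {group gT}).
Hypotheses (nNG : (N <| G)%g) (sDN : D \subset N).
Let sNG := normal_sub nNG.
Let sDG := subset_trans sDN sNG.
Variables (B a : 'M[F]_#|G|).
Hypothesis aD : fixed_by D a.
Hypothesis defB : B = rel_trace D a.
Implicit Types M P : representation F G.

(* Averaging a D-linear retraction with a, since B = Tr_D^G(a) acts as 1. *)
Lemma rel_projective_retract M (K p : 'M_(rdegree M)) :
    gring_op M B = 1%:M -> mxmodule M K -> (p <= K)%MS -> K *m p = K ->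
    {in D, forall x, M x *m p = p *m M x} ->
  exists2 q : 'M_(rdegree M), @is_hom F gT G M M q & (q <= K)%MS /\ K *m q = K.
Proof.
move=> oneM modK pK Kp cp; set A := gring_op M a; have [cA opB] := rel_trace_op M sDG aD.
rewrite -defB in opB.
have modKA m (U : 'M_(m, rdegree M)) : (U <= K)%MS -> (U *m A <= K)%MS.
  move=> sUK; apply: submx_trans (submxMr A sUK) _.
  by apply: mxmodule_envelop modK _ (submx_refl _); apply: gring_mxP.
exists (\sum_(C in rcosets D G) M (repr C)^-1%g *m (A *m p) *m M (repr C)).
  apply: (rel_trace_hom sDG) => x Dx.
  by rewrite mulmxA cA // -mulmxA cp // mulmxA.
have pK' m (U : 'M_(m, rdegree M)) : (U <= K)%MS -> U *m p = U.
  by case/submxP=> X ->; rewrite -mulmxA Kp.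
split.
  apply: summx_sub => C /(repr_rcosets sDG)[GC _].
  by rewrite !mulmxA mxmodule_trans // mulmx_sub.
rewrite -[RHS]mulmx1 -oneM opB !mulmx_sumr.
apply: eq_bigr => C /(repr_rcosets sDG)[GC _]; rewrite !mulmxA.
congr (_ *m _); apply: pK'; apply: modKA.
by rewrite mxmodule_trans ?groupV ?submx_refl.
Qed.

(** The maps [eta i] separate the points of W and are N-linear into conjugates of the simple module
    S, so W is semisimple. Concretely, start from a supplement Y of K: if K and Y meet, some [eta i]
    is onto already on their intersection, and cutting Y with its kernel leaves a smaller
    supplement. *)
Lemma exists_complement (W S : representation F N)
    (eta : gT -> 'M[F]_(rdegree W, rdegree S)) (K : 'M_(rdegree W)) :
    mx_irreducible S ->
    {in G, forall i, {in N, forall x, W x *m eta i = eta i *m S (x ^ i)%g}} ->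
    (forall v : 'rV_(rdegree W), {in G, forall i, v *m eta i = 0} -> v = 0) ->
    mxmodule W K ->
  exists2 Y : 'M_(rdegree W), mxmodule W Y & (K + Y :=: 1%:M)%MS /\ (K :&: Y)%MS = 0.
Proof.
move=> irrS hometa injeta modK.
have [m] := ubnP (\rank (1%:M : 'M[F]_(rdegree W))).
have : (1%:M <= K + (1%:M : 'M[F]_(rdegree W)))%MS by exact: addsmxSr.
move: (mxmodule1 W).
elim: m {1 3 4}1%:M => // m IHm Y modY fullY; rewrite ltnS => leYm.
have [KY0 | nzKY] := eqVneq (K :&: Y)%MS 0.
  by exists Y => //; split=> //; apply/eqmxP; rewrite submx1.
have [i Gi nzi] : exists2 i, i \in G & (K :&: Y)%MS *m eta i != 0.
  apply: NNPP => noi; case/negP: nzKY; apply/eqP/row_matrixP=> j; rewrite row0.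
  apply: injeta => i Gi; rewrite -row_mul; apply/eqP; apply: contraT => nz.
  by case: noi; exists i => //; apply: contraNneq nz => ->; rewrite row0.
have modker : mxmodule W (Y :&: kermx (eta i))%MS.
  apply: capmx_module modY _; apply/mxmoduleP=> x Nx; apply/sub_kermxP.
  by rewrite -mulmxA hometa // mulmxA mulmx_ker mul0mx.
have fullKY : row_full ((K :&: Y)%MS *m eta i).
  have := proj2 (iffLR (mx_irrP S) irrS) <<(K :&: Y)%MS *m eta i>>%MS.
  rewrite /row_full genmxE; apply; last by rewrite -mxrank_eq0 genmxE mxrank_eq0.
  rewrite (eqmx_module _ (genmxE _)); apply/mxmoduleP=> y Ny.
  have Nx : (y ^ i^-1)%g \in N.
    by rewrite memJ_norm ?groupV // (subsetP (normal_norm nNG)).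
  have -> : y = ((y ^ i^-1) ^ i)%g by rewrite conjgKV.
  move: Nx; set x := (y ^ i^-1)%g => Nx.
  rewrite -mulmxA -hometa // mulmxA submxMr //.
  exact: (mxmoduleP (capmx_module modK modY)).
have sY : (Y <= (K :&: Y) + (Y :&: kermx (eta i)))%MS.
  have /submxP[X defX] : (Y *m eta i <= (K :&: Y)%MS *m eta i)%MS by apply: submx_full.
  rewrite -[Y in (Y <= _)%MS](subrK (X *m (K :&: Y)%MS)) addrC addmx_sub_adds ?submxMl //.
  rewrite sub_capmx; apply/andP; split.
    by rewrite addmx_sub // eqmx_opp mulmx_sub // capmxSr.
  by apply/sub_kermxP; rewrite mulmxBl -mulmxA defX subrr.
apply: (IHm (Y :&: kermx (eta i))%MS) => //.
  apply: submx_trans fullY _; rewrite addsmx_sub addsmxSl /=.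
  apply: submx_trans sY _; apply: addsmxS => //; exact: capmxSl.
apply: leq_trans leYm; apply: rank_ltmx; rewrite /ltmx capmxSl /=.
apply: contra nzi; rewrite sub_capmx => /andP[_ sYk].
by apply/eqP/sub_kermxP; apply: submx_trans sYk; apply: capmxSr.
Qed.

Lemma head_hom_vanish P Q S (u : 'M_(rdegree P, rdegree Q))
    (th : 'M_(rdegree P, rdegree S)) :
    gring_op P B = 1%:M -> is_projective_cover u ->
    mx_irreducible (S : representation F N) ->
    @is_hom F gT N (restr sNG P) S th -> kermx u *m th = 0.
Proof.
move=> oneP [_ homu fullu essu] irrS homth.
pose K' := (\bigcap_(g in G) kermx (P g *m th))%MS.
have K'P m (U : 'M_(m, rdegree P)) :
    reflect {in G, forall g, U *m P g *m th = 0} (U <= K')%MS.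
  apply: (iffP sub_bigcapmxP) => H g Gg; last by apply/sub_kermxP; rewrite mulmxA H.
  by rewrite -mulmxA; apply/sub_kermxP/H.
have modK' : mxmodule P K'.
  apply/mxmoduleP=> h Gh; apply/K'P=> g Gg.
  by rewrite -(mulmxA K') -repr_mxM //; apply: (K'P _ _ (submx_refl _)); apply: groupM.
have exK' := exact_submod modK'.
set W := Representation (factmod_repr modK') in exK'.
set q := in_factmod K' 1%:M in exK'.
have [_ homq _ fullq kerq] := exK'; have q0 := exact_comp0 exK'.
have {kerq} kerq : (kermx q :=: K')%MS by apply: eqmx_trans kerq _; apply: val_submod1.
pose eta (g : gT) : 'M_(rdegree W, rdegree S) := pinvmx q *m (P g *m th).
have qeta g : g \in G -> q *m eta g = P g *m th.
  move=> Gg; apply: (factor_full (K := K')); first by rewrite kerq.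
  by rewrite mulmxA; apply: (K'P _ _ (submx_refl _)).
have modK := mxmodule_kermx homu; set K := kermx u in modK *.
have modKq : mxmodule W (K *m q) := mxmodule_image homq modK.
pose Kq := <<K *m q>>%MS.
have modKq' : mxmodule W Kq by rewrite (eqmx_module _ (genmxE _)).
have [Y modY [fullY dxY]] : exists2 Y : 'M_(rdegree W), mxmodule (restr sNG W) Y &
    (Kq + Y :=: 1%:M)%MS /\ (Kq :&: Y)%MS = 0.
  have cmp := @exists_complement (restr sNG W) S eta Kq irrS. apply: cmp => //; last exact: mxmodule_subg.
    move=> g Gg x Nx; apply: (row_full_inj fullq).
    have Gx := subsetP sNG x Nx.
    have Ngx : (x ^ g)%g \in N by rewrite memJ_norm // (subsetP (normal_norm nNG)).
    have Ggx := subsetP sNG _ Ngx.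
    have e1 : q *m restr sNG W x = P x *m q by apply: esym (homq x Gx).
    rewrite [LHS]mulmxA e1 -[LHS]mulmxA [RHS]mulmxA !qeta // -[RHS]mulmxA -(homth _ Ngx) /= !mulmxA.
    by rewrite -!repr_mxM // conjgE !mulgA mulgV mul1g.
  move=> v v0; have /submxP[v' def_v] : (v <= q)%MS by apply: submx_full.
  rewrite def_v; suff /K'P : {in G, forall g, v' *m P g *m th = 0}.
    by rewrite -kerq => /sub_kermxP.
  by move=> g Gg; rewrite -mulmxA -qeta // mulmxA -def_v v0.
have cpi := proj_mx_hom dxY (mxmodule_subg sNG modKq') modY.
set pi := proj_mx Kq Y in cpi.
have [Pi homPi [PiK KPi]] : exists2 Pi : 'M_(rdegree W), @is_hom F gT G W W Pi &
    (Pi <= Kq)%MS /\ Kq *m Pi = Kq.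
  apply: (@rel_projective_retract W Kq pi) => //.
  - by apply: (row_full_inj fullq); rewrite -hom_gring // oneP mulmx1 mul1mx.
  - rewrite /pi -[proj_mx _ _]mul1mx; exact: proj_mx_sub.
  - exact: proj_mx_id.
  move=> x Dx; have Nx := subsetP sDN x Dx.
  have fullKY : row_full (Kq + Y)%MS by rewrite -sub1mx fullY.
  by apply: (row_full_inj fullKY); rewrite [LHS]mulmxA [RHS]mulmxA; apply: (hom_mxP cpi x Nx).
have KqPi : K *m q *m Pi = K *m q.
  have /submxP[X ->] : (K *m q <= Kq)%MS by rewrite genmxE.
  by rewrite -mulmxA KPi.
(* K together with the kernel of the retraction spans P, so this kernel maps onto Q; [u] being
   essential, the retraction is zero. *)
have : row_full (kermx (q *m Pi)).
  apply: essu.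
    exact: mxmodule_kermx (hom_comp homq homPi).
  have /submxP[X defX] : (q *m Pi <= K *m q)%MS.
    by apply: submx_trans (submxMl _ _) _; rewrite -(genmxE (K *m q)).
  have u1 : (1%:M <= u)%MS by rewrite sub1mx.
  rewrite -sub1mx; apply: submx_trans u1 _.
  have defu : (1%:M - X *m K) *m u = u.
    by rewrite mulmxBl mul1mx -mulmxA mulmx_ker mulmx0 subr0.
  rewrite -{1}defu; apply: submxMr; apply/sub_kermxP; rewrite mulmxBl mul1mx.
  by rewrite -(mulmxA X K) (mulmxA K q) KqPi -defX subrr.
rewrite -sub1mx => /sub_kermxP; rewrite mul1mx => qPi0.
have Pi0 : Pi = 0 by apply: (row_full_inj fullq); rewrite qPi0 mulmx0.
have : (K <= K')%MS by rewrite -kerq; apply/sub_kermxP; rewrite -KqPi Pi0 mulmx0.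
by move/K'P/(_ 1%g (group1 G)); rewrite repr_mx1 mulmx1.
Qed.

End Head.

(** * Composition multiplicities as dimensions of Hom from projective covers *)

Section Cover.

Variables (F : fieldType) (gT : finGroupType) (G : {group gT}).
Implicit Types M P Q S T : representation F G.

Lemma hdim_factor_le (N : {group gT}) (P Q S : representation F N)
    (u : 'M_(rdegree P, rdegree Q)) :
    is_hom u -> row_full u ->
    (forall th : 'M_(rdegree P, rdegree S), is_hom th -> kermx u *m th = 0) ->
  (hdim P S N <= hdim Q S N)%N.
Proof.
move=> homu fullu vanish.
have fac (f : 'M_(rdegree P, rdegree S)) : is_hom f -> u *m (pinvmx u *m f) = f.
  by move=> homf; apply: (factor_full (submx_refl _)); apply: vanish.
apply: (rank_linear_inj (T := mulmx (pinvmx u))) => f /sub_homP homf.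
  apply/sub_homP => x Nx /=; apply: (row_full_inj fullu).
  by rewrite [LHS]mulmxA -homu // -[LHS]mulmxA fac // homf // [RHS]mulmxA fac.
by move=> /= f0; rewrite -(fac f homf) f0 mulmx0.
Qed.

Variables (B : 'M[F]_#|G|).
Hypothesis ZB : (B \in 'Z(group_ring F G))%MS.
Hypothesis idB : B *m B = B.

Lemma cover_in_block P Q (u : 'M_(rdegree P, rdegree Q)) :
  is_projective_cover u -> gring_op Q B = 1%:M -> gring_op P B = 1%:M.
Proof.
case=> _ homu fullu essu oneQ.
have fullP : row_full (gring_op P B).
  apply: essu; last by rewrite hom_gring // oneQ mulmx1.
  rewrite -[gring_op P B]mul1mx; apply: mxmodule_image (mxmodule1 _).
  exact: op_hom.
by apply: (row_full_inj fullP); rewrite mulmx1 op_idem.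
Qed.

Variables (D : {group gT}) (a : 'M[F]_#|G|).
Hypotheses (sDG : D \subset G) (aD : fixed_by D a) (defB : B = rel_trace D a).
Hypothesis splitG : group_splitting_field F G.

(** The case N = G of [head_hom_vanish] reduces Hom(P, T) to Hom(Q, T), where Schur's lemma over a
    splitting field applies. *)
Lemma hdim_cover P Q T (u : 'M_(rdegree P, rdegree Q)) :
    is_projective_cover u -> gring_op Q B = 1%:M -> mx_irreducible Q ->
    mx_irreducible T ->
  (mx_rsim T Q -> hdim P T G = 1%N) /\ (~ mx_rsim T Q -> hdim P T G = 0%N).
Proof.
move=> covu oneQ irrQ irrT; have [_ homu fullu _] := covu.
have le : (hdim P T G <= hdim Q T G)%N.
  apply: hdim_factor_le homu fullu _ => th homth.
  have oneP := cover_in_block covu oneQ.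
  have homth' : @is_hom F gT G (restr (normal_sub (normal_refl G)) P) T th.
    by move=> x Gx; apply: homth.
  exact: (head_hom_vanish (nNG := normal_refl G) sDG aD defB oneP covu irrT homth').
split=> [simT | nsim].
  rewrite (subadditive_rsim (hdim_subadditiver P) simT); apply/eqP.
  rewrite eqn_leq; apply/andP; split.
    rewrite -(subadditive_rsim (hdim_subadditiver P) simT).
    apply: leq_trans le _; rewrite (subadditive_rsim (hdim_subadditiver Q) simT).
    by rewrite hdim_abs_irr //; apply: splitG.
  rewrite lt0n mxrank_eq0; apply/eqP=> fix0.
  have : (mxvec u <= rfix_mx (hom_repr P Q) G)%MS by apply/sub_homP.
  rewrite fix0 submx0 mxvec_eq0 -mxrank_eq0 (eqP fullu).
  by have [+ _] := iffLR (mx_irrP _) irrQ; case: (rdegree Q).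
apply/eqP; rewrite -leqn0; apply: leq_trans le _.
rewrite leqn0; apply/eqP/hdim_irr => //; first exact: splitG.
by move=> /mx_rsim_sym.
Qed.

Lemma composition_mult_hdim P Q M c (u : 'M_(rdegree P, rdegree Q)) :
    is_projective_cover u -> gring_op Q B = 1%:M -> mx_irreducible Q ->
    has_composition_mult M Q c ->
  hdim P M G = c.
Proof.
move=> covu oneQ irrQ [Us [compU [I [lastU simI cardI]]]].
have [projP _ _ _] := covu; have hP := projective_higman projP.
rewrite (series_additive compU (hdim_additiver hP) lastU) -cardI -sum1_card.
rewrite [RHS]big_mkcond /=; apply: eq_bigr => i _.
have irri := mx_series_repr_irr compU (ltn_ord i).
have [h1 h0] := hdim_cover covu oneQ irrQ
  (irri : mx_irreducible (Representation (series_repr i compU))).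
by case: ifP => [/simI/h1 // | nI]; apply: h0 => /simI; rewrite nI.
Qed.

End Cover.

(** * Bounding Cartan entries by the rank of b *)

Section CartanBound.

Variables (F : fieldType) (gT : finGroupType) (G N D : {group gT}).
Hypotheses (nNG : (N <| G)%g) (sDN : D \subset N).
Let sNG := normal_sub nNG.
Let sDG := subset_trans sDN sNG.
Hypothesis splitG : group_splitting_field F G.
Variables (B a : 'M[F]_#|G|).
Hypotheses (ZB : (B \in 'Z(group_ring F G))%MS) (idB : B *m B = B).
Hypotheses (aD : fixed_by D a) (defB : B = rel_trace D a).
Variable b : 'M[F]_#|N|.
Hypotheses (Zb : (b \in 'Z(group_ring F N))%MS) (idb : b *m b = b).
Variable S : representation F N.
Hypotheses (absS : mx_absolutely_irreducible S) (oneS : acts_as_one b S).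
Hypothesis uniqS : forall T : representation F N,
  mx_irreducible T -> acts_as_one b T -> mx_rsim T S.
Hypothesis nzb : forall M : representation F G,
  mx_irreducible M -> in_block B M -> gring_op (restr sNG M) b != 0.

(** With h(M) = dim Hom_N(M, S) and s = [rdegree S], the chain is c_ij r_j s^2 <= (rank b) h(P_i) s
    <= (rank b) h(S_i) s <= (rank b) r_i <= n s^2 r_i. *)
Lemma cartan_bound n l (c : 'M[nat]_l) :
    (\rank b <= n * rdegree S ^ 2)%N -> is_cartan_matrix B c ->
  forall i j, (c i j <= n)%N.
Proof.
move=> rank_b [S_ [irrS_ _ _] cartan].
have s_gt0 : (0 < rdegree S)%N by case/andP: absS.
pose r i := op_rank b (restr sNG (S_ i)).
have r_gt0 i : (0 < r i)%N.
  by have [irr blk] := irrS_ i; rewrite lt0n mxrank_eq0; apply: nzb.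
have addb := restr_additive sNG (op_rank_additive Zb idb).
have bound i j : (c i j * r j <= n * r i)%N.
  have [P [u [covu [Us [compU [I [lastU simI cardI]]]]]]] := cartan i j.
  have [irri blki] := irrS_ i.
  have [projP homu fullu _] := covu.
  have le1 : (c i j * r j <= op_rank b (restr sNG P))%N.
    rewrite (series_additive compU addb lastU) -cardI.
    rewrite -sum_nat_const [X in (_ <= X)%N](bigID (mem I)) /=; apply: leq_trans (leq_addr _ _).
    apply: leq_sum => k /simI simk.
    by rewrite /r -(additive_rsim addb (M1 := Representation (series_repr k compU)) simk).
  have hP := higman_restr sNG (projective_higman projP).
  have eq2 := op_rank_higman Zb idb uniqS hP.
  have le3 : (hdim (restr sNG P) S N <= hdim (restr sNG (S_ i)) S N)%N.
    have H := @hdim_factor_le F gT N (restr sNG P) (restr sNG (S_ i)) S u (restr_hom sNG homu) fullu; apply: H => th homth.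
    have oneP := cover_in_block ZB idB covu blki.
    exact: (head_hom_vanish sDN aD defB oneP covu (mx_abs_irrW absS) homth).
  have le4 := hdim_le_op_rank Zb idb absS oneS (restr sNG (S_ i)).
  rewrite -(leq_pmul2r (m := rdegree S ^ 2)) ?expn_gt0 ?s_gt0 //.
  apply: (@leq_trans (\rank b * r i)).
    rewrite -mulnn mulnA; apply: leq_trans (leq_mul (leq_mul le1 (leqnn _)) (leqnn _)) _.
    rewrite eq2 -mulnA leq_mul2l; apply/orP; right.
    by apply: leq_trans le4; rewrite leq_mul2r le3 orbT.
  by rewrite mulnAC leq_mul2r rank_b orbT.
(* The entries are dim Hom(P', P) and dim Hom(P, P') for the two covers. *)
have sym i j : c i j = c j i.
  have [P [u [covu compP]]] := cartan i j.
  have [P' [u' [covu' compP']]] := cartan j i.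
  have [irri blki] := irrS_ i; have [irrj blkj] := irrS_ j.
  rewrite -(composition_mult_hdim ZB idB sDG aD defB splitG covu' blkj irrj compP).
  rewrite -(composition_mult_hdim ZB idB sDG aD defB splitG covu blki irri compP').
  by apply: hdim_sym; apply: projective_higman; case: covu'.
(* By symmetry the bound can be used in the direction in which r i / r j is at most 1. *)
move=> i j; wlog le_r : i j / (r i <= r j)%N.
  by move=> W; case/orP: (leq_total (r i) (r j)) => le; [|rewrite sym]; apply: W.
rewrite -(leq_pmul2r (r_gt0 j)); apply: leq_trans (bound i j) _.
by rewrite leq_mul2l le_r orbT.
Qed.

End CartanBound.

(** * Defect groups are p-groups *)

Section DefectGroup.

Variables (F : fieldType) (gT : finGroupType) (G : {group gT}).
Local Notation aG := (regular_repr F G).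

Lemma card_sub_rcosets (Q D : {group gT}) y :
    Q \subset D -> D \subset G -> y \in G ->
  #|[set C in rcosets Q G | (D * C)%g == (D :* y)%g]| = #|D : Q|%g.
Proof.
move=> sQD sDG Gy.
rewrite /indexg -(card_imset (rcosets Q D) (can_inj (rcosetK y))); apply: eq_card => C.
rewrite !inE; apply/andP/imsetP => [[/rcosetsP[x Gx ->] /eqP eqD] | [E /rcosetsP[d Dd ->] ->]].
  have Dxy : (x * y^-1)%g \in D.
    have : x \in (D :* y)%g.
      by rewrite -eqD mulgA (mulGSid sQD) rcoset_refl.
    by rewrite mem_rcoset.
  exists (Q :* (x * y^-1))%g; first by apply/rcosetsP; exists (x * y^-1)%g.
  by rewrite -rcosetM mulgKV.
have Gd := subsetP sDG d Dd; split.
  by apply/rcosetsP; exists (d * y)%g; rewrite ?groupM // rcosetM.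
by rewrite -rcosetM mulgA (mulGSid sQD) rcosetM (rcoset_id Dd).
Qed.

Lemma rel_trace_sub (Q D : {group gT}) (a : 'M[F]_#|G|) :
    Q \subset D -> D \subset G -> fixed_by D a ->
  rel_trace Q a = #|D : Q|%g%:R *: rel_trace (G := G) D a.
Proof.
move=> sQD sDG [Ra ca]; have sQG := subset_trans sQD sDG.
rewrite /rel_trace scaler_sumr.
rewrite (partition_big (fun C => (D * C)%g) (mem (rcosets D G))) /=; last first.
  move=> C /(repr_rcosets sQG)[GC ->]; apply/rcosetsP; exists (repr C) => //.
  by rewrite mulgA (mulGSid sQD).
apply: eq_bigr => K /(repr_rcosets sDG)[GK defK].
rewrite (eq_bigr (fun _ => aG (repr K)^-1%g *m a *m aG (repr K))) => [|C].
  rewrite sumr_const scaler_nat; congr (_ *+ _).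
  rewrite -(card_sub_rcosets sQD sDG GK); apply: eq_card => C.
  by rewrite !inE -defK.
case/andP=> /(repr_rcosets sQG)[GC defC] /eqP DC.
have rC : repr C \in C by rewrite {2}defC rcoset_refl.
have Kx : repr C \in K by rewrite -DC -[repr C]mul1g mem_mulg.
have := rel_trace_coset sDG (M := Representation aG) (X := a) ca GC.
have <- : K = (D :* repr C)%g.
  by move: Kx; rewrite {1}defK => /rcoset_eqP ->.
by move=> /= ->.
Qed.

(** For a Sylow p-subgroup Q of D the index |D:Q| is invertible in F, so dividing [a] by it turns
    the trace from D into a trace from Q; minimality gives D = Q. *)
Lemma defect_pgroup p (B : 'M[F]_#|G|) (D : {group gT}) : p \in [pchar F] ->
  is_defect_group B D -> (p.-group D)%g.
Proof.
move=> charF [sDG [a aD defB] minD].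
have [Q sylQ] := Sylow_exists p D; have sQD := pHall_sub sylQ.
have [-> | neQ] := eqVneq D Q; first exact: pHall_pgroup sylQ.
have ltQ : Q \proper D.
  by rewrite properEneq sQD andbT; apply: contraNneq neQ => eqQ; apply/eqP/val_inj.
case: (minD Q ltQ); exists (#|D : Q|%g%:R^-1 *: a).
  have [Ra ca] := aD; split; first by rewrite linearZ scalemx_sub.
  by move=> x /(subsetP sQD) Dx; rewrite -scalemxAl -scalemxAr ca.
have nz : (#|D : Q|%g%:R : F) != 0.
  have [_ _ p'] := and3P sylQ.
  by rewrite -(dvdn_pcharf charF) -p'natE // (pcharf_prime charF).
have -> : rel_trace Q (#|D : Q|%g%:R^-1 *: a) = #|D : Q|%g%:R^-1 *: rel_trace (G := G) Q a.
  rewrite /rel_trace scaler_sumr; apply: eq_bigr => C _.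
  by rewrite -scalemxAr -scalemxAl.
by rewrite (rel_trace_sub sQD sDG aD) scalerA mulVf // scale1r.
Qed.

End DefectGroup.

(** * The case of a normal defect group *)

Section NormalDefect.

Variables (F : fieldType) (gT : finGroupType) (G D : {group gT}) (p : nat).
Hypotheses (charF : p \in [pchar F]) (pD : (p.-group D)%g).

Lemma trivial_mx_repr : mx_repr D (fun _ : gT => 1%:M : 'M[F]_1).
Proof. by split=> // x y _ _; rewrite mulmx1. Qed.

Definition trivial_repr : representation F D :=
  Representation (MxRepresentation trivial_mx_repr).

Lemma pgroup_irr_trivial (T : representation F D) :
  mx_irreducible T -> mx_rsim T trivial_repr.
Proof.
move=> irrT; have [T_gt0 _] := iffLR (mx_irrP T) irrT.
have /rowV0Pn[v fixv nzv] := rfix_pgroup_pchar charF T T_gt0 pD (subxx D).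
apply: mx_rsim_sym; apply: (irr_hom_rsim (M1 := trivial_repr) (f := v)) => //.
  exact/mx_abs_irrW/linear_mx_abs_irr.
by move=> x Dx /=; rewrite mul1mx (rfix_mxP D fixv).
Qed.

(** This is [cartan_bound] for N = D and b = 1: in characteristic p a p-group has only the trivial
    simple module, so s = 1 and rank b = |D|. *)
Lemma normal_defect_bound (B : 'M[F]_#|G|) l (c : 'M[nat]_l) :
    group_splitting_field F G -> is_block B -> is_defect_group B D ->
    is_cartan_matrix B c -> (D <| G)%g ->
  forall i j, (c i j <= #|D|)%N.
Proof.
move=> splitG [ZB idB _ _] [_ [a aD defB] _] cartan nDG.
have center1 : (1%:M \in 'Z(group_ring F D))%MS.
  apply/center_mxP; split=> [|A _]; last by rewrite mulmx1 mul1mx.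
  exact: (envelop_mx1 (regular_repr F D)).
apply: (@cartan_bound F gT G D D nDG (subxx D) splitG B a ZB idB aD defB 1%:M
          center1 _ trivial_repr) cartan => //.
- by rewrite mulmx1.
- exact: linear_mx_abs_irr.
- by rewrite /acts_as_one gring_op1.
- by move=> T irrT _; apply: pgroup_irr_trivial.
- move=> M irrM _; rewrite gring_op1 -mxrank_eq0 mxrank1 /= -lt0n.
  by case/mx_irrP: irrM.
by rewrite mxrank1 exp1n muln1.
Qed.

End NormalDefect.

(** * Every simple module of a covering block has a non-zero b-component *)

Section Covering.

Variables (F : fieldType) (gT : finGroupType) (G : {group gT}).
Local Notation aG := (regular_repr F G).
Local Notation R_G := (group_ring F G).
Implicit Types M : representation F G.

(** z is the product of the factors 1 - e, kept abstract behind the properties used later. *)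
Lemma annihilating_idempotent (es : seq 'M[F]_#|G|) :
    {in es, forall e, (e \in R_G)%MS /\ e *m e = e} ->
    {in es &, forall e e', e *m e' = e' *m e} ->
  exists z : 'M[F]_#|G|,
  [/\ (z \in R_G)%MS /\ {in es, forall e, z *m e = 0 /\ e *m z = 0},
      forall w, {in es, forall e, w *m e = e *m w} -> w *m z = z *m w,
      forall w : 'M_#|G|, {in es, forall e, w *m e = 0} -> w *m z = w,
      forall w : 'M_#|G|, {in es, forall e, e *m w = 0} -> z *m w = w
    & forall M, {in es, forall e, gring_op M e = 0} -> gring_op M z = 1%:M].
Proof.
elim: es => [_ _ | e es IHes idem comm].
  exists 1%:M; split=> [|w _|w _|w _|M _]; rewrite ?mulmx1 ?mul1mx ?gring_op1 //.
  by split=> //; apply: (envelop_mx1 aG).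
have es_sub x : x \in es -> x \in e :: es by rewrite inE orbC => ->.
have e_in : e \in e :: es by rewrite mem_head.
have [|x y xs ys|z [[Rz z0] cz zr zl zM]] := IHes.
- by move=> x /es_sub/idem.
- by apply: comm; apply: es_sub.
have [Re ee] := idem e e_in.
have ez : e *m z = z *m e by apply: cz => x /es_sub xs; apply: comm.
have R1e : (1%:M - e \in R_G)%MS.
  by rewrite linearB /= addmx_sub ?eqmx_opp //; apply: (envelop_mx1 aG).
have cE w : w *m e = e *m w -> w *m (1%:M - e) = (1%:M - e) *m w.
  by move=> cwe; rewrite mulmxBr mulmxBl mulmx1 mul1mx cwe.
have eE : e *m (1%:M - e) = 0 by rewrite mulmxBr mulmx1 ee subrr.
exists (z *m (1%:M - e)); split.
- split; first exact: envelop_mxM.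
  move=> x; rewrite inE => /predU1P[-> | xs].
    by rewrite -mulmxA -cE // eE mulmx0 mulmxA ez -mulmxA eE mulmx0.
  have [zx xz] := z0 x xs; have cxe := comm x e (es_sub x xs) e_in.
  by rewrite -mulmxA -cE // mulmxA zx mul0mx mulmxA xz mul0mx.
- move=> w cw; have cwz : w *m z = z *m w by apply: cz => x /es_sub/cw.
  by rewrite mulmxA cwz -!mulmxA cE //; apply: cw.
- move=> w w0; rewrite mulmxA zr => [|x /es_sub/w0 //].
  by rewrite mulmxBr mulmx1 w0 // subr0.
- move=> w w0; rewrite -mulmxA mulmxBl mul1mx w0 // subr0.
  by apply: zl => x /es_sub/w0.
move=> M M0; rewrite gring_opM // zM => [|x /es_sub/M0 //].
by rewrite linearB /= gring_op1 M0 // subr0 mul1mx.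
Qed.

Variable N : {group gT}.
Hypothesis nNG : (N <| G)%g.
Let sNG := normal_sub nNG.
Variable b : 'M[F]_#|N|.
Hypotheses (Zb : (b \in 'Z(group_ring F N))%MS) (idb : b *m b = b).

(** The element b viewed inside FG. *)
Let beta := gring_op (restr sNG (Representation aG)) b.

Lemma gring_op_regular_restr : (beta \in R_G)%MS /\
  forall M, gring_op M beta = gring_op (restr sNG M) b.
Proof.
have betaE : beta = \sum_i gring_row b 0 i *: aG (enum_val i).
  rewrite /beta gring_opE /gring_mx /= mulmx_sum_row linear_sum.
  by apply: eq_bigr => i _; rewrite linearZ /= rowK mxvecK.
have GN (i : 'I_#|N|) : enum_val i \in G by apply: (subsetP sNG); apply: enum_valP.
split=> [|M].
  rewrite betaE linear_sum summx_sub //= => i _.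
  by rewrite linearZ scalemx_sub // envelop_mx_id.
rewrite betaE gring_opE [RHS]gring_opE /= [in RHS]/gring_mx /= mulmx_sum_row.
rewrite -gring_opE !linear_sum; apply: eq_bigr => i _.
by rewrite !linearZ /= rowK mxvecK gring_opG.
Qed.

(** Let z be the product of all 1 - b^g. It is central, so Bz is 0 or B by primitivity. If b killed
    M, z would act as 1 on M, hence Bz = B; then z acts as 1 on the module M' that witnesses the
    covering, and zb = 0 shows that b kills M', a contradiction. *)
Lemma cover_nonzero (B : 'M[F]_#|G|) : is_block B -> covers sNG B b ->
  forall M, mx_irreducible M -> in_block B M -> gring_op (restr sNG M) b != 0.
Proof.
move=> [ZB idB nzB minB] [M' oneM' nzM'] M irrM oneM.
have [Rb bM] := gring_op_regular_restr.
pose conj g := aG g^-1%g *m beta *m aG g.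
have aGK g : g \in G -> aG g *m aG g^-1%g = 1%:M.
  by move=> Gg; rewrite -repr_mxM ?groupV // mulgV repr_mx1.
have aGVK g : g \in G -> aG g^-1%g *m aG g = 1%:M.
  by move=> Gg; rewrite -repr_mxM ?groupV // mulVg repr_mx1.
have conjM g h : g \in G -> h \in G -> aG h^-1%g *m conj g *m aG h = conj (g * h)%g.
  by move=> Gg Gh; rewrite /conj invMg !repr_mxM ?groupV // !mulmxA.
have beta_id : beta *m beta = beta by apply: op_idem.
have conj_id g : g \in G -> conj g *m conj g = conj g.
  move=> Gg; rewrite /conj -!mulmxA (mulmxA (aG g)) aGK // mul1mx.
  by rewrite (mulmxA beta) beta_id.
have conj_N g : g \in G -> {in N, forall x, aG x *m conj g = conj g *m aG x}.
  move=> Gg x Nx; have Gx := subsetP sNG x Nx.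
  have Nxg : (x ^ g^-1)%g \in N.
    by rewrite memJ_norm ?groupV // (subsetP (normal_norm nNG)).
  have Gxg := subsetP sNG _ Nxg.
  have cb : aG (x ^ g^-1)%g *m beta = beta *m aG (x ^ g^-1)%g.
    exact: (op_hom Zb (restr sNG (Representation aG)) Nxg).
  rewrite /conj !mulmxA -repr_mxM ?groupV //.
  have -> : (x * g^-1 = g^-1 * x ^ g^-1)%g by rewrite conjgE invgK !mulgA mulVg mul1g.
  rewrite repr_mxM ?groupV // -(mulmxA _ _ beta) cb -!mulmxA -repr_mxM //.
  by rewrite -repr_mxM // conjgE invgK -!mulgA mulVg mulg1.
have conj_beta g : g \in G -> conj g *m beta = beta *m conj g.
  move=> Gg; apply/esym; apply: (@hom_gring F gT N (restr sNG (Representation aG))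
    (restr sNG (Representation aG)) (conj g)).
  exact: conj_N.
have comm g h : g \in G -> h \in G -> conj g *m conj h = conj h *m conj g.
  move=> Gg Gh; have Ggh : (g * h^-1)%g \in G by rewrite groupM ?groupV.
  have -> : conj g = aG h^-1%g *m conj (g * h^-1)%g *m aG h by rewrite conjM // mulgKV.
  have cb := conj_beta _ Ggh; set C := conj (g * h^-1)%g in cb *.
  move: C cb => C cb; rewrite /conj -!mulmxA !(mulmxA (aG h)) aGK // !mul1mx.
  by rewrite (mulmxA C) (mulmxA beta) cb.
have [||z [[Rz z0] cz zr zl zM]] := annihilating_idempotent (es := [seq conj g | g <- enum G]).
- move=> _ /mapP[g + ->]; rewrite mem_enum => Gg; split; last exact: conj_id.
  by rewrite /conj !envelop_mxM // envelop_mx_id ?groupV.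
- move=> _ _ /mapP[g + ->] /mapP[h + ->]; rewrite !mem_enum; exact: comm.
have conjP g : g \in G -> conj g \in [seq conj g | g <- enum G].
  by move=> Gg; apply: map_f; rewrite mem_enum.
(* z and its conjugate y both annihilate the whole G-stable family of conjugates of b, so y z equals
   y and also z. *)
have z_conj x : x \in G -> aG x^-1%g *m z *m aG x = z.
  move=> Gx; set y := _ *m aG x.
  have Gx1 : x^-1%g \in G by rewrite groupV.
  have yz : y *m z = y.
    apply: zr => _ /mapP[g + ->]; rewrite mem_enum => Gg.
    have Ggx := groupM Gg Gx1; have [ze _] := z0 _ (conjP _ Ggx).
    have -> : conj g = aG x^-1%g *m conj (g * x^-1)%g *m aG x by rewrite conjM // mulgKV.
    move: (conj _) ze => C ze; rewrite /y -!mulmxA !(mulmxA (aG x)) aGK // !mul1mx.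
    by rewrite (mulmxA z) ze mul0mx mulmx0.
  have zy : z *m (aG x *m z *m aG x^-1%g) = aG x *m z *m aG x^-1%g.
    apply: zl => _ /mapP[g + ->]; rewrite mem_enum => Gg.
    have Ggx := groupM Gg Gx; have [_ ez] := z0 _ (conjP _ Ggx).
    have -> : conj g = aG x *m conj (g * x)%g *m aG x^-1%g.
      by rewrite -[in RHS]conjM // !mulmxA aGK // mul1mx -mulmxA aGK // mulmx1.
    move: (conj _) ez => C ez; rewrite -!mulmxA !(mulmxA (aG x^-1%g)) aGVK // !mul1mx.
    by rewrite (mulmxA C) ez mul0mx mulmx0.
  have : y *m z = z; last by rewrite yz.
  have -> : y *m z = aG x^-1%g *m (z *m (aG x *m z *m aG x^-1%g)) *m aG x.
    by rewrite /y -!mulmxA aGVK // mulmx1.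
  by rewrite zy !mulmxA aGVK // mul1mx -mulmxA aGVK // mulmx1.
have zC x : x \in G -> aG x *m z = z *m aG x.
  by move=> Gx; rewrite -{1}(z_conj x Gx) !mulmxA aGK // mul1mx.
have [RB cB] := center_mxP ZB.
have cz' A : (A \in R_G)%MS -> A *m z = z *m A.
  case/envelop_mxP=> k ->; rewrite mulmx_suml mulmx_sumr.
  by apply: eq_bigr => x Gx; rewrite -scalemxAl -scalemxAr zC.
have zz : z *m z = z by apply: zr => e /z0[].
have ZBz : (B *m z \in 'Z(R_G))%MS.
  apply/center_mxP; split=> [|A RA]; first exact: envelop_mxM.
  by rewrite mulmxA cB // -!mulmxA cz'.
have BzBz : B *m z *m (B *m z) = B *m z.
  by rewrite -mulmxA (mulmxA z) -cz' // -mulmxA zz mulmxA idB.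
apply/eqP=> Mb0.
have Mz : gring_op M z = 1%:M.
  apply: zM => _ /mapP[g + ->]; rewrite mem_enum => Gg.
  by rewrite /conj !gring_opM ?envelop_mx_id // bM Mb0 mulmx0 mul0mx.
have M'z : gring_op M' (B *m z) = gring_op M' z.
  by rewrite gring_opM // oneM' mul1mx.
case: (minB (B *m z) ZBz BzBz); first by rewrite mulmxA idB.
  move=> Bz0; have := congr1 (gring_op M) Bz0.
  rewrite gring_opM // oneM mul1mx Mz linear0 => /eqP.
  by have [Mgt0 _] := iffLR (mx_irrP M) irrM; rewrite -mxrank_eq0 mxrank1 eqn0Ngt Mgt0.
move=> BzB; case/eqP: nzM'; have := bM M' => /= <-.
have [zb _] := z0 _ (conjP 1%g (group1 G)).
rewrite /conj invg1 repr_mx1 mulmx1 mul1mx in zb.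
have := congr1 (gring_op M') zb; rewrite gring_opM // -M'z BzB oneM' mul1mx.
by rewrite linear0.
Qed.

End Covering.

(** * Independence of the traces of absolutely irreducible representations *)

Section TraceIndependence.

Variables (F : fieldType) (gT : finGroupType) (G : {group gT}).
Local Notation aG := (regular_repr F G).
Local Notation R_G := (group_ring F G).
Implicit Types M S T U : representation F G.

Lemma gring_mx_ring v : (gring_mx aG v \in R_G)%MS.
Proof. exact: gring_mxP. Qed.

Lemma mul_delta_mx_delta m n k l (X : 'M[F]_(m, n)) (u : 'I_k) (v : 'I_l) i j :
  delta_mx u i *m X *m delta_mx j v = X i j *: delta_mx u v.
Proof.
apply/matrixP=> x y; rewrite -mulmxA mxE (bigD1 i) //= big1 ?addr0 => [|t /negPf neq].
  rewrite !mxE (bigD1 j) //= big1 ?addr0 => [|t /negPf neq].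
    rewrite !mxE !eqxx andbT /=.
    by case: (x == u); case: (y == v); rewrite /= ?mulr1 ?mulr0 ?mul1r ?mul0r.
  by rewrite !mxE neq mulr0.
by rewrite !mxE neq andbF mul0r.
Qed.

Lemma abs_irr_lift U : mx_absolutely_irreducible U ->
  exists2 la : {linear 'M[F]_(rdegree U) -> 'M[F]_#|G|},
    forall X, (la X \in R_G)%MS & forall X, gring_op U (la X) = X.
Proof.
case/andP=> _ fullE.
exists (gring_mx aG \o mulmxr (pinvmx (enveloping_algebra_mx U)) \o mxvec) => X /=.
  exact: gring_mx_ring.
by rewrite gring_op_mx /gring_mx /= mulmxKpV ?mxvecK // submx_full.
Qed.

(** If some A kills U but not T, a non-zero entry of A on T is spread along the diagonal by matrix
    units. Otherwise T factors through the matrix algebra of U by a homomorphism [tau], and the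
    images of one row of matrix units give a non-zero map from U to T. *)
Lemma separate_irr T U :
    mx_absolutely_irreducible T -> mx_absolutely_irreducible U ->
    ~ mx_rsim U T ->
  exists A, [/\ (A \in R_G)%MS, gring_op U A = 0 & gring_op T A = 1%:M].
Proof.
move=> absT absU nsim.
have [laT RT opT] := abs_irr_lift absT; have [la RU opU] := abs_irr_lift absU.
have irrT := mx_abs_irrW absT; have irrU := mx_abs_irrW absU.
have [T_gt0 _] := iffLR (mx_irrP T) irrT; have [U_gt0 _] := iffLR (mx_irrP U) irrU.
have [[A [RA UA0 /matrix0Pn[i [j nzA]]]] | noA] :=
    classic (exists A, [/\ (A \in R_G)%MS, gring_op U A = 0 & gring_op T A != 0]).
  set a := gring_op T A i j in nzA.
  exists (a^-1 *: \sum_k laT (delta_mx k i) *m A *m laT (delta_mx j k)); split.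
  - rewrite linearZ scalemx_sub //= linear_sum summx_sub //= => k _.
    by rewrite !envelop_mxM.
  - rewrite linearZ linear_sum /= big1 ?scaler0 // => k _.
    by rewrite !gring_opM // UA0 mulmx0 mul0mx.
  rewrite linearZ linear_sum /= mx1_sum_delta scaler_sumr.
  apply: eq_bigr => k _; rewrite !gring_opM // !opT.
  rewrite mul_delta_mx_delta -/a.
  by rewrite scalerA mulVf // scale1r.
case: nsim; have vanish A : (A \in R_G)%MS -> gring_op U A = 0 -> gring_op T A = 0.
  by move=> RA UA; apply/eqP; apply: contraT => nz; case: noA; exists A.
pose tau X := gring_op T (la X).
have tauP A : (A \in R_G)%MS -> gring_op T A = tau (gring_op U A).
  move=> RA; apply/eqP; rewrite -subr_eq0 -linearB; apply/eqP/vanish.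
    by rewrite linearB /= addmx_sub // eqmx_opp RU.
  by rewrite linearB /= opU subrr.
have tauM X Y : tau (X *m Y) = tau X *m tau Y.
  rewrite /tau -gring_opM ?RU // -/(tau _) [RHS]tauP ?envelop_mxM ?RU //.
  by rewrite gring_opM ?RU // !opU.
pose i0 := Ordinal U_gt0.
have [v [j nz]] : exists (v : 'rV_(rdegree T)) j, v *m tau (delta_mx i0 j) != 0.
  apply: NNPP => no; have tau0 j : tau (delta_mx i0 j) = 0.
    apply/row_matrixP=> k; rewrite row0 rowE; apply/eqP; apply: contraT => nz.
    by case: no; exists (delta_mx 0 k), j.
  have : tau 1%:M = 0.
    rewrite mx1_sum_delta /tau !linear_sum big1 // => j _.
    transitivity (tau (delta_mx j i0 *m delta_mx i0 j)); first by rewrite mul_delta_mx.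
    by rewrite tauM tau0 mulmx0.
  have R1 : (1%:M \in R_G)%MS by apply: (envelop_mx1 aG).
  rewrite -(gring_op1 U) -tauP // gring_op1 => /eqP.
  by rewrite -mxrank_eq0 mxrank1 eqn0Ngt T_gt0.
pose f : 'M[F]_(rdegree U, rdegree T) := \matrix_k (v *m tau (delta_mx i0 k)).
apply: (irr_hom_rsim (f := f)) => //; last first.
  by apply: contraNneq nz => f0; rewrite -(rowK (fun k => v *m tau (delta_mx i0 k))) -/f f0 row0.
have fE (u : 'rV_(rdegree U)) : u *m f = v *m tau (delta_mx i0 0 *m u).
  rewrite mulmx_sum_row [in RHS](row_sum_delta u) mulmx_sumr /tau !linear_sum /=.
  by apply: eq_bigr => k _; rewrite rowK -scalemxAr mul_delta_mx !linearZ /=.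
move=> x Gx; apply/row_matrixP=> k; rewrite !rowE !mulmxA !fE.
rewrite mulmxA tauM -(gring_opG U Gx) -tauP ?envelop_mx_id // gring_opG //.
by rewrite mulmxA.
Qed.

(** A product of separating elements isolates one representation, on which a lifted matrix unit has
    trace 1. *)
Lemma trace_independence k (T : 'I_k -> representation F G) (c : 'I_k -> F) :
    (forall t, mx_absolutely_irreducible (T t)) ->
    (forall t u, mx_rsim (T t) (T u) -> t = u) ->
    {in G, forall x, \sum_t c t * \tr (T t x) = 0} ->
  forall t, c t = 0.
Proof.
move=> absT nsim tr0 t.
have trA A : (A \in R_G)%MS -> \sum_u c u * \tr (gring_op (T u) A) = 0.
  case/envelop_mxP=> a ->.
  transitivity (\sum_(x in G) a x * \sum_u c u * \tr (T u x)).
    under [RHS]eq_bigr => x _ do rewrite mulr_sumr.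
    rewrite exchange_big; apply: eq_bigr => u _.
    rewrite !linear_sum mulr_sumr; apply: eq_bigr => x Gx /=.
    by rewrite !linearZ /= gring_opG // mulrCA.
  by rewrite big1 // => x Gx; rewrite tr0 // mulr0.
have [A [RA At Au]] : exists A : 'M[F]_#|G|, [/\ (A \in R_G)%MS, gring_op (T t) A = 1%:M
    & forall u, u != t -> gring_op (T u) A = 0].
  have [A [RA At Au]] : exists A : 'M[F]_#|G|, [/\ (A \in R_G)%MS, gring_op (T t) A = 1%:M
      & forall u, u \in enum 'I_k -> u != t -> gring_op (T u) A = 0].
    elim: (enum 'I_k) => [|u us [A [RA At Au]]].
      by exists 1%:M; split=> //; [apply: (envelop_mx1 aG) | rewrite gring_op1].
    have [-> | neq] := eqVneq u t.
      exists A; split=> // u'; rewrite inE => /predU1P[-> | ]; last exact: Au.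
      by rewrite eqxx.
    have [|C [RC uC tC]] := separate_irr (absT t) (absT u).
      by move=> /nsim/eqP; rewrite (negPf neq).
    exists (A *m C); split; first exact: envelop_mxM.
      by rewrite gring_opM // At tC mulmx1.
    move=> u'; rewrite inE => /predU1P[-> _ | us' neq'].
      by rewrite gring_opM // uC mulmx0.
    by rewrite gring_opM // Au // mul0mx.
  by exists A; split=> // u; apply: Au; rewrite mem_enum.
have [laT RT opT] := abs_irr_lift (absT t).
have [T_gt0 _] := iffLR (mx_irrP _) (mx_abs_irrW (absT t)).
pose i0 := Ordinal T_gt0.
have := trA (A *m laT (delta_mx i0 i0)) (envelop_mxM RA (RT _)).
rewrite (bigD1 t) //= big1 => [|u neq]; last first.
  by rewrite gring_opM // Au // mul0mx mxtrace0 mulr0.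
rewrite gring_opM // At mul1mx opT addr0 /mxtrace (bigD1 i0) //= big1 => [|i /negPf neq].
  by rewrite mxE !eqxx addr0 mulr1.
by rewrite mxE neq.
Qed.

End TraceIndependence.

(** * From complex roots of unity to roots of unity in another field *)

(** The cyclotomic polynomial Phi_m is monic and minimal for w, so it divides h over the integers.
    Moreover Phi_m(z) = 0: z is a root of Phi_d for some d dividing m, and then z^d = 1 forces d =
    m. *)
Lemma root_transfer (L : fieldType) m (w : algC) (z : L) (h : {poly int}) :
    m.-primitive_root w -> m.-primitive_root z ->
  root (map_poly intr h) w -> root (map_poly intr h) z.
Proof.
move=> prw prz hw; have m_gt0 := prim_order_gt0 prw.
have root_Phi : root (map_poly intr 'Phi_m) z.
  have := congr1 (fun q : {poly int} => root (map_poly intr q : {poly L}) z) (prod_Cyclotomic m_gt0).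
  rewrite rmorph_prod rmorphB rmorphXn /= map_polyX rmorph1.
  rewrite [in RHS]/root !hornerE prim_expr_order // subrr eqxx.
  move=> /idP; rewrite /root horner_prod prodf_seq_eq0 => /hasP[d dm /= rootd].
  rewrite -dvdn_divisors // in dm.
  have d_gt0 := dvdn_gt0 m_gt0 dm.
  have zd1 : z ^+ d = 1.
    have := congr1 (fun q : {poly int} => (map_poly intr q : {poly L}).[z]) (prod_Cyclotomic d_gt0).
    rewrite (big_rem d) /=; last by rewrite -dvdn_divisors.
    rewrite rmorphM rmorphB rmorphXn /= map_polyX rmorph1 hornerM (rootP rootd) mul0r.
    by rewrite !hornerE => /esym/eqP; rewrite subr_eq0 => /eqP.
  have : (m %| d)%N by rewrite (prim_order_dvd prz) zd1.
  move=> md; have <- : d = m by apply/eqP; rewrite eqn_dvd dm md.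
  exact: rootd.
have PhiM := Cyclotomic_monic m.
have hE := Pdiv.RingMonic.rdivp_eq PhiM h.
set q := Pdiv.CommonRing.rdivp h _ in hE; set r := Pdiv.CommonRing.rmodp h _ in hE.
have szr : (size r < size 'Phi_m)%N.
  by rewrite Pdiv.Ring.ltn_rmodp monic_neq0.
have rw : root (map_poly intr r) w.
  have Phiw : root (map_poly intr 'Phi_m) w.
    by rewrite (Cintr_Cyclotomic prw) root_cyclotomic.
  by move: hw; rewrite hE rmorphD rmorphM /root !hornerE (rootP Phiw) mulr0 add0r.
have r0 : r = 0.
  have [p [minp monp dvdp]] := minCpolyP w.
  have := dvdp (map_poly intr r).
  rewrite -map_poly_comp (eq_map_poly (g := intr)) => [|x]; last by rewrite /= ratr_int.
  rewrite rw => /esym pr.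
  have szp : size p = size 'Phi_m.
    rewrite -(size_map_poly (ratr : {rmorphism rat -> algC})) -minp (minCpoly_cyclotomic prw).
    by rewrite size_cyclotomic size_Cyclotomic.
  apply/eqP; apply: contraTT pr => nz.
  have inj : injective (intr : int -> rat) by apply: intr_inj.
  have nz' : map_poly intr r != 0 :> {poly rat}.
    by rewrite -size_poly_eq0 size_map_inj_poly // size_poly_eq0.
  by apply/negP=> /(dvdp_leq nz'); rewrite szp leqNgt size_map_inj_poly // szr.
by rewrite hE r0 addr0 rmorphM /root !hornerE (rootP root_Phi) mulr0.
Qed.

(** * Characteristic polynomials and traces in exact sequences *)

Section CharPoly.

Variable L : fieldType.

Lemma char_poly_similar n (T A B : 'M[L]_n) :
  T \in unitmx -> T *m A = B *m T -> char_poly A = char_poly B.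
Proof.
move=> uT TA; have dT : \det (map_mx polyC T) != 0.
  by rewrite det_map_mx polyC_eq0 -unitfE -unitmxE.
apply: (mulfI dT); rewrite /char_poly -det_mulmx [RHS]mulrC -det_mulmx.
congr (\det _); rewrite /char_poly_mx mulmxBr mulmxBl -!map_mxM TA.
by rewrite scalar_mxC.
Qed.

Lemma char_poly_block n1 n2 (A : 'M[L]_n1) (C : 'M_(n2, n1)) (B : 'M_n2) :
  char_poly (block_mx A 0 C B) = char_poly A * char_poly B.
Proof.
rewrite /char_poly.
have -> : char_poly_mx (block_mx A 0 C B)
        = block_mx (char_poly_mx A) 0 (- map_mx polyC C) (char_poly_mx B).
  rewrite /char_poly_mx scalar_mx_block map_block_mx opp_block_mx add_block_mx.
  by rewrite map_mx0 oppr0 addr0 add0r.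
exact: det_lblock.
Qed.

Lemma char_poly_diag n (d : 'rV[L]_n) :
  char_poly (diag_mx d) = \prod_i ('X - (d 0 i)%:P).
Proof.
rewrite char_poly_trig ?diag_mx_is_trig //.
by apply: eq_bigr => i _; rewrite mxE eqxx.
Qed.

Lemma exact_block n1 n2 (A1 : 'M[L]_n1) (A : 'M_(n1 + n2)) (A2 : 'M_n2)
    (i : 'M_(n1, n1 + n2)) (q : 'M_(n1 + n2, n2)) :
    A1 *m i = i *m A -> A *m q = q *m A2 -> row_free i -> row_full q ->
    i *m q = 0 ->
  exists2 T, T \in unitmx & exists C, T *m A = block_mx A1 0 C A2 *m T.
Proof.
move=> hi hq fi fq iq0.
pose q' := pinvmx q; have q'q : q' *m q = 1%:M by rewrite mulVpmx.
have [i' ii'] := row_freeP fi.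
exists (col_mx i q').
  rewrite -row_free_unit; apply/row_freeP.
  exists (row_mx (i' - q *m q' *m i') q).
  rewrite mul_col_row !mulmxBr !mulmxA ii' iq0 !mul0mx subr0 q'q mul1mx subrr.
  by rewrite -scalar_mx_block.
have [C defC] : exists C, q' *m A = C *m i + A2 *m q'.
  have : (q' *m A - A2 *m q' <= i)%MS.
    have -> : (i :=: kermx q)%MS.
      apply/eqmxP; have sik : (i <= kermx q)%MS by apply/sub_kermxP.
      rewrite -(mxrank_leqif_eq sik) mxrank_ker (eqP fi) (eqP fq).
      by rewrite addnK.
    apply/sub_kermxP; rewrite mulmxBl -mulmxA hq mulmxA q'q mul1mx.
    by rewrite -mulmxA q'q mulmx1 subrr.
  by case/submxP=> C eqC; exists C; rewrite -eqC subrK.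
by exists C; rewrite mul_col_mx mul_block_col mul0mx addr0 hi defC.
Qed.

Lemma char_poly_exact n1 n n2 (A1 : 'M[L]_n1) (A : 'M_n) (A2 : 'M_n2)
    (i : 'M_(n1, n)) (q : 'M_(n, n2)) :
    A1 *m i = i *m A -> A *m q = q *m A2 -> row_free i -> row_full q ->
    i *m q = 0 -> n = (n1 + n2)%N ->
  char_poly A = char_poly A1 * char_poly A2.
Proof.
move=> hi hq fi fq iq0 defn; subst n.
have [T uT [C TA]] := exact_block hi hq fi fq iq0.
by rewrite (char_poly_similar uT TA) char_poly_block.
Qed.

Lemma trace_exact n1 n n2 (A1 : 'M[L]_n1) (A : 'M_n) (A2 : 'M_n2)
    (i : 'M_(n1, n)) (q : 'M_(n, n2)) :
    A1 *m i = i *m A -> A *m q = q *m A2 -> row_free i -> row_full q ->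
    i *m q = 0 -> n = (n1 + n2)%N ->
  \tr A = \tr A1 + \tr A2.
Proof.
move=> hi hq fi fq iq0 defn; subst n.
have [T uT [C TA]] := exact_block hi hq fi fq iq0.
by rewrite -(mulKmx uT A) TA mxtrace_mulC mulmxK // mxtrace_block.
Qed.

End CharPoly.

(** * Eigenvalues as powers of the lifting root, and Brauer characters *)

Section Spectrum.

Variables (F : fieldType) (m : nat) (beta : brauer_lift F m).
Variables (gT : finGroupType) (N : {group gT}).
Implicit Types M : representation F N.
Local Notation L := (lift_field beta).
Local Notation phi := (Defs.lift_embed beta).
Local Notation z := (lift_root beta).
Local Notation w := (lift_value beta).
Let prz := lift_rootP beta.
Let prw := lift_valueP beta.
Let m_gt0 : (0 < m)%N := prim_order_gt0 prz.

(** A diagonalisation is recorded by exponents, so that the same [d] describes the eigenvalues z^d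
    and their complex lifts w^d. *)
Definition spectrum n (X : 'M[L]_n) (d : 'I_n -> nat) :=
  exists2 T : 'M[L]_n, T \in unitmx &
    T *m X = diag_mx (\row_i z ^+ d i) *m T.

Lemma spectrum_char_poly n (X : 'M[L]_n) d :
  spectrum X d -> char_poly X = \prod_i ('X - (z ^+ d i)%:P).
Proof.
case=> T uT TX; rewrite (char_poly_similar uT TX) char_poly_diag.
by apply: eq_bigr => i _; rewrite mxE.
Qed.

Lemma mup_prod_root (I : finType) (d : I -> nat) (k : nat) : (k < m)%N ->
  mup (z ^+ k) (\prod_i ('X - (z ^+ d i)%:P)) = (\sum_i (d i %% m == k))%N.
Proof.
move=> ltk; rewrite -(big_map (fun i => z ^+ d i) xpredT (fun y => 'X - y%:P)).
rewrite mu_prod_XsubC count_map -sum1_count big_mkcond /=.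
apply: eq_bigr => i _.
by rewrite (eq_prim_root_expr prz) (modn_small ltk); case: ifP.
Qed.

Lemma sum_mup_root (I : finType) (d : I -> nat) :
  \sum_(k < m) (mup (z ^+ k) (\prod_i ('X - (z ^+ d i)%:P)))%:R * w ^+ k
  = \sum_i w ^+ d i.
Proof.
rewrite (eq_bigr (fun k : 'I_m => \sum_i ((d i %% m)%N == k)%:R * w ^+ k)); last first.
  by move=> k _; rewrite mup_prod_root // natr_sum mulr_suml.
rewrite exchange_big; apply: eq_bigr => i _ /=.
rewrite (bigD1 (Ordinal (ltn_pmod (d i) m_gt0))) //= eqxx mul1r big1 => [|k neq].
  by rewrite addr0 (prim_expr_mod prw).
have /negPf -> : (d i %% m)%N != k; last by rewrite mul0r.
by apply: contraNneq neq => e; apply/eqP/val_inj.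
Qed.

Lemma spectrum_brauer_char M x d : spectrum (map_mx phi (M x)) d ->
  brauer_char beta M x = \sum_i w ^+ d i.
Proof.
by move=> specX; rewrite /brauer_char (spectrum_char_poly specX) sum_mup_root.
Qed.

(** The matrix is a root of X^m - 1, which splits over L with the distinct roots z^k. *)
Lemma spectrum_repr_exists M x : x \in N -> (#[x]%g %| m)%N ->
  exists d, spectrum (map_mx phi (M x)) d.
Proof.
move=> Nx; rewrite order_dvdn => /eqP xm; case: M => [[|n] M] /=.
  exists (fun _ => 0%N), 1%:M; first exact: unitmx1.
  by apply/matrixP=> -[].
set X := map_mx phi (M x).
have Xm : X ^+ m = 1.
  by rewrite -rmorphXn -repr_mxX // xm repr_mx1 rmorph1.
have [] := proj2 (diagonalizableP X).
  exists [seq z ^+ k | k <- index_iota 0 m].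
    rewrite map_inj_in_uniq ?iota_uniq // => i j; rewrite !mem_index_iota /= => li lj.
    by move/eqP; rewrite (eq_prim_root_expr prz) !modn_small // => /eqP.
  apply: mxminpoly_min; rewrite big_map (factor_Xn_sub_1 prz).
  by rewrite rmorphB rmorphXn /= horner_mx_X rmorph1 Xm subrr.
move=> T uT /(diagonalizable_forLR uT)[D XE].
have TX : T *m X = diag_mx D *m T.
  rewrite mxpoly.conjumx ?unitmx_inv // invmxK in XE.
  by rewrite [in LHS]XE !mulmxA mulmxV // mul1mx.
have TXj j i : row i T *m X ^+ j = D 0 i ^+ j *: row i T.
  elim: j => [|j IHj]; first by rewrite !expr0 mulmx1 scale1r.
  rewrite exprSr -mulmxE mulmxA IHj -scalemxAl -row_mul TX row_mul row_diag_mx.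
  by rewrite -scalemxAl -rowE scalerA exprSr.
have D1 i : D 0 i ^+ m = 1.
  have := TXj m i; rewrite Xm mulmx1 => /eqP; rewrite -subr_eq0 -{1}[row i T]scale1r.
  rewrite -scalerBl scaler_eq0 => /orP[]; first by rewrite subr_eq0 => /eqP.
  move=> /eqP r0; have fT : row_free T by rewrite row_free_unit.
  have : delta_mx 0 i = 0 :> 'rV[L]_n.+1.
    by apply: (row_free_inj fT); rewrite -rowE r0 mul0mx.
  by move/rowP/(_ i)/eqP; rewrite !mxE !eqxx oner_eq0.
exists (fun i => val (sval (prim_rootP prz (D1 i)))), T => //; rewrite TX.
congr (diag_mx _ *m _); apply/rowP=> i; rewrite mxE.
by case: (prim_rootP prz (D1 i)) => k /= ->.
Qed.

Lemma spectrum_reprX M x d j : x \in N ->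
  spectrum (map_mx phi (M x)) d -> spectrum (map_mx phi (M (x ^+ j)%g)) (fun i => j * d i)%N.
Proof.
move=> Nx [T uT TX]; exists T => //; elim: j => [|j IHj].
  rewrite repr_mx1 map_mx1 mulmx1 (_ : diag_mx _ = 1%:M) ?mul1mx //.
  by rewrite -diag_const_mx; congr diag_mx; apply/rowP=> i; rewrite !mxE expr0.
rewrite expgS repr_mxM ?groupX // map_mxM mulmxA TX -mulmxA IHj mulmxA mulmx_diag.
by congr (diag_mx _ *m _); apply/rowP=> i; rewrite !mxE mulSn exprD.
Qed.

Lemma spectrum_trace n (X : 'M[L]_n) d : spectrum X d -> \tr X = \sum_i z ^+ d i.
Proof.
case=> T uT TX; rewrite -[X](mulKmx uT) TX mxtrace_mulC mulmxK //.
by rewrite mxtrace_diag; apply: eq_bigr => i _; rewrite mxE.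
Qed.

Lemma brauer_char_additive x : x \in N ->
  additive_on_exact (fun M => brauer_char beta M x).
Proof.
move=> Nx; split=> [[n M] /= n0 | M1 M M2 i p exip].
  subst n; rewrite /brauer_char /char_poly det_mx00 big1 // => k _.
  by rewrite mupNroot ?mul0r // root1.
have degM := exact_degree exip; have ip0 := exact_comp0 exip.
have [homi homp fi fp _] := exip.
have cpE := @char_poly_exact L _ _ _ (map_mx phi (M1 x)) (map_mx phi (M x))
  (map_mx phi (M2 x)) (map_mx phi i) (map_mx phi p).
rewrite /brauer_char -big_split; apply: eq_bigr => k _ /=.
rewrite cpE -?map_mxM ?homi ?homp ?ip0 ?map_mx0 ?row_free_map ?row_full_map //.
by rewrite mupM ?monic_neq0 ?char_poly_monic // natrD mulrDl.
Qed.

End Spectrum.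

Lemma rank_diag_mx (L : fieldType) n (e : 'rV[L]_n) :
  \rank (diag_mx e) = #|[set i | e 0 i != 0]|.
Proof.
set k := #|_|; pose f (j : 'I_k) : 'I_n := enum_val j.
pose R : 'M[L]_(k, n) := \matrix_j delta_mx 0 (f j).
have rowR j : row j R = delta_mx 0 (f j) by rewrite rowK.
have RRt : R *m R^T = 1%:M.
  apply/row_matrixP=> j; rewrite row_mul rowR row1; apply/rowP=> j'.
  rewrite mxE (bigD1 (f j)) //= big1 => [|i /negPf neq]; last first.
    by rewrite mxE eqxx /= neq mul0r.
  rewrite addr0 !mxE !eqxx mul1r /= (inj_eq enum_val_inj).
  by rewrite eq_sym.
have RD : R *m diag_mx e = diag_mx (\row_j e 0 (f j)) *m R.
  apply/row_matrixP=> j; rewrite !row_mul rowR row_diag_mx -rowE row_diag_mx.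
  by rewrite -scalemxAl -rowE rowR mxE.
have DR : diag_mx e *m (R^T *m R) = diag_mx e.
  apply/row_matrixP=> i; rewrite row_mul row_diag_mx -scalemxAl.
  have [-> | nz] := eqVneq (e 0 i) 0; first by rewrite !scale0r.
  have iS : i \in [set i | e 0 i != 0] by rewrite inE.
  congr (_ *: _); have <- : f (enum_rank_in iS i) = i by rewrite /f enum_rankK_in.
  by rewrite -rowR mulmxA -row_mul -row_mul RRt mul1mx.
apply/eqP; rewrite eqn_leq; apply/andP; split.
  rewrite -DR mulmxA; exact: mulmx_max_rank.
have uD : diag_mx (\row_j e 0 (f j)) \in unitmx.
  rewrite unitmxE det_diag unitfE; apply/prodf_neq0 => j _; rewrite mxE.
  by have := enum_valP j; rewrite inE.
have := mxrankM_maxl (R *m diag_mx e) R^T; rewrite RD -mulmxA RRt mulmx1.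
move=> le; have := mxrankM_maxr R (diag_mx e); rewrite RD; apply: leq_trans.
by apply: leq_trans le; rewrite (mxrank_unit uD).
Qed.

(** * Brauer characters of Hom modules *)

Section BrauerCharacters.

Variables (F : fieldType) (m : nat) (beta : brauer_lift F m).
Variables (gT : finGroupType) (N : {group gT}).
Implicit Types M : representation F N.
Local Notation L := (lift_field beta).
Local Notation phi := (Defs.lift_embed beta).
Local Notation z := (lift_root beta).
Local Notation w := (lift_value beta).
Let prz := lift_rootP beta.
Let prw := lift_valueP beta.
Let m_gt0 : (0 < m)%N := prim_order_gt0 prz.

(** The inverse of w^d is written with a natural exponent; when m divides d this exponent is m
    instead of 0, which gives the same power. *)
Lemma lift_conj_expr d : (w ^+ d)^* = w ^+ (m - d %% m).
Proof.
rewrite -(prim_expr_mod prw d); have ltd := ltn_pmod d m_gt0.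
have w_unit : w != 0.
  apply/eqP=> w0; have := prim_expr_order prw.
  by rewrite w0 expr0n eqn0Ngt m_gt0 => /eqP; rewrite eq_sym oner_eq0.
apply: (mulfI (expf_neq0 (d %% m) w_unit)); rewrite -exprD subnKC 1?ltnW //.
rewrite (prim_expr_order prw) -normCK normrX.
have -> : `|w| = 1.
  by apply/eqP; rewrite -(@pexpr_eq1 _ _ m) // ?normr_ge0 // -normrX (prim_expr_order prw) normr1.
by rewrite !expr1n.
Qed.

Lemma spectrum_ghom M1 M2 x d1 d2 : x \in N ->
    spectrum (map_mx phi (M1 x)) d1 -> spectrum (map_mx phi (M2 x)) d2 ->
  spectrum (map_mx phi (ghom M1 M2 x))
    (fun u => mxvec (\matrix_(i, j) (m - d1 i %% m + d2 j)%N) 0 u).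
Proof.
move=> Nx [T1 u1 TX1] [T2 u2 TX2].
set X1 := map_mx phi (M1 x) in TX1; set X2 := map_mx phi (M2 x) in TX2.
have X1V : map_mx phi (M1 x^-1%g) *m X1 = 1%:M.
  by rewrite -map_mxM -repr_mxM ?groupV // mulVg repr_mx1 map_mx1.
set Y1 := map_mx phi (M1 x^-1%g) in X1V.
have homE f : mxvec f *m map_mx phi (ghom M1 M2 x) = mxvec (Y1 *m f *m X2).
  suff -> : map_mx phi (ghom M1 M2 x) = lin_mx (mulmx Y1 \o mulmxr X2).
    by rewrite mul_vec_lin /= mulmxA.
  apply/matrixP=> i j; case/mxvec_indexP: i => i1 i2; case/mxvec_indexP: j => j1 j2.
  rewrite !mxE /= !mxvecE !mxE rmorph_sum; apply: eq_bigr => k _.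
  rewrite !mxE rmorphM rmorph_sum; congr (_ * _); apply: eq_bigr => l _.
  by rewrite !mxE rmorphM rmorph_nat.
exists (lin_mx (mulmx (invmx T1) \o mulmxr T2)).
  rewrite -row_free_unit; apply/row_freeP.
  exists (lin_mx (mulmx T1 \o mulmxr (invmx T2))); apply: eq_lin_mx => f.
  by rewrite mulmxA !mul_vec_lin /= mulmx1 !mulmxA mulmxK // mulmxV // mul1mx.
pose D1 := diag_mx (\row_i z ^+ (m - d1 i %% m)).
have D1K : D1 *m diag_mx (\row_i z ^+ d1 i) = 1%:M.
  rewrite mulmx_diag -diag_const_mx; congr diag_mx; apply/rowP=> i; rewrite !mxE.
  rewrite -(prim_expr_mod prz (d1 i)) -exprD subnK ?prim_expr_order //.
  exact/ltnW/ltn_pmod.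
have Y1T : Y1 *m invmx T1 = invmx T1 *m D1.
  have : invmx T1 *m D1 *m (T1 *m X1) = 1%:M.
    by rewrite TX1 mulmxA -(mulmxA _ D1) D1K mulmx1 mulVmx.
  move=> e1; rewrite -[LHS]mul1mx -e1 -!mulmxA (mulmxA X1).
  by rewrite (mulmx1C X1V) mul1mx mulmxV // mulmx1.
apply: eq_lin_mx => f; rewrite !mulmxA !mul_vec_lin /= homE.
have -> : mxvec f *m diag_mx (\row_u z ^+ mxvec (\matrix_(i, j) (m - d1 i %% m + d2 j)%N) 0 u)
        = mxvec (D1 *m f *m diag_mx (\row_j z ^+ d2 j)).
  apply/rowP=> u; case/mxvec_indexP: u => i j.
  rewrite mul_mx_diag !mxE !mxvecE !mxE (bigD1 j) //= big1 => [|k /negPf neq].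
    rewrite addr0 mul_diag_mx !mxE eqxx mulr1n exprD mulrCA -!mulrA; congr (_ * _).
  by rewrite !mxE neq mulr0n mulr0.
rewrite mul_vec_lin /= -!mulmxA -TX2 !mulmxA Y1T.
by rewrite -!mulmxA.
Qed.

Lemma brauer_char_ghom M1 M2 x : x \in N -> (#[x]%g %| m)%N ->
  brauer_char beta (ghom M1 M2) x = (brauer_char beta M1 x)^* * brauer_char beta M2 x.
Proof.
move=> Nx xm; have [d1 s1] := spectrum_repr_exists beta M1 Nx xm.
have [d2 s2] := spectrum_repr_exists beta M2 Nx xm.
rewrite (spectrum_brauer_char s1) (spectrum_brauer_char s2).
rewrite (spectrum_brauer_char (spectrum_ghom Nx s1 s2)).
rewrite (reindex _ (curry_mxvec_bij _ _)) /= rmorph_sum mulr_suml.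
rewrite (eq_bigr (fun u => w ^+ (m - d1 u.1 %% m) * w ^+ d2 u.2)) => [|[i j] _]; last first.
  by rewrite mxvecE mxE exprD.
rewrite -(pair_bigA _ (fun i j => w ^+ (m - d1 i %% m) * w ^+ d2 j)) /=.
by apply: eq_bigr => i _; rewrite mulr_sumr; apply: eq_bigr => j _; rewrite lift_conj_expr.
Qed.

End BrauerCharacters.

(** * Brauer characters of permutation modules *)

Section PermutationCharacter.

Variables (F : fieldType) (m : nat) (beta : brauer_lift F m).
Variables (gT : finGroupType) (N H : {group gT}).
Local Notation L := (lift_field beta).
Local Notation phi := (Defs.lift_embed beta).
Local Notation z := (lift_root beta).
Local Notation w := (lift_value beta).

(** Each coefficient of the difference [Q] is an integer polynomial in the root of unity, so
    [root_transfer] applies to it. *)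
Lemma prod_root_transfer (q : {poly int}) (I : finType) (d : I -> nat) :
    map_poly intr q = \prod_i ('X - (w ^+ d i)%:P) ->
  map_poly intr q = \prod_i ('X - (z ^+ d i)%:P).
Proof.
move=> qE; pose Q : {poly {poly int}} := q^:P - \prod_i ('X - ('X^(d i))%:P).
have evalQ (R : comNzRingType) (a : R) :
    map_poly (fun h : {poly int} => (map_poly intr h).[a]) Q
    = map_poly intr q - \prod_i ('X - (a ^+ d i)%:P).
  pose ev : {rmorphism {poly int} -> R} := horner_eval a \o map_poly intr.
  rewrite -[LHS]/(map_poly ev Q) rmorphB rmorph_prod /= -map_poly_comp.
  congr (_ - _); first by apply: eq_map_poly => c; rewrite /= /horner_eval map_polyC hornerC.
  apply: eq_bigr => i _; rewrite rmorphB /= map_polyX map_polyC /=.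
  by rewrite /horner_eval map_polyXn hornerXn.
have coefQ (R : comNzRingType) (a : R) i :
    (map_poly intr Q`_i).[a] = (map_poly intr q - \prod_i ('X - (a ^+ d i)%:P))`_i.
  by rewrite -evalQ coef_map_id0 //; rewrite rmorph0 horner0.
apply/eqP; rewrite -subr_eq0; apply/eqP/polyP=> i; rewrite -coefQ coef0.
apply/rootP/(root_transfer (lift_valueP beta) (lift_rootP beta)).
by apply/rootP; rewrite coefQ qE subrr coef0.
Qed.

(** The integral permutation matrix is diagonalised over the complex numbers, regarded as a lift
    [lift0] of themselves. Its eigenvalue exponents are valid over L too, so the Brauer character is
    the complex trace, that is, the number of fixed cosets. *)
Lemma brauer_char_coset x : x \in N -> (#[x]%g %| m)%N ->
  brauer_char beta (coset_repr F N H) x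
  = #|[set C in rcosets H N | (C :* x)%g == C]|%:R.
Proof.
move=> Nx xm.
pose Wz : 'M[int]_#|rcosets H N| := \matrix_(i, j) ((enum_val i :* x)%g == enum_val j)%:R.
pose lift0 := BrauerLift (idfun : {rmorphism algC -> algC}) (lift_valueP beta) (lift_valueP beta).
have [d spec] := spectrum_repr_exists lift0 (coset_repr algC N H) Nx xm.
rewrite map_mx_id //= in spec.
have WC : coset_mx algC N H x = map_mx intr Wz.
  by apply/matrixP=> i j; rewrite !mxE rmorph_nat.
have WL : map_mx phi (coset_mx F N H x) = map_mx intr Wz.
  by apply/matrixP=> i j; rewrite !mxE !rmorph_nat.
rewrite /brauer_char /= WL -map_char_poly /=.
rewrite (prod_root_transfer (d := d)); last first.
  by rewrite map_char_poly -WC (spectrum_char_poly spec).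
rewrite sum_mup_root -[LHS](spectrum_trace spec) /mxtrace.
rewrite (eq_bigr (fun i => ((enum_val i :* x)%g == enum_val i)%:R)) => [|i _]; last by rewrite mxE.
rewrite -natr_sum; congr _%:R.
rewrite -(big_enum_val (fun C => nat_of_bool ((C :* x)%g == C))) /=.
rewrite -sum1_card big_mkcond [RHS]big_mkcond /=; apply: eq_bigr => C _.
by rewrite inE; case: (C \in _).
Qed.

End PermutationCharacter.

(** * Traces depend only on the p-regular part *)

Section TraceRegularPart.

Variables (F : fieldType) (p : nat) (gT : finGroupType).
Hypothesis charF : p \in [pchar F].

Lemma trace_additive (N : {group gT}) x : x \in N ->
  additive_on_exact (fun M : representation F N => \tr (M x)).
Proof.
move=> Nx; split=> [[n M] /= n0 | M1 M M2 i q exiq].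
  by subst n; rewrite /mxtrace big_ord0.
have [homi homq fi fq _] := exiq.
by apply: (trace_exact (i := i) (q := q)) => //;
   [apply: homi | apply: homq | apply: exact_comp0 | apply: exact_degree exiq].
Qed.

(** On a simple module of the cyclic group of x, the fixed vectors of the p-part form a non-zero
    submodule, so the p-part acts trivially. *)
Lemma trace_regular_part (N : {group gT}) (M : representation F N) x : x \in N -> \tr (M x) = \tr (M (x.`_p^')%g).
Proof.
move=> Nx; have sAN : (<[x]> \subset N)%g by rewrite cycle_subG.
have Ax := cycle_id x; have Ay : (x.`_p^' \in <[x]>)%g by rewrite mem_cycle.
have [k [T [irrT _ _ addT]]] := composition_factors (restr sAN M).
have /= -> := addT _ _ (trace_additive Ax); have /= -> := addT _ _ (trace_additive Ay).
apply: eq_bigr => j _; congr (\tr _).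
have [T_gt0 irr] := iffLR (mx_irrP _) (irrT j).
pose Q := <[x.`_p]>%G; have QA : (Q <| <[x]>)%g.
  by rewrite -sub_abelian_normal ?cycle_abelian // cycle_subG mem_cycle.
have nz := rfix_pgroup_pchar charF (T j) T_gt0 (p_elt_constt p x) (normal_sub QA).
have := irr _ (normal_rfix_mx_module _ QA) nz; rewrite -sub1mx => /rfix_mxP fixQ.
have Tp : T j (x.`_p)%g = 1%:M by rewrite -[LHS]mul1mx fixQ ?cycle_id.
transitivity (T j (x.`_p * x.`_p^')%g); first by rewrite consttC.
by rewrite repr_mxM ?mem_cycle // Tp mul1mx.
Qed.

End TraceRegularPart.

(** * Representatives of the simple modules *)

Section Representatives.

Variables (F : fieldType) (gT : finGroupType) (N : {group gT}).
Implicit Types M T : representation F N.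

Lemma distinct_representatives K (T0 : 'I_K -> representation F N) :
  exists k (h : 'I_k -> 'I_K),
    (forall t u, mx_rsim (T0 (h t)) (T0 (h u)) -> t = u) /\
    forall j, exists t, mx_rsim (T0 j) (T0 (h t)).
Proof.
suff drop k : (exists h : 'I_k -> 'I_K, forall j, exists t, mx_rsim (T0 j) (T0 (h t))) ->
    exists k (h : 'I_k -> 'I_K),
    (forall t u, mx_rsim (T0 (h t)) (T0 (h u)) -> t = u) /\
    forall j, exists t, mx_rsim (T0 j) (T0 (h t)).
  by apply: (drop K); exists id => j; exists j; apply: mx_rsim_refl.
elim: k => [|k IHk] [h cov].
  by exists 0, h; split=> // -[].
have [[t [u [neq sim]]] | no] :=
    classic (exists t u, t <> u /\ mx_rsim (T0 (h t)) (T0 (h u))); last first.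
  exists k.+1, h; split=> // t u sim; apply: NNPP => neq.
  by case: no; exists t, u.
have [t' tE] : exists t', t = lift u t'.
  by have [t' -> | e] := unliftP u t; [exists t' | case: neq].
apply: IHk; exists (h \o lift u) => j; have [v] := cov j.
have [v' -> simv | -> simu] := unliftP u v; first by exists v'.
by exists t'; rewrite /= -tE; apply: mx_rsim_trans simu (mx_rsim_sym sim).
Qed.

Lemma irreducible_representatives : exists k (T : 'I_k -> representation F N),
  [/\ forall t, mx_irreducible (T t),
      forall t u, mx_rsim (T t) (T u) -> t = u
    & forall M, mx_irreducible M -> exists t, mx_rsim M (T t)].
Proof.
have [Us [compU lastU]] : exists Us : seq 'M[F]_#|N|,
    mx_composition_series (regular_repr F N) Us /\ (last 0 Us :=: 1%:M)%MS.
  (* [mx_Schreier] provides its series only towards a boolean goal. *)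
  apply: NNPP => no; suff: false by [].
  apply: (@mx_Schreier F gT N _ (regular_repr F N) [::]) => // -[V [? ? _]].
  by case: no; exists V.
pose T0 (i : 'I_(size Us)) := Representation (series_repr i compU).
have [k [h [nsim cov]]] := distinct_representatives T0.
exists k, (T0 \o h); split=> // [t | M irrM].
  exact: mx_series_repr_irr.
have [i simi] := rsim_regular_series irrM compU lastU; have [t simt] := cov i.
by exists t; apply: mx_rsim_trans simi simt.
Qed.

End Representatives.

(** * Linear independence of Brauer characters *)

Section LinearIndependence.

Variables (F : fieldType) (p m : nat) (gT : finGroupType) (N : {group gT}).
Hypothesis charF : p \in [pchar F].
Variable beta : brauer_lift F m.
Hypothesis expN : (#|N|`_p^' %| m)%N.
Hypothesis splitN : group_splitting_field F N.
Implicit Types M T : representation F N.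
Local Notation phi := (Defs.lift_embed beta).
Local Notation bc := (brauer_char beta).

Lemma regular_order x : x \in N -> (p^'.-elt x)%g -> (#[x]%g %| m)%N.
Proof.
move=> Nx px; apply: dvdn_trans expN; rewrite -(part_pnat_id px).
by rewrite partn_dvd ?cardG_gt0 ?order_dvdG.
Qed.

(** An integral relation between Brauer characters transfers to a relation between traces over F, on
    p-regular elements and therefore on all of N. Independence of traces makes all coefficients
    divisible by p; dividing by p and repeating, they are divisible by every power of p. *)
Lemma brauer_independence k (T : 'I_k -> representation F N) (n : 'I_k -> int) :
    (forall t, mx_irreducible (T t)) ->
    (forall t u, mx_rsim (T t) (T u) -> t = u) ->
    {in N, forall x, (p^'.-elt x)%g -> \sum_t bc (T t) x *~ n t = 0} ->
  forall t, n t = 0.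
Proof.
move=> irrT nsim; have p_gt1 := prime_gt1 (pcharf_prime charF).
have dvd_p (e : 'I_k -> int) :
    {in N, forall x, (p^'.-elt x)%g -> \sum_t bc (T t) x *~ e t = 0} ->
  forall t, (p %| e t)%Z.
  move=> rel t; rewrite (dvdz_pcharf charF); apply/eqP.
  apply: (trace_independence (T := T) (c := fun t => (e t)%:~R)) => // [u | x Nx].
    exact: splitN.
  set y := (x.`_p^')%g; have Ny : y \in N by rewrite groupX.
  have py : (p^'.-elt y)%g := p_elt_constt _ _.
  have ym := regular_order Ny py.
  have /fin_all_exists[d specd] u := spectrum_repr_exists beta (T u) Ny ym.
  (* Evaluated at w this is the relation at y between Brauer characters, and at z the one between
     traces. *)
  pose h : {poly int} := \sum_u (e u)%:P * \sum_i 'X^(d u i).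
  have hE (R : comNzRingType) (a : R) :
      (map_poly intr h).[a] = \sum_u (\sum_i a ^+ d u i) *~ e u.
    rewrite rmorph_sum horner_sum; apply: eq_bigr => u _.
    rewrite rmorphM /= map_polyC hornerM hornerC rmorph_sum horner_sum /= mulrzl.
    by congr (_ *~ _); apply: eq_bigr => i _; rewrite map_polyXn hornerXn.
  apply: (fmorph_inj phi); rewrite rmorph0 rmorph_sum /=.
  have hw : root (map_poly intr h) (lift_value beta).
    apply/rootP; rewrite hE -[RHS](rel y Ny py); apply: eq_bigr => u _.
    by rewrite (spectrum_brauer_char (specd u)).
  have /rootP := root_transfer (lift_valueP beta) (lift_rootP beta) hw.
  rewrite hE => hz; rewrite -[RHS]hz; apply: eq_bigr => u _.
  rewrite rmorphM rmorph_int mulrzl /=.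
  by rewrite (trace_regular_part charF) // -/y -(spectrum_trace (specd u)) trace_map_mx.
suff dvd_pX j (e : 'I_k -> int) :
    {in N, forall x, (p^'.-elt x)%g -> \sum_t bc (T t) x *~ e t = 0} ->
  forall t, ((p ^ j)%N %| e t)%Z.
  move=> rel t; apply/eqP; rewrite -absz_eq0; apply: contraT => nz.
  (* The exponent |n t| is large enough, since p^|n t| > |n t|. *)
  have := dvd_pX `|n t|%N n rel t; rewrite dvdzE /= => /dvdn_leq.
  by rewrite lt0n => /(_ nz); rewrite leqNgt ltn_expl.
elim: j e => [|j IHj] e rel t; first by rewrite expn0 dvd1z.
have ep u := divzK (dvd_p e rel u).
rewrite -(ep t) expnSr PoszM dvdz_mul //.
apply: (IHj (fun u => (e u %/ p)%Z)) => x Nx px.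
apply: (mulIf (x := p%:R)); first by rewrite pnatr_eq0 -lt0n ltnW.
rewrite mul0r mulr_suml -[RHS](rel x Nx px); apply: eq_bigr => u _.
by rewrite -[in RHS]ep mulrzA mulr_natr pmulrn.
Qed.

(** V stands for a virtual module, with integer weights. Every additive invariant is read off from
    composition multiplicities, and by independence those of V cancel. *)
Lemma virtual_zero (V : seq (int * representation F N))
    (f : representation F N -> algC) : additive_on_exact f ->
    {in N, forall x, (p^'.-elt x)%g -> \sum_(v <- V) bc v.2 x *~ v.1 = 0} ->
  \sum_(v <- V) f v.2 *~ v.1 = 0.
Proof.
move=> addf rel; have [k [T [irrT nsim allT]]] := irreducible_representatives F N.
have [c cP] : exists c : representation F N -> 'I_k -> nat,
    forall M (g : representation F N -> algC), additive_on_exact g ->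
    g M = \sum_t g (T t) *+ c M t.
  suff cM M : exists c : 'I_k -> nat,
      forall g : representation F N -> algC, additive_on_exact g ->
      g M = \sum_t g (T t) *+ c t.
    exact: (ClassicalEpsilon.choice _ cM).
  have [K [U [irrU _ _ addU]]] := composition_factors M.
  have /fin_all_exists[s simU] j := allT _ (irrU j).
  exists (fun t => #|[set j | s j == t]|) => g addg.
  rewrite (addU _ _ addg) (partition_big s xpredT) //=; apply: eq_bigr => t _.
  rewrite -sumr_const; apply: eq_big => [j | j /eqP st]; first by rewrite inE.
  by rewrite (additive_rsim addg (simU j)) st.
have sumE (g : representation F N -> algC) : additive_on_exact g -> \sum_(v <- V) g v.2 *~ v.1
    = \sum_t g (T t) *~ (\sum_(v <- V) v.1 *+ c v.2 t).
  move=> addg; rewrite (eq_bigr _ (fun v _ => congr1 (fun y => y *~ v.1) (cP v.2 g addg))).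
  under eq_bigr => v _ do rewrite mulrz_suml.
  rewrite exchange_big; apply: eq_bigr => t _.
  rewrite mulrz_sumr; apply: eq_bigr => v _.
  by rewrite pmulrn -mulrzA -mulr_natr natz mulrC.
rewrite sumE // big1 // => t _.
pose e t := \sum_(v <- V) v.1 *+ c v.2 t.
rewrite -/(e t) (_ : e t = 0) ?mulr0z //; move: t.
apply: (brauer_independence irrT nsim) => x Nx px.
exact: etrans (esym (sumE _ (brauer_char_additive beta Nx))) (rel x Nx px).
Qed.

Lemma same_brauer_char_rsim M1 M2 :
    mx_irreducible M1 -> mx_irreducible M2 -> same_brauer_char beta p M1 M2 ->
  mx_rsim M1 M2.
Proof.
move=> irr1 irr2 same; apply: NNPP => nsim.
pose T (t : 'I_2) := if t == 0 then M1 else M2.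
pose n (t : 'I_2) : int := if t == 0 then 1 else -1.
suff /(_ 0) : forall t, n t = 0 by [].
apply: (brauer_independence (T := T)) => [t | t u | x Nx px].
- by rewrite /T; case: ifP.
- rewrite /T; have [-> | nt] := eqVneq t 0; have [-> // | nu] := eqVneq u 0.
  - by move=> sim; case: nsim.
  - by move/mx_rsim_sym=> sim; case: nsim.
  by move=> _; apply: val_inj; case: t u nt nu => [[|[|?]] ?] [[|[|?]] ?].
by rewrite !big_ord_recl big_ord0 /= addr0 mulr1z mulrNz mulr1z same // subrr.
Qed.

End LinearIndependence.

(** * Fixed points of cyclic subgroups *)

Section CyclicFixed.

Variables (F : fieldType) (m : nat) (beta : brauer_lift F m).
Variables (gT : finGroupType) (N : {group gT}).
Implicit Types M : representation F N.
Local Notation phi := (Defs.lift_embed beta).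
Local Notation z := (lift_root beta).
Local Notation w := (lift_value beta).
Local Notation bc := (brauer_char beta).
Let prz := lift_rootP beta.
Let prw := lift_valueP beta.

Lemma sum_cycle (V : nmodType) (f : gT -> V) x :
  \sum_(y in <[x]>%g) f y = \sum_(j < #[x]%g) f (x ^+ j)%g.
Proof.
have -> : <[x]>%g = [set (x ^+ j)%g | j : 'I_#[x]%g].
  apply/setP=> y; apply/idP/imsetP => [/cyclePmin[j ltj ->] | [j _ ->]].
    by exists (Ordinal ltj).
  exact: mem_cycle.
rewrite big_imset //= => i j _ _ /eqP; rewrite eq_expg_mod_order.
by rewrite !modn_small // => /eqP/val_inj.
Qed.

Lemma sum_root_powers o d : (0 < o)%N -> (m %| o * d)%N ->
  \sum_(j < o) w ^+ (j * d) = (if (m %| d)%N then o else 0)%:R.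
Proof.
move=> o_gt0 md; have [dm | ndm] := ifP.
  rewrite (eq_bigr (fun _ => 1)) ?sumr_const ?card_ord // => j _.
  by apply/eqP; rewrite -(prim_order_dvd prw) dvdn_mull.
have nz : w ^+ d - 1 != 0 by rewrite subr_eq0 -(prim_order_dvd prw) ndm.
apply: (mulfI nz); rewrite mulr0 -[RHS](subrr 1).
have -> : \sum_(j < o) w ^+ (j * d) = \sum_(j < o) (w ^+ d) ^+ j.
  by apply: eq_bigr => j _; rewrite mulnC exprM.
rewrite -subrX1 -exprM; congr (_ - _); apply/eqP.
by rewrite -(prim_order_dvd prw) mulnC.
Qed.

(** Diagonalise x: over the cyclic group the lifts of powers of an eigenvalue sum to the order of x
    if the eigenvalue is 1, and to 0 otherwise. *)
Lemma cyclic_fixed_rank M x : x \in N -> (#[x]%g %| m)%N ->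
  (#[x]%g * \rank (rfix_mx M <[x]>%g))%:R = \sum_(y in <[x]>%g) bc M y.
Proof.
move=> Nx xm; have [d specd] := spectrum_repr_exists beta M Nx xm.
have mod i : (m %| #[x]%g * d i)%N.
  have [T uT TX] := spectrum_reprX #[x]%g Nx specd.
  rewrite expg_order repr_mx1 map_mx1 mulmx1 in TX.
  have : diag_mx (\row_i z ^+ (#[x]%g * d i)) = 1%:M.
    by rewrite -[LHS](mulmxK uT) -TX mulmxV.
  by move/matrixP/(_ i i)/eqP; rewrite !mxE eqxx mulr1n -(prim_order_dvd prz).
have -> : \sum_(y in <[x]>%g) bc M y = \sum_i (if (m %| d i)%N then #[x]%g else 0)%:R.
  rewrite sum_cycle (eq_bigr (fun j : 'I_#[x]%g => \sum_i w ^+ (j * d i))); last first.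
    by move=> j _; rewrite (spectrum_brauer_char (spectrum_reprX j Nx specd)).
  by rewrite exchange_big; apply: eq_bigr => i _; rewrite sum_root_powers ?order_gt0.
rewrite -natr_sum -big_mkcond sum_nat_const /= mulnC; congr (_ * _)%:R.
have -> : \rank (rfix_mx M <[x]>%g) = \rank (kermx (M x - 1%:M)).
  suff /eqmxP-> : (rfix_mx M <[x]>%g == kermx (M x - 1%:M))%MS by [].
  apply/andP; split.
    apply/sub_kermxP; rewrite mulmxBr mulmx1; apply/eqP; rewrite subr_eq0; apply/eqP.
    by have /rfix_mxP-> := submx_refl (rfix_mx M <[x]>%g); rewrite ?cycle_id.
  apply/rfix_mxP => y /cycleP[j ->]; set K := kermx _.
  have KM : K *m M x = K.
    by apply/eqP; rewrite -subr_eq0 -[X in _ - X]mulmx1 -mulmxBr mulmx_ker.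
  elim: j => [|j IHj]; first by rewrite repr_mx1 mulmx1.
  by rewrite expgS repr_mxM ?groupX // mulmxA KM.
have [T uT TX] := specd.
rewrite mxrank_ker -(mxrank_map phi) map_mxB map_mx1.
have -> : \rank (map_mx phi (M x) - 1%:M) = \rank (diag_mx (\row_i (z ^+ d i - 1))).
  have fT : row_free T by rewrite row_free_unit.
  have/eqmxMfull uTX : row_full T by rewrite row_full_unit.
  rewrite -(uTX _ (_ - _)) -(mxrankMfree (diag_mx _) fT) mulmxBr mulmx1 TX.
  congr (\rank _); apply/matrixP=> i j; rewrite !mul_diag_mx !mxE.
  by rewrite mulrBl mul1r.
rewrite rank_diag_mx -[X in (X - _)%N]card_ord -(cardsC [set i | (m %| d i)%N]).
rewrite -[X in (_ - X)%N](_ : #|~: [set i | (m %| d i)%N]| = _) ?addnK; last first.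
  by apply: eq_card => i; rewrite !inE mxE subr_eq0 -(prim_order_dvd prz).
by apply: eq_card => i; rewrite !inE.
Qed.

End CyclicFixed.

(** * A virtual module with zero Brauer character *)

Section VirtualProduct.

Variables (F : fieldType) (p m : nat) (gT : finGroupType) (N : {group gT}).
Hypothesis charF : p \in [pchar F].
Variable beta : brauer_lift F m.
Hypothesis expN : (#|N|`_p^' %| m)%N.
Hypothesis splitN : group_splitting_field F N.
Implicit Types (M : representation F N) (H : {group gT}).
Local Notation phi := (Defs.lift_embed beta).
Local Notation bc := (brauer_char beta).

Definition fixed_cosets H x := #|[set C in rcosets H N | (C :* x)%g == C]|.

Lemma brauer_char_coset_ghom H M x : x \in N -> (p^'.-elt x)%g ->
  bc (ghom (coset_repr F N H) M) x = (fixed_cosets H x)%:R * bc M x.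
Proof.
move=> Nx px; have xm := regular_order expN Nx px.
by rewrite brauer_char_ghom // brauer_char_coset // rmorph_nat.
Qed.

(** [K] is an additive subgroup modulo which [A] vanishes on the modules Hom(W_x, M): the multiples
    of rank b for the divisibility at q, and 0 for the norm formula. *)
Variables (A : representation F N -> algC) (K : algC -> Prop) (H : gT -> {group gT}).
Hypotheses (addA : additive_on_exact A) (K0 : K 0).
Hypothesis KB : forall u v, K u -> K v -> K (u - v).
Hypothesis KH : {in N, forall x, (p^'.-elt x)%g ->
  forall M, K (A (ghom (coset_repr F N (H x)) M))}.

(* The virtual module prod_x (u_x - W_x) (x) M, where W_x permutes the cosets *)
(* of H x and u_x counts the cosets fixed by x, has zero Brauer character. *)
Lemma coset_product M :
  K (A M * \prod_(x in N | (p^'.-elt x)%g) (fixed_cosets (H x) x)%:R).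
Proof.
have KN u : K u -> K (- u) by move=> Ku; rewrite -sub0r; apply: KB.
have KD u v : K u -> K v -> K (u + v) by move=> Ku Kv; rewrite -[v]opprK; apply/KB/KN.
have KMn u n : K u -> K (u *+ n).
  by move=> Ku; elim: n => [|n IHn]; rewrite ?mulr0n // mulrS; apply: KD.
have KMz u (n : int) : K u -> K (u *~ n).
  by case: n => n Ku; [apply: KMn | rewrite NegzE mulrNz; apply/KN/KMn].
have Ksum (V : seq (int * representation F N)) f :
    (forall M', K (f M')) -> K (\sum_(v <- V) f v.2 *~ v.1).
  by move=> Kf; apply: big_ind => // v _; apply/KMz.
have mulzMn (x : algC) (n : int) u : x *~ (n *+ u) = u%:R * (x *~ n).
  by rewrite -(mulr_natr n u) natz mulrzA -pmulrn mulr_natl.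
pose reg := enum [pred x in N | (p^'.-elt x)%g].
have regP x : x \in reg -> x \in N /\ (p^'.-elt x)%g.
  by rewrite mem_enum => /andP.
(* When the product is expanded, all terms that involve some W_x lie in [K], and the remaining one
   is A M times the integers u_x. *)
suff [V [V0 KV]] : exists V : seq (int * representation F N),
    {in N, forall y, (p^'.-elt y)%g -> \sum_(v <- V) bc v.2 y *~ v.1
       = bc M y * \prod_(x <- reg) ((fixed_cosets (H x) x)%:R - (fixed_cosets (H x) y)%:R)}
    /\ K (\sum_(v <- V) A v.2 *~ v.1 - A M * \prod_(x <- reg) (fixed_cosets (H x) x)%:R).
  move: KV; rewrite (virtual_zero charF (beta := beta) expN splitN addA); last first.
    move=> y Ny py; rewrite V0 //.
    have yr : y \in reg by rewrite mem_enum inE Ny.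
    by rewrite (big_rem y) //= subrr mul0r mulr0.
  by rewrite sub0r => /KN; rewrite opprK big_enum.
elim: reg regP => [|x xs IHxs] regP.
  exists [:: (1, M)]; split=> [y Ny py | ]; rewrite !big_seq1 !big_nil !mulr1 //.
  by rewrite mulr1z subrr.
have [Nx px] := regP x (mem_head _ _).
have [|V [V0 KV]] := IHxs; first by move=> y ys; apply: regP; rewrite inE ys orbT.
set u := fixed_cosets (H x) x.
exists ([seq (v.1 *+ u, v.2) | v <- V]
     ++ [seq (- v.1, ghom (coset_repr F N (H x)) v.2) | v <- V]); split=> [y Ny py | ].
  rewrite big_cat !big_map big_cons /= mulrCA -V0 // mulrBl !mulr_sumr -sumrN.
  congr (_ + _); apply: eq_bigr => v _ /=.
    exact: mulzMn.
  by rewrite brauer_char_coset_ghom // mulrNz -mulrzAr.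
rewrite big_cat !big_map big_cons mulrCA /=.
have -> : \sum_(v <- V) A v.2 *~ (v.1 *+ u) = u%:R * \sum_(v <- V) A v.2 *~ v.1.
  by rewrite mulr_sumr; apply: eq_bigr => v _; apply: mulzMn.
rewrite addrAC -mulrBr; apply: KD; first by rewrite mulr_natl; apply: KMn.
rewrite (eq_bigr (fun v => - (A (ghom (coset_repr F N (H x)) v.2) *~ v.1))) => [|v _]; last first.
  by rewrite mulrNz.
by rewrite sumrN; apply/KN/(Ksum V (fun M' => A (ghom _ M'))) => M'; apply: KH.
Qed.

End VirtualProduct.

(** * A subgroup for which the number of cosets fixed by x is prime to q *)

Section FixedCosets.

Variables (gT : finGroupType) (N : {group gT}).
Local Open Scope group_scope.
Implicit Types (H : {group gT}).

Lemma rcoset_fixed H g x : ((H :* g :* x)%g == (H :* g)%g) = (x \in H :^ g)%g.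
Proof.
by rewrite -rcosetM mem_conjg (sameP eqP rcoset_eqP) mem_rcoset conjgE invgK mulgA.
Qed.

(** Let y be the q'-part of x, M the normaliser in N of its cyclic group, and H the product of that
    cyclic group with a Sylow q-subgroup of M containing the q-part of x. As <y> is a normal Hall
    q'-subgroup of H, a coset Hg fixed by x has g in M; so the fixed cosets are those of H in M
    fixed by the q-part, and their number is |M:H| modulo q. *)
Lemma normaliser_hall_subgroup q x : prime q -> x \in N ->
  exists H, [/\ H \subset N, forall r, r != q -> (r^'.-elt x)%g -> (r^'.-group H)%g
    & ~~ (q %| fixed_cosets N H x)%N].
Proof.
move=> pr_q Nx; set y := (x.`_q^')%g; set xq := (x.`_q)%g.
have Ny : y \in N by rewrite groupX.
pose M := 'N_N(<[y]>)%G; have Mxq : (<[xq]> \subset M)%g.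
  rewrite cycle_subG inE groupX //= (subsetP (cent_sub _)) // cent_cycle.
  apply/cent1P; exact: commuteX2.
have [Q sylQ xqQ] := Sylow_superset Mxq (p_elt_constt q x).
have [sQM qQ _] := and3P sylQ.
have My : y \in M by rewrite inE Ny (subsetP (normG _)) ?cycle_id.
have nyQ : (Q \subset 'N(<[y]>))%g by apply: subset_trans sQM (subsetIr _ _).
pose H := (<[y]> <*> Q)%G; have HE : H = (<[y]> * Q)%g :> {set gT} by exact: norm_joinEr.
have sHM : H \subset M by rewrite join_subG cycle_subG My.
have sHN : H \subset N := subset_trans sHM (subsetIl _ _).
have q'y : (q^'.-group <[y]>)%g := p_elt_constt _ _.
have hallH : (q^'.-Hall(H) <[y]>)%g.
  rewrite pHallE joing_subl /= HE coprime_cardMg; last first.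
    by rewrite coprime_sym (pnat_coprime qQ q'y).
  rewrite partnM ?cardG_gt0 // (part_pnat_id q'y) part_p'nat ?muln1 //.
  by rewrite pnatNK.
have nyH : (<[y]> <| H)%g by rewrite /normal joing_subl join_subG normG nyQ.
exists H; split=> // [r neq r'x | ].
  rewrite HE pgroupM; apply/andP; split.
    exact: p_eltX.
  by apply: (pi_pgroup qQ); rewrite !inE eq_sym.
have -> : fixed_cosets N H x = #|'Fix_(rcosets H M | 'Rs)(<[xq]>)%g|.
  rewrite afix_cycle; apply: eq_card => C; rewrite in_setI [LHS]inE.
  have -> : (C \in 'Fix_'Rs[xq])%g = ((C :* xq)%g == C).
    by apply/afix1P/eqP => /=; rewrite rcosetE.
  apply/andP/andP=> -[/rcosetsP[g Ng ->]]; rewrite !rcoset_fixed => xH; last first.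
    split; first by apply/rcosetsP; exists g => //; case/setIP: Ng.
    rewrite -(consttC q x) groupM // (subsetP _ _ (cycle_id _)) //.
    rewrite -/y -(normP (_ : g \in 'N(<[y]>)%g)) ?conjSg ?joing_subl //.
    by case/setIP: Ng.
  split; last by rewrite groupX.
  apply/rcosetsP; exists g => //; rewrite inE Ng /=.
  have : (y ^ g^-1)%g \in H by rewrite -mem_conjg groupX.
  move=> yH; have := mem_normal_Hall hallH nyH yH; rewrite p_eltJ p_elt_constt => ygy.
  by rewrite -groupV; apply/normP/eqP; rewrite eqEcard cardJg leqnn andbT -cycleJ cycle_subG ygy.
have mod := pgroup_fix_mod (p_elt_constt q x : q.-group <[xq]>)
  (subset_trans Mxq (actsRs_rcosets H M)).
rewrite /dvdn -mod -/(dvdn q _) -/(#|M : H|) -p'natE //.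
have sQH : Q \subset H by rewrite joing_subr.
have [_ _] := and3P sylQ; rewrite -(Lagrange_index sHM sQH).
by rewrite pnatM => /andP[].
Qed.

End FixedCosets.

(** * Arithmetic of rank b away from p, and the norm formula *)

Section BlockDegree.

Variables (F : fieldType) (p m : nat) (gT : finGroupType) (N : {group gT}).
Hypothesis charF : p \in [pchar F].
Variable beta : brauer_lift F m.
Hypothesis expN : (#|N|`_p^' %| m)%N.
Hypothesis splitN : group_splitting_field F N.
Implicit Types (M T : representation F N) (H : {group gT}).
Local Notation bc := (brauer_char beta).

Lemma pgroup_natr_neq0 H : (p^'.-group H)%g -> (#|H|%:R : F) != 0.
Proof. by rewrite /pgroup p'natE ?(pcharf_prime charF) // (dvdn_pcharf charF). Qed.

Lemma brauer_charJ M x g : x \in N -> g \in N -> bc M (x ^ g)%g = bc M x.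
Proof.
move=> Nx Ng; rewrite /brauer_char; set c1 := char_poly _; set c2 := char_poly _.
suff -> : c1 = c2 by [].
apply/esym/(@char_poly_similar _ _ (map_mx (Defs.lift_embed beta) (M g^-1%g))).
  rewrite map_unitmx; exact: repr_mx_unit (groupVr Ng).
by rewrite -!map_mxM -!repr_mxM ?groupJ ?groupV // conjgE !mulgA mulgK.
Qed.

(** Frobenius reciprocity: the fixed-coset count is the trivial character of H induced to N. *)
Lemma sum_fixed_cosets H (f : gT -> algC) : H \subset N ->
    {in N &, forall x g, f (x ^ g)%g = f x} ->
  \sum_(x in N) (fixed_cosets N H x)%:R * f x = #|N : H|%g%:R * \sum_(x in H) f x.
Proof.
move=> sHN fJ.
rewrite (eq_bigr (fun x => \sum_(C in rcosets H N) ((C :* x)%g == C)%:R * f x)); last first.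
  move=> x _; rewrite -mulr_suml -natr_sum; congr (_%:R * _).
  rewrite /fixed_cosets -sum1_card [RHS]big_mkcond [LHS]big_mkcond /=.
  by apply: eq_bigr => C _; rewrite inE; case: (_ \in _).
have -> : #|N : H|%g%:R = \sum_(C in rcosets H N) 1 :> algC by rewrite sumr_const.
rewrite exchange_big mulr_suml; apply: eq_bigr => C CH /=.
have [Ng ->] := repr_rcosets sHN CH; set g := repr C in Ng *; rewrite mul1r.
rewrite (reindex_inj (conjg_inj g)) /= (eq_bigl (mem N)) => [|x]; last by rewrite groupJr.
rewrite (big_setID H) (setIidPr sHN) /= addrC big1 => [|x /setDP[Nx Hx]].
  rewrite add0r; apply: eq_bigr => x Hx.
  have Nx := subsetP sHN x Hx.
  rewrite rcoset_fixed memJ_conjg (fJ x g Nx Ng) (_ : x \in H) ?mul1r //.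
by rewrite rcoset_fixed memJ_conjg (negPf Hx) mul0r.
Qed.

Variable b : 'M[F]_#|N|.
Hypotheses (Zb : (b \in 'Z(group_ring F N))%MS) (idb : b *m b = b).
Variable S : representation F N.
Hypothesis oneS : acts_as_one b S.
Hypothesis uniqS : forall T, mx_irreducible T -> acts_as_one b T -> mx_rsim T S.
Local Notation s := (rdegree S).
Local Notation r := (\rank b).

Lemma op_rank_coset_ghom H M : H \subset N -> (p^'.-group H)%g ->
  (op_rank b (ghom (coset_repr F N H) M) * s = r * hdim S M H)%N.
Proof.
move=> sHN pH; have nzH := pgroup_natr_neq0 pH.
rewrite (op_rank_higman Zb idb uniqS); first by rewrite hdim_coset_ghom.
exact/higman_ghom/higman_coset.
Qed.

Lemma op_rank_self : op_rank b S = s.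
Proof. by rewrite /op_rank oneS mxrank1. Qed.

Lemma scaled_op_rank_additive (c : algC) :
  additive_on_exact (fun M => c * (op_rank b M)%:R).
Proof.
have [nu0 nuD] := op_rank_additive Zb idb; split=> [M M0 | M1 M M2 i q ex].
  by rewrite nu0 ?mulr0.
by rewrite (nuD _ _ _ _ _ ex) natrD mulrDr.
Qed.

(** Take A M = s dim(Mb) and let K consist of the multiples of r. By [op_rank_coset_ghom] the value
    of A at Hom(W_x, M) is r dim Hom_H(S, M), while A S = s^2; k is the product of the fixed-coset
    counts. *)
Lemma block_rank_dvd_prime q : prime q -> q != p ->
  exists2 k, ~~ (q %| k)%N & (r %| s ^ 2 * k)%N.
Proof.
move=> pr_q neq.
have [H HP] : exists H : gT -> {group gT}, forall x, x \in N ->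
    [/\ H x \subset N, (p^'.-elt x)%g -> (p^'.-group (H x))%g
      & ~~ (q %| fixed_cosets N (H x) x)%N].
  apply: (ClassicalEpsilon.choice (fun x (H : {group gT}) => x \in N ->
    [/\ H \subset N, (p^'.-elt x)%g -> (p^'.-group H)%g
      & ~~ (q %| fixed_cosets N H x)%N])) => x; have [Nx | nNx] := boolP (x \in N).
    have [H [sHN pH qH]] := normaliser_hall_subgroup pr_q Nx.
    by exists H => _; split=> //; apply: pH; rewrite eq_sym.
  by exists 1%G => /idPn.
pose k := (\prod_(x in N | (p^'.-elt x)%g) fixed_cosets N (H x) x)%N; exists k.
  rewrite /k; elim/big_rec: _ => [|x n /andP[Nx _]]; first by rewrite dvdn1 neq_ltn prime_gt1 ?orbT.
  by case: (HP x Nx) => _ _ nq nn; rewrite Euclid_dvdM // (negPf nq).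
have [] := coset_product charF beta expN splitN (H := H)
    (K := fun u => exists n : int, u = (r%:Z * n)%:~R) (scaled_op_rank_additive s%:R) _ _ _ S.
- by exists 0; rewrite mulr0.
- by move=> u v [i ->] [j ->]; exists (i - j); rewrite mulrBr rmorphB.
- move=> x Nx px M; have [sHN pH _] := HP x Nx.
  exists (hdim S M (H x)); rewrite -natrM mulnC op_rank_coset_ghom ?pH //.
move=> n; rewrite op_rank_self -natr_prod -!natrM -/k mulnn => /eqP.
rewrite pmulrn eqr_int => /eqP kE.
by rewrite -(@dvdzE r (s ^ 2 * k)%N) kE dvdz_mulr.
Qed.

(** A M is r times the pairing of the Brauer characters of S and M over p-regular elements, minus
    |N| s dim(Mb). On Hom(W, M), with W the permutation module on cosets of <x>, both terms equal r
    |N| dim Hom_<x>(S, M). As x fixes the coset <x>, no fixed-coset count vanishes, so A S = 0. *)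
Lemma block_norm :
  r%:R * (\sum_(x in N | (p^'.-elt x)%g) (bc S x)^* * bc S x) = #|N|%:R * (s ^ 2)%:R.
Proof.
pose f M x := if (p^'.-elt x)%g then (bc S x)^* * bc M x else 0.
pose A M : algC := r%:R * (\sum_(x in N) f M x) - (#|N| * s)%:R * (op_rank b M)%:R.
have addA : additive_on_exact A.
  have [nu0 nuD] := scaled_op_rank_additive (#|N| * s)%:R.
  split=> [M M0 | M1 M M2 i q ex].
    rewrite /A nu0 // subr0 big1 ?mulr0 // => x Nx; rewrite /f.
    have -> : bc M x = 0 by exact: (proj1 (brauer_char_additive beta Nx)).
    by rewrite mulr0 if_same.
  rewrite /A (nuD _ _ _ _ _ ex) opprD addrACA -mulrDr -big_split /=; congr (_ * _ + _).
  apply: eq_bigr => x Nx; rewrite /f; case: ifP => _; last by rewrite addr0.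
  have -> : bc M x = bc M1 x + bc M2 x by exact: (proj2 (brauer_char_additive beta Nx) _ _ _ _ _ ex).
  by rewrite mulrDr.
have fJ M : {in N &, forall x g, f M (x ^ g)%g = f M x}.
  by move=> x g Nx Ng; rewrite /f p_eltJ !brauer_charJ.
have A0 M x : x \in N -> (p^'.-elt x)%g -> A (ghom (coset_repr F N <[x]>) M) = 0.
  move=> Nx px; have sCN : (<[x]> \subset N)%g by rewrite cycle_subG.
  rewrite /A (eq_bigr (fun y => (fixed_cosets N <[x]> y)%:R * f M y)) => [|y Ny]; last first.
    rewrite /f; case: ifP => py; last by rewrite mulr0.
    by rewrite (brauer_char_coset_ghom beta expN) // mulrCA.
  rewrite (sum_fixed_cosets sCN (fJ M)) (eq_bigr (fun y => bc (ghom S M) y)); last first.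
    move=> y Cy; have py : (p^'.-elt y)%g by apply: mem_p_elt Cy.
    by rewrite /f py brauer_char_ghom ?(subsetP sCN) // (regular_order expN) ?(subsetP sCN).
  rewrite -(cyclic_fixed_rank beta) ?(regular_order expN) // -!natrM -mulnA (mulnC s).
  rewrite op_rank_coset_ghom // -/(hdim S M _) (mulnA #|N : _|%g) (mulnC _ #[x]%g) Lagrange //.
  by rewrite mulnCA subrr.
have /eqP : A S * \prod_(x in N | (p^'.-elt x)%g) (fixed_cosets N <[x]> x)%:R = 0.
  apply: (coset_product charF beta expN splitN (A := A) (K := fun u => u = 0)
    (H := fun x => <[x]>%G)) => // [u v -> -> | x Nx px M]; first by rewrite subr0.
  exact: A0.
rewrite mulf_eq0 => /orP[ | /prodf_eq0]; last first.
  case=> x /andP[Nx px]; rewrite pnatr_eq0 => /eqP/card0_eq/(_ <[x]>%g).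
  by rewrite [LHS]inE (group_mem_rcosets N <[x]>%G) rcoset_id ?cycle_id // eqxx.
rewrite subr_eq0 /f -big_mkcondr => /eqP ->.
by rewrite op_rank_self natrM -mulrA -natrM mulnn.
Qed.

End BlockDegree.

(** * A divisibility of ranks from p-group orbits in characteristic p *)

Lemma sum_orbit_ind (aT : finGroupType) (T : finType) (to : {action aT &-> T})
    (K : {group aT}) (V : nmodType) (I : V -> Prop) (F : T -> V) :
    I 0 -> (forall u v, I u -> I v -> I (u + v)) ->
    (forall k x, k \in K -> F (to x k) = F x) ->
    (forall x, I (F x *+ #|orbit to K x|)) ->
  I (\sum_x F x).
Proof.
move=> I0 ID FK IF; rewrite (partition_big (orbit to K) xpredT) //=.
apply: big_ind => // O _.
case: (pickP (fun x => orbit to K x == O)) => [x0 /eqP <- | no]; last by rewrite big_pred0.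
rewrite (eq_bigl (fun x => x \in orbit to K x0)) => [|x]; last exact: (sameP eqP orbit_eqP).
rewrite (eq_bigr (fun _ => F x0)) ?sumr_const // => x /orbitP[k Kk <-].
exact: FK.
Qed.

(** Write r = p^v r' with r' prime to p. By Frobenius (1 + X)^r = (1 + X^(p^v))^r', whose
    coefficient at p^v is r'. *)
Lemma coef_exp_pchar (L : fieldType) p r : p \in [pchar L] -> (0 < r)%N ->
  exists2 v, (p ^ v %| r)%N & (('X + 1) ^+ r : {poly L})`_(p ^ v) != 0.
Proof.
move=> charL r_gt0; have pr_p := pcharf_prime charL.
set v := logn p r; exists v; first exact: pfactor_dvdnn.
rewrite -(partnC p r_gt0) p_part -/v; set r' := (r`_p^')%N.
have p'r' : ~~ (p %| r')%N by rewrite -p'natE // part_pnat.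
have pcharX : p \in [pchar {poly L}] by rewrite (rmorph_pchar (@polyC L)).
have r'_gt0 : (0 < r')%N by apply: part_gt0.
rewrite exprM exprDn_pchar ?expr1n; last by rewrite (eq_pnat _ (pcharf_eq pcharX)) pnatX pnat_id.
rewrite addrC exprDn coef_sum (bigD1 (lift ord0 (Ordinal r'_gt0))) //=.
rewrite big1 ?addr0 => [|i /eqP neq].
  rewrite expr1n mul1r expr1 coefMn coefXn eqxx bin1.
  by rewrite -(dvdn_pcharf charL).
rewrite expr1n mul1r -exprM coefMn coefXn -[X in X == _]muln1 eqn_pmul2l ?expn_gt0 ?prime_gt0 //.
case: eqP => [e|]; last by rewrite mul0rn.
by case: neq; apply: val_inj.
Qed.

Section RankOrbits.

Variables (L : fieldType) (p n R j : nat) (K : {group 'S_n}).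
Hypotheses (charL : p \in [pchar L]) (pK : (p.-group K)%g).
Variables (A : 'I_n -> 'M[L]_R) (I : {set 'I_R}).
Hypothesis AK : {in K, forall s : 'S_n, exists2 W : 'M_R, W \in unitmx &
  forall i, W *m A (s i) = A i *m W}.
Hypothesis orbK : forall i, (p ^ j %| #|orbit 'P%act K i|)%N.
Hypothesis diagA : exists2 T : 'M_R, T \in unitmx &
  T *m (\sum_i A i) = diag_mx (\row_i (i \in I)%:R) *m T.

Local Notation cst := (map_mx (@mpolyC n L)).
Let Mx : 'M[{mpoly L[n]}]_R := 1%:M + \sum_i 'X_i *: cst (A i).

Lemma msym_det s : s \in K -> msym s (\det Mx) = \det Mx.
Proof.
case/AK=> W uW WA.
have dW : \det (cst W) != 0.
  rewrite det_map_mx mpolyC_eq0 -unitfE -unitmxE //.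
apply: (mulIf dW); rewrite -det_map_mx -det_mulmx mulrC -det_mulmx; congr (\det _).
rewrite mulmxDr map_mxD mulmxDl map_mx1 mulmx1 mul1mx; congr (_ + _).
rewrite raddf_sum mulmx_suml [in RHS](reindex_inj (@perm_inj _ s)) mulmx_sumr /=.
apply: eq_bigr => i _; rewrite map_mxZ /=.
rewrite (_ : map_mx _ (cst (A i)) = cst (A i)); last first.
  by apply/matrixP=> k l; rewrite !mxE /= /msym mmapC.
have -> : msym s 'X_i = 'X_(s i) :> {mpoly L[n]} by rewrite /msym mmapX mmap1U.
by rewrite -scalemxAl -scalemxAr -!map_mxM WA.
Qed.

(** The polynomial det(1 + sum X_i A_i) is invariant under K because conjugations permute the A_i,
    and it becomes (1 + X)^|I| when all variables are set to X. The coefficient at p^v, v the p-adic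
    valuation of |I|, is non-zero, whereas modulo p only K-invariant monomials contribute; their
    degrees are divisible by p^j, so j <= v. *)
Lemma rank_dvd_orbits : (p ^ j %| #|I|)%N.
Proof.
have [-> | I_gt0] := posnP #|I|; first exact: dvdn0.
have [v pvI nz] := coef_exp_pchar charL I_gt0.
apply: contraR nz => ndv; apply/eqP; have {}ndv : ~~ (p ^ j %| p ^ v)%N.
  by apply: contra ndv => /dvdn_trans; apply.
pose ev : {rmorphism {mpoly L[n]} -> {poly L}} := mmap (@polyC L) (fun _ : 'I_n => 'X).
have -> : ('X + 1) ^+ #|I| = ev (\det Mx).
  rewrite -det_map_mx; have [T uT TA] := diagA.
  have dT : \det (map_mx (@polyC L) T) != 0.
    by rewrite det_map_mx polyC_eq0 -unitfE -unitmxE.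
  have evM : map_mx ev Mx = 1%:M + 'X *: map_mx (@polyC L) (\sum_i A i).
    rewrite map_mxD map_mx1 raddf_sum [in RHS]raddf_sum scaler_sumr; congr (_ + _).
    apply: eq_bigr => i _; apply/matrixP=> k l; rewrite !mxE /=.
    by rewrite mulrC mul_mpolyC mmapZ mmapX mmap1U mulrC.
  apply: (mulIf dT); rewrite [RHS]mulrC -det_mulmx evM mulmxDr mulmx1 -scalemxAr -map_mxM TA.
  pose e : 'rV[{poly L}]_R := \row_i (1 + 'X * (i \in I)%:R).
  have -> : map_mx (@polyC L) T + 'X *: map_mx (@polyC L) (diag_mx (\row_i (i \in I)%:R) *m T)
          = diag_mx e *m map_mx (@polyC L) T.
    apply/matrixP=> i k; rewrite !mul_diag_mx !mxE rmorphM rmorph_nat mulrDl mul1r.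
    by rewrite mulrA.
  rewrite det_mulmx det_diag; congr (_ * _); rewrite (bigID (mem I)) /= [X in _ * X]big1 ?mulr1.
    by rewrite -prodr_const; apply: eq_bigr => i iI; rewrite mxE iI mulr1 addrC.
  by move=> i /negPf iI; rewrite mxE iI mulr0 addr0.
rewrite -[ev _]/(mmap (@polyC L) (fun _ : 'I_n => 'X) _).
rewrite (mmapE (f := polyC) (msize (\det Mx))) // coef_sum.
(* The coefficient of X^(p^v) is the sum of the coefficients of all monomials of degree p^v, which K
   permutes. *)
pose b := msize (\det Mx); pose F (m : 'X_{1..n < b}) :=
  if mdeg m == (p ^ v)%N then (\det Mx)@_m else 0.
rewrite (eq_bigr F) => [|m _]; last first.
  rewrite /mmap1 prodrXr -mdegE coefCM coefXn mulr_natr /F eq_sym.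
  by case: eqP.
have bP (m : 'X_{1..n < b}) (s : 'S_n) : (mdeg [multinom (m : 'X_{1..n}) (s i) | i < n] < b)%N.
  by rewrite mdeg_mperm bmdeg.
pose act_fun (m : 'X_{1..n < b}) (s : 'S_n) := BMultinom (bP m (s^-1)%g).
have act1 m : act_fun m 1%g = m.
  by apply: val_inj; rewrite /= invg1 mperm1.
have actM m s t : act_fun m (s * t)%g = act_fun (act_fun m s) t.
  by apply: val_inj; rewrite /= invMg mpermM.
pose to := TotalAction act1 actM.
apply: (sum_orbit_ind (to := to) (K := K) (I := fun u => u = 0)) => //.
- by move=> u w -> ->; rewrite addr0.
- move=> s m Ks; rewrite /F /= mdeg_mperm; case: ifP => // _.
  by rewrite -mcoeff_sym msym_det ?groupV.
move=> m; rewrite /F; case: eqP => degm; last by rewrite mul0rn.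
(* Orbits have p-power length, so those of length divisible by p contribute 0. The others are single
   monomials, with exponents constant on the orbits of K. *)
have [] := boolP (p %| #|orbit to K m|)%N.
  by rewrite (dvdn_pcharf charL) => /eqP e; rewrite -mulr_natr e mulr0.
have pr_p := pcharf_prime charL.
rewrite -p'natE // => p'o; case/negP: ndv; rewrite -degm mdegE.
have o1 : #|orbit to K m| = 1%N.
  apply: (pnat_1 (pi := p)) p'o; rewrite card_orbit.
  by apply: pnat_dvd pK; rewrite dvdn_indexg.
have fixm s : s \in K -> act_fun m s = m.
  move=> Ks; have /card1P[m' oE] := introT eqP o1.
  have mE : m = m' by apply/eqP; have := oE m; rewrite orbit_refl inE => <-.
  by apply/eqP; have := oE (to m s); rewrite mem_orbit // inE -mE => <-.
apply: (sum_orbit_ind (to := perm_action 'I_n) (K := K) (I := fun u => (p ^ j %| u)%N)) => //.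
- by move=> u w; apply: dvdn_add.
- move=> s i Ks; have /(congr1 (fun m : 'X_{1..n < b} => (m : 'X_{1..n}) (s i))) := fixm s Ks.
  by rewrite /= mnmE permK.
move=> i; have -> (a c : nat) : a *+ c = (a * c)%N.
  by elim: c => [|c IHc]; rewrite ?muln0 // mulrS IHc mulnS.
by apply: dvdn_mull; apply: orbK.
Qed.

End RankOrbits.

(** * Orbits of a p-subgroup on the cosets of D *)

Section CosetPermutations.

Variables (gT : finGroupType) (G D : {group gT}).

Definition coset_step (h : gT) (i : 'I_#|rcosets D G|) : 'I_#|rcosets D G| :=
  coset_index G D (enum_val i :* h)%g.

Lemma val_coset_step h i : h \in G -> enum_val (coset_step h i) = (enum_val i :* h)%g.
Proof. by move=> Gh; rewrite coset_indexK // rcosets_rcoset // coset_valP. Qed.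

(* The orbits of a p-subgroup Q of G on D\G are at least as large as #|Q| / #|D|. *)
Lemma coset_orbits p (Q : {group gT}) e d : prime p -> Q \subset G ->
    #|Q| = (p ^ e)%N -> #|D| = (p ^ d)%N ->
  exists K : {group 'S_#|rcosets D G|},
  [/\ (p.-group K)%g,
      {in K, forall s : 'S_#|rcosets D G|, exists2 h, h \in Q & forall i, s i = coset_step h i}
    & forall i, (p ^ (e - d) %| #|orbit 'P%act K i|)%N].
Proof.
move=> pr_p sQG cardQ cardD.
(* The identity is a default outside G, so that [sig] is a total function. *)
have step_inj h : injective (if h \in G then coset_step h else id).
  case: ifP => [Gh i i' eqi | _ i i' //]; have := val_coset_step i Gh.
  rewrite eqi val_coset_step // => eqC.
  by apply: enum_val_inj; rewrite -(rcosetK h (enum_val i)) -eqC rcosetK.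
pose sig h := perm (step_inj h).
have sigE h i : h \in Q -> sig h i = coset_step h i.
  by move=> Qh; rewrite permE (subsetP sQG).
have sigM : {in Q &, {morph sig : h k / (h * k)%g}}.
  move=> h k Qh Qk; apply/permP=> i; rewrite permM !sigE ?groupM //.
  have [Gh Gk] := (subsetP sQG h Qh, subsetP sQG k Qk).
  by apply: enum_val_inj; rewrite !val_coset_step ?groupM // rcosetM.
pose f := Morphism sigM; exists (f @* Q)%G; split.
- apply: morphim_pgroup; by rewrite /pgroup cardQ pnatX pnat_id.
- by move=> s /morphimP[h _ Qh ->]; exists h => // i; apply: sigE.
move=> i; set C := enum_val i; have CG : C \in rcosets D G := coset_valP i.
have -> : #|orbit 'P%act (f @* Q)%g i| = #|orbit 'Rs%act Q C|.
  rewrite -(card_imset _ (@enum_val_inj _ _)); apply: eq_card => C'.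
  apply/imsetP/orbitP => [[i' /orbitP[s /morphimP[h _ Qh ->] <-] ->] | [h Qh <-]].
    by exists h => //=; rewrite /aperm sigE // val_coset_step ?(subsetP sQG) // rcosetE.
  exists (sig h i); last by rewrite sigE // val_coset_step ?(subsetP sQG) //= rcosetE.
  by apply/orbitP; exists (sig h) => //; apply: (mem_morphim f).
have [g Gg defC] := rcosetsP CG.
(* The stabiliser in Q of the coset Dg lies in the conjugate of D by g. *)
have stabD : (#|'C_Q[C | 'Rs]%g| %| #|D|)%N.
  rewrite -(cardJg D g) cardSg //; apply/subsetP=> h /setIP[Qh /astab1P /=].
  by rewrite rcosetE -/C defC -rcoset_fixed => ->.
move: stabD; rewrite cardD => /(dvdn_pfactor _ _ pr_p)[c lecd cardC].
have := card_orbit_stab 'Rs%act Q C; rewrite cardQ cardC => cardO.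
have p_gt1 := prime_gt1 pr_p.
have lece : (c <= e)%N by rewrite -(dvdn_Pexp2l _ _ p_gt1) -cardO dvdn_mull.
suff -> : #|orbit 'Rs%act Q C| = (p ^ (e - c))%N by rewrite dvdn_exp2l ?leq_sub2l.
apply/eqP; rewrite -(eqn_pmul2r (m := p ^ c)) ?expn_gt0 ?(ltnW p_gt1) //.
by rewrite cardO -expnD subnK.
Qed.

End CosetPermutations.

(** * Eigenvalue multiplicities of p-regular elements on S *)

Section EigenvalueMultiplicity.

Variables (F : fieldType) (p m : nat) (gT : finGroupType) (G N D : {group gT}).
Hypothesis charF : p \in [pchar F].
Variable beta : brauer_lift F m.
Hypotheses (sNG : N \subset G) (sDN : D \subset N).
Let sDG := subset_trans sDN sNG.
Local Notation phi := (Defs.lift_embed beta).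
Local Notation z := (lift_root beta).
Variables (a : 'M[F]_#|G|) (M : representation F G) (S : representation F N).
Hypotheses (aD : fixed_by D a) (oneM : gring_op M (rel_trace D a) = 1%:M).
Variables (io : 'M[F]_(rdegree S, rdegree M)) (pi : 'M[F]_(rdegree M, rdegree S)).
Hypotheses (homio : @is_hom F gT N S (restr sNG M) io).
Hypotheses (hompi : @is_hom F gT N (restr sNG M) S pi) (iopi : io *m pi = 1%:M).

(** S is an N-summand of M, where the identity is the trace of [a] from D; so the identity of S is a
    sum of matrices [At] over the cosets of D. A Sylow p-subgroup Q of C_N(x) permutes them and
    commutes with the spectral projection [E] of x, whose rank is the multiplicity. Now
    [rank_dvd_orbits] applies with the orbits of Q on cosets. *)
Lemma eigenvalue_mult_dvd x e f d k : x \in N ->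
    spectrum (map_mx phi (S x)) d ->
    (#|'C_N[x]%g|`_p = p ^ e)%N -> #|D| = (p ^ f)%N ->
  (p ^ (e - f) %| #|[set i | z ^+ d i == z ^+ k]|)%N.
Proof.
move=> Nx [T uT TX] cardC cardD; have pr_p := pcharf_prime charF.
have charL : p \in [pchar lift_field beta] by rewrite (rmorph_pchar phi).
have [Q sylQ] := Sylow_exists p 'C_N[x]%G.
have sQC := pHall_sub sylQ; have sQN : Q \subset N := subset_trans sQC (subsetIl _ _).
have sQG := subset_trans sQN sNG.
have cardQ : #|Q| = (p ^ e)%N by rewrite (card_Hall sylQ).
have [K [pK KQ orbK]] := coset_orbits pr_p sQG cardQ cardD.
set I := [set i | _]; pose J := diag_mx (\row_i (i \in I)%:R) : 'M[lift_field beta]_(rdegree S).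
pose E := invmx T *m J *m T.
have [cA0 opB] := rel_trace_op M sDG aD; rewrite oneM in opB.
set A0 := gring_op M a in cA0 opB.
pose At g := io *m (M g^-1%g *m A0 *m M g) *m pi.
pose A (i : 'I_#|rcosets D G|) := E *m map_mx phi (At (repr (enum_val i))).
apply: (rank_dvd_orbits charL pK (A := A)) => //; last first.
  exists T => //; rewrite -mulmx_sumr.
  have -> : \sum_(i < #|rcosets D G|) map_mx phi (At (repr (enum_val i))) = 1%:M.
    transitivity (map_mx phi (\sum_(i < #|rcosets D G|) At (repr (enum_val i)))).
      apply/matrixP=> u v; rewrite mxE !summxE rmorph_sum; apply: eq_bigr => i _.
      by rewrite mxE.
    rewrite -(big_enum_val (fun C => At (repr C))) /=.
    rewrite -mulmx_suml -mulmx_sumr.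
    by rewrite -opB mulmx1 iopi map_mx1.
  by rewrite mulmx1 /E !mulmxA mulmxV // mul1mx.
move=> s /KQ[h Qh sE]; have [Nh /cent1P cxh] := setIP (subsetP sQC h Qh).
have Gh := subsetP sQG h Qh.
exists (map_mx phi (S h)).
  by rewrite map_unitmx repr_mx_unit.
(* h commutes with x and so preserves its eigenspaces; in an eigenbasis its matrix has no entries
   between different eigenvalues. *)
have EW : map_mx phi (S h) *m E = E *m map_mx phi (S h).
  set W := map_mx phi (S h).
  pose Y := T *m W *m invmx T.
  have YX : Y *m diag_mx (\row_i z ^+ d i) = diag_mx (\row_i z ^+ d i) *m Y.
    have XT : map_mx phi (S x) *m invmx T = invmx T *m diag_mx (\row_i z ^+ d i).
      by rewrite -[LHS]mul1mx -(mulVmx uT) -!mulmxA (mulmxA T) TX mulmxK.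
    rewrite /Y -!mulmxA -XT (mulmxA W) -map_mxM -repr_mxM // (cxh : (h * x = x * h)%g) repr_mxM // map_mxM.
    by rewrite !mulmxA TX.
  have YE : invmx T *m Y *m T *m E = E *m (invmx T *m Y *m T).
    move: {W} Y YX => Y YX.
    have YJ : Y *m J = J *m Y.
      apply/matrixP=> i j; rewrite mul_mx_diag mul_diag_mx !mxE.
      have := congr1 (fun Z : 'M_(rdegree S) => Z i j) YX.
      rewrite mul_mx_diag mul_diag_mx !mxE !inE.
      move=> YXij; have [-> | neq] := eqVneq (z ^+ d i) (z ^+ d j); first by rewrite mulrC.
      suff -> : Y i j = 0 by rewrite mulr0 mul0r.
      by apply: contraNeq neq => nz; apply/eqP/(mulIf nz); rewrite -YXij mulrC.
    by rewrite /E !mulmxA !(mulmxK uT) -!mulmxA (mulmxA Y) YJ -mulmxA.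
  have <- : invmx T *m Y *m T = W by rewrite /Y !mulmxA mulVmx // mul1mx mulmxKV.
  exact: YE.
move=> i; rewrite /A mulmxA EW -[LHS]mulmxA -[RHS]mulmxA -!map_mxM sE val_coset_step //; congr (_ *m map_mx _ _).
have CG := coset_valP i; have [Gg defC] := repr_rcosets sDG CG.
set g := repr (enum_val i) in Gg defC *.
rewrite defC -rcosetM /At rel_trace_coset ?groupM //.
rewrite invMg !repr_mxM ?groupV // !mulmxA.
have ioE := homio Nh; have piE := hompi Nh; rewrite /= in ioE piE.
have ioV : S h *m io *m M h^-1%g = io.
  by rewrite ioE -mulmxA -repr_mxM ?groupV // mulgV repr_mx1 mulmx1.
by rewrite ioV -!mulmxA -piE.
Qed.

End EigenvalueMultiplicity.

(** * rank b divides |D| s^2 *)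

Section BlockRankDivides.

Variables (F : fieldType) (p m : nat) (gT : finGroupType) (N : {group gT}).
Hypothesis charF : p \in [pchar F].
Variable beta : brauer_lift F m.
Hypothesis expN : (#|N|`_p^' %| m)%N.
Hypothesis splitN : group_splitting_field F N.
Local Notation phi := (Defs.lift_embed beta).
Local Notation z := (lift_root beta).
Local Notation w := (lift_value beta).
Local Notation bc := (brauer_char beta).
Let prz := lift_rootP beta.
Let prw := lift_valueP beta.
Variable b : 'M[F]_#|N|.
Hypotheses (Zb : (b \in 'Z(group_ring F N))%MS) (idb : b *m b = b).
Variable S : representation F N.
Hypothesis oneS : acts_as_one b S.
Hypothesis uniqS : forall T : representation F N,
  mx_irreducible T -> acts_as_one b T -> mx_rsim T S.
Variable f : nat.
Hypothesis multS : forall x e d k, x \in N -> (p^'.-elt x)%g ->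
    spectrum (map_mx phi (S x)) d -> (#|'C_N[x]%g|`_p = p ^ e)%N ->
  (p ^ (e - f) %| #|[set i | z ^+ d i == z ^+ k]|)%N.

Lemma brauer_char_centraliser x : x \in N -> (p^'.-elt x)%g ->
  exists2 al, al \in Aint & (p ^ f)%:R * bc S x = (#|'C_N[x]%g|`_p)%N%:R * al.
Proof.
move=> Nx px; have [d specd] := spectrum_repr_exists beta S Nx (regular_order expN Nx px).
rewrite p_part; set e := logn _ _.
have multE k := multS k Nx px specd (p_part p #|'C_N[x]%g|); rewrite -/e in multE.
exists ((p ^ (f - e))%:R * \sum_(k < m)
          (#|[set i | z ^+ d i == z ^+ k]| %/ p ^ (e - f))%N%:R * w ^+ k).
  rewrite rpredM ?rpred_nat // rpred_sum // => k _.
  by rewrite rpredM ?rpred_nat // rpredX // (Aint_prim_root prw).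
rewrite mulrA -natrM -expnD.
(* Subtraction is truncated, and both sides are the maximum of e and f. *)
have -> : (e + (f - e) = f + (e - f))%N by rewrite -!maxnE maxnC.
rewrite expnD natrM -mulrA; congr (_ * _).
rewrite (spectrum_brauer_char specd) mulr_sumr -(sum_mup_root beta d).
apply: eq_bigr => k _; rewrite mulrA -natrM mulnC divnK; last exact: multE.
congr (_%:R * _); rewrite mup_prod_root // -sum1_card [RHS]big_mkcond /=.
apply: eq_bigr => i _; rewrite inE (eq_prim_root_expr prz) (modn_small (ltn_ord k)).
by case: eqP.
Qed.

(** Multiply the norm formula by p^f and group the sum by classes. The class size times |C_N(x)|_p
    is |N|_p times an integer, so the sum is |N|_p times an algebraic integer [Th]. Then r Th = p^f
    s^2 |N|_p' makes Th rational, hence an integer. *)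
Lemma block_rank_dvd_char :
  (\rank b %| p ^ f * rdegree S ^ 2 * #|N|`_p^')%N.
Proof.
pose g x := if (p^'.-elt x)%g then (bc S x)^* * bc S x else 0.
have normE := block_norm charF beta expN splitN Zb idb oneS uniqS.
have gJ : {in N &, forall x h, g (x ^ h)%g = g x}.
  by move=> x h Nx Nh; rewrite /g p_eltJ !brauer_charJ.
rewrite big_mkcondr (sum_by_classes gJ) in normE.
have bcA x : x \in N -> (p^'.-elt x)%g -> bc S x \in Aint.
  move=> Nx px; have [d specd] := spectrum_repr_exists beta S Nx (regular_order expN Nx px).
  rewrite (spectrum_brauer_char specd) rpred_sum // => i _.
  by rewrite rpredX // (Aint_prim_root prw).
have classE C : C \in classes N -> exists2 al, al \in Aint &
    (p ^ f)%:R * (#|C|%:R * g (repr C)) = (#|N|`_p)%N%:R * al.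
  move=> /repr_classesP[Nx defC]; set x := repr C in Nx defC *.
  rewrite /g; case: ifP => px; last by exists 0; rewrite ?rpred0 ?mulr0.
  have [al Aal alE] := brauer_char_centraliser Nx px.
  exists ((#|N|`_p^' %/ #|'C_N[x]%g|`_p^')%N%:R * (al * (bc S x)^*)).
    by rewrite !rpredM ?rpred_nat // Aint_aut bcA.
  rewrite mulrCA (mulrC (bc S x)^*) (mulrA (p ^ f)%:R) alE !mulrA -!natrM; congr (_%:R * _ * _).
  have C_gt0 : (0 < #|'C_N[x]%g|`_p^')%N := part_gt0 _ _.
  apply/eqP; rewrite -(eqn_pmul2r C_gt0) -!mulnA divnK ?partn_dvd ?cardSg ?subsetIl //.
  by rewrite !partnC // defC -index_cent1 mulnC Lagrange ?subsetIl.
have [Th ATh ThE] : exists2 Th, Th \in Aint &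
    (p ^ f)%:R * \sum_(C in classes N) #|C|%:R * g (repr C) = (#|N|`_p)%N%:R * Th.
  rewrite mulr_sumr; elim/big_ind: _ => [|u v [al Aal ->] [al' Aal' ->] | C /classE //].
    by exists 0; rewrite ?rpred0 ?mulr0.
  by exists (al + al'); rewrite ?rpredD ?mulrDr.
have [r0 | r_gt0] := posnP (\rank b).
  move/eqP: normE; rewrite r0 mul0r eq_sym -natrM pnatr_eq0 muln_eq0.
  rewrite (eqn0Ngt #|N|) cardG_gt0 => /eqP->.
  by rewrite muln0 mul0n dvdn0.
have nzr : (\rank b)%:R != 0 :> algC by rewrite pnatr_eq0 -lt0n.
have eqTh : (\rank b)%:R * Th = (p ^ f * rdegree S ^ 2 * #|N|`_p^')%N%:R.
  have nzN : (#|N|`_p)%N%:R != 0 :> algC by rewrite pnatr_eq0 -lt0n part_gt0.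
  apply: (mulfI nzN); rewrite mulrCA -ThE mulrCA normE -!natrM; congr _%:R.
  by rewrite [RHS]mulnCA partnC // -mulnA (mulnC #|N|).
have /Cint_rat_Aint/(_ ATh)/intrP[t tE] : Th \in Crat.
  by rewrite -(mulKf nzr Th) eqTh rpredM ?rpredV ?rpred_nat.
move: eqTh; rewrite tE !pmulrn -intrM => /eqP; rewrite eqr_int => /eqP eqt.
have : ((\rank b)%:Z %| (p ^ f * rdegree S ^ 2 * #|N|`_p^')%N%:Z)%Z by rewrite -eqt dvdz_mulr.
exact.
Qed.

(** The p-part comes from [block_rank_dvd_char], where |N|_p' is prime to p, and the q-parts come
    from [block_rank_dvd_prime]. *)
Lemma block_rank_dvd : prime p -> (0 < p ^ f * rdegree S ^ 2)%N ->
  (\rank b %| p ^ f * rdegree S ^ 2)%N.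
Proof.
move=> pr_p s_gt0; have r_gt0 : (0 < \rank b)%N.
  have := block_rank_dvd_char; rewrite lt0n; apply: contraL => /eqP->.
  by rewrite dvd0n -lt0n muln_gt0 s_gt0 part_gt0.
apply/(dvdn_partP _ r_gt0) => q; rewrite mem_primes => /andP[pr_q _].
have dvq : ((\rank b)`_q %| \rank b)%N := dvdn_part q _.
have [-> {q pr_q dvq} | neq] := eqVneq q p.
  have := dvdn_trans (dvdn_part p _) block_rank_dvd_char.
  rewrite Gauss_dvdl // (@pnat_coprime p) ?part_pnat //.
have [k nqk rk] := block_rank_dvd_prime charF beta expN splitN Zb idb oneS uniqS pr_q neq.
apply: dvdn_mull; have := dvdn_trans dvq rk.
rewrite Gauss_dvdl // (@pnat_coprime q) ?part_pnat //.
by rewrite p'natE.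
Qed.

End BlockRankDivides.

(** * Clifford theory and the conclusion *)

(** S is a simple N-submodule of the b-component of M; by Clifford M is semisimple over N, so S
    splits off. *)
Lemma clifford_summand (F : fieldType) (gT : finGroupType) (G N : {group gT})
    (nNG : (N <| G)%g) (b : 'M[F]_#|N|) (M : representation F G) :
    (b \in 'Z(group_ring F N))%MS -> b *m b = b -> mx_irreducible M ->
    gring_op (restr (normal_sub nNG) M) b != 0 ->
  exists (S : representation F N) (io : 'M[F]_(rdegree S, rdegree M))
         (pi : 'M[F]_(rdegree M, rdegree S)),
  [/\ mx_irreducible S, acts_as_one b S,
      @is_hom F gT N S (restr (normal_sub nNG) M) io,
      @is_hom F gT N (restr (normal_sub nNG) M) S pi
    & io *m pi = 1%:M].
Proof.
move=> Zb idb irrM nzb; set sNG := normal_sub nNG in nzb *; set MN := restr sNG M in nzb *.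
set U := gring_op MN b in nzb.
have modU : mxmodule MN U.
  rewrite -[U]mul1mx; exact: mxmodule_image (op_hom Zb MN) (mxmodule1 _).
have [V simV sVU] : exists2 V : 'M_(rdegree M), mxsimple MN V & (V <= U)%MS.
  apply: NNPP => no; suff: false by [].
  by apply: (mxsimple_exists modU nzb) => ex; case: no.
have [modV nzV _] := simV.
have [X sXG [sumX _]] := Clifford_basis irrM simV.
have semi : mxsemisimple MN (1%:M : 'M_(rdegree M)).
  apply: (intro_mxsemisimple sumX) => x Xx _.
  exact: Clifford_simple simV (subsetP sXG x Xx).
have [W modW fullVW dxVW] := mxsemisimple_reducible semi modV (submx1 _).
have VW0 : (V :&: W)%MS = 0 by apply/mxdirect_addsP.
pose S := Representation (submod_repr modV).
pose io : 'M_(rdegree S, rdegree M) := val_submod 1%:M.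
have hio : @is_hom F gT N S MN io.
  by move=> x Nx /=; rewrite -val_submodE -(val_submodJ modV) // mul1mx.
have fio : row_free io by rewrite /row_free val_submod1.
have sio : (io <= V)%MS by rewrite val_submod1.
exists S, io, (in_submod V (proj_mx V W)); split=> //.
- exact/submod_mx_irr.
- apply: (row_free_inj fio).
  rewrite (hom_gring b hio) mul1mx -/U.
  have /submxP[Y ->] := submx_trans sio sVU.
  by rewrite -mulmxA [U *m U](op_idem Zb idb).
- move=> x Nx /=.
  have sxD : (1%:M <= dom_hom_mx MN (proj_mx V W))%MS.
    by rewrite -fullVW; exact: proj_mx_hom.
  have eqx := hom_mxP sxD x Nx; rewrite !mul1mx in eqx.
  have sPV : (proj_mx V W <= V)%MS by rewrite -[proj_mx _ _]mul1mx proj_mx_sub.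
  by rewrite -(in_submodJ modV _ sPV) -eqx [in_submod V (proj_mx V W)]in_submodE mulmxA -in_submodE.
by rewrite in_submodE mulmxA -in_submodE proj_mx_id // val_submodK.
Qed.

Theorem theorem7p3 (p : nat) (F : fieldType) (gT : finGroupType)
    (G : {group gT}) (charF : p \in [pchar F]%R)
    (splitG : group_splitting_field F G)
    (beta : brauer_lift F (#|G|`_p^')%N) :
  (forall (N : {group gT}) (nNG : (N <| G)%g) (b : 'M[F]_#|N|) (B : 'M[F]_#|G|)
          (D : {group gT}) (l : nat) (c : 'M[nat]_l),
     group_splitting_field F N ->
     is_block b -> is_block B -> covers (normal_sub nNG) B b ->
     is_defect_group B D -> block_l beta p B l -> is_cartan_matrix B c ->
     block_l beta p b 1 -> D \subset N ->
     forall i j : 'I_l, (c i j <= #|D|)%N)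
  /\
  (forall (B : 'M[F]_#|G|) (D : {group gT}) (l : nat) (c : 'M[nat]_l),
     is_block B -> is_defect_group B D -> block_l beta p B l ->
     is_cartan_matrix B c -> (D <| G)%g ->
     forall i j : 'I_l, (c i j <= #|D|)%N).
Proof.
split=> [N nNG b B D l c splitN [Zb idb _ _] blockB cov defD _ cartan lb sDN i j
        | B D l c blockB defD _ cartan nDG]; last first.
  exact: normal_defect_bound charF (defect_pgroup charF defD) _ _ _ splitG blockB defD cartan nDG.
have [ZB idB _ _] := blockB; have [sDG [a aD defB] _] := defD.
have [f cardD] := p_natP (defect_pgroup charF defD).
(* Hence the lift chosen for G also serves N. *)
have expN : (#|N|`_p^' %| #|G|`_p^')%N by rewrite partn_dvd ?cardSg ?normal_sub.
have nzb := cover_nonzero Zb idb blockB cov.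
have [T [irrT _ _] _] := cartan; have [irrM blockM] := irrT i.
have [S [io [pi [irrS oneS hio hpi iopi]]]] := clifford_summand Zb idb irrM (nzb _ irrM blockM).
(* l(b) = 1 gives all simple modules in b the same Brauer character, and over a splitting field this
   determines the module. *)
have uniqS (U : representation F N) : mx_irreducible U -> acts_as_one b U -> mx_rsim U S.
  move=> irrU oneU; apply: (same_brauer_char_rsim charF (beta := beta) expN splitN irrU irrS) => x Nx px.
  have [S1 [_ _ allS1]] := lb; have [k1 e1] := allS1 U irrU oneU.
  by have [k2 e2] := allS1 S irrS oneS; rewrite (e1 x Nx px) (e2 x Nx px) (ord1 k1) (ord1 k2).
have absS := splitN _ _ irrS; have [S_gt0 _] := iffLR (mx_irrP _) irrS.
have oneM : gring_op (T i) (rel_trace D a) = 1%:M by rewrite -defB.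
have D_gt0 : (0 < #|D| * rdegree S ^ 2)%N by rewrite muln_gt0 cardG_gt0 expn_gt0 S_gt0.
have rank_b : (\rank b <= #|D| * rdegree S ^ 2)%N.
  apply: dvdn_leq => //; rewrite cardD in D_gt0 *.
  apply: (block_rank_dvd charF (beta := beta) expN splitN Zb idb oneS uniqS) (pcharf_prime charF) D_gt0.
  move=> x e d k Nx px specd cardC.
  exact: (eigenvalue_mult_dvd charF sDN aD oneM hio hpi iopi k Nx specd cardC cardD).
exact: (cartan_bound sDN splitG ZB idB aD defB Zb idb absS oneS uniqS nzb rank_b cartan).
Qed.
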